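(* Fix a constant rate $R=k/n$ with $R^{-1}$ an integer, and consider random codes with encoding unitary drawn from the 1D brickwork ensemble $\mathfrak B$ on $k$ qudits of dimension $q=2^{n/k}$ (i.e. $n$ physical qubits), at depth $d=\log\frac k\varepsilon+\frac{\log k}{\log\frac1{2\eta}}+\frac{\log(e-1)}{\log\frac1{2\eta}}+1$ with $\eta=\frac q{q^2+1}$ and $0<\varepsilon<k$. For all sufficiently large $n$ the expected Choi error satisfies: (a) for strength-$\vec p$ local Pauli noise, if $1-f(\vec p)-\frac kn>0$ with $f(\vec p)=2\log(\sqrt{p_I}+\sqrt{p_X}+\sqrt{p_Y}+\sqrt{p_Z})$, $$\mathbb E\,\epsilon_{\mathrm{Choi}}\le\Big(2^{-n(1-f(\vec p)-\frac kn)}+\big(\tfrac\varepsilon k\big)^{\frac nk-2}\Big)^{1/4};$$ (b) for strength-$p$ i.i.d. erasure errors, if $1-\log(1+3p)-\frac kn>0$, $$\mathbb E\,\epsilon_{\mathrm{Choi}}\le\Big(2^{-n(1-\log(1+3p)-\frac kn)}+\big(\tfrac\varepsilon k\big)^{\frac nk-2}\Big)^{1/4};$$ (c) for strength-$p$ local amplitude damping noise, if $-\log\big(\frac1{2-p}+\sqrt{\frac p{2-p}}\big)-\frac kn>0$, $$\mathbb E\,\epsilon_{\mathrm{Choi}}\le\Big(2^{-n\left(-\log\left(\frac1{2-p}+\sqrt{\frac p{2-p}}\right)-\frac kn\right)}+\big(\tfrac\varepsilon k\big)^{\frac nk-2}\Big)^{1/4};$$ (d) for strength-$p$ nearest-neighbour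 $ZZ$-coupling noise, if $1-\frac kn-2(1+\frac kn)\log(\sqrt{1-p}+\sqrt p)\ge0$, $$\mathbb E\,\epsilon_{\mathrm{Choi}}\le\Big(2^{-n\left(1-\frac kn-2(1+\frac kn)\log(\sqrt{1-p}+\sqrt p)\right)}+\big(\tfrac\varepsilon k\big)^{\frac nk-2}\Big)^{1/4}.$$
   Context: All logarithms are base 2; $e$ is Euler's number. Brickwork ensemble: $k$ (even) qudits of dimension $q$ on a ring (qudit $k+1$ identified with qudit $1$); $U=U^{[d]}\cdots U^{[1]}$, where layer $l$ is a tensor product of independent Haar-random (or uniform from a unitary 2-design group) two-qudit gates on pairs $\{2i-1,2i\}$ for $l$ odd and $\{2i,2i+1\}$ for $l$ even, $1\le i\le k/2$; $\varepsilon$ is such that $d$ is a positive integer. Each qudit is a group of $n/k$ consecutive physical qubits; one of these carries a logical qubit and the other $n/k-1$ are ancillas in $|0\rangle$. Choi error: $L$ is the $k$-qubit logical system, $S$ the $n$-qubit physical system, $R$ a $k$-qubit reference, $\hat\phi_{LR}$ the maximally entangled state, $\mathcal E(\rho)=U(\rho\otimes|0^{n-k}\rangle\langle0^{n-k}|)U^\dagger$. For a noise channel $\mathcal N$ on $S$, $\epsilon_{\mathrm{Choi}}=\min_{\mathcal D}P(\hat\phi_{LR},[(\mathcal D\circ\mathcal N\circ\mathcal E)_L\otimes I_R](\hat\phi_{LR}))$ over channels $\mathcal D$ to $L$, with $P=\sqrt{1-F^2}$, $F(\rho,\sigma)=\Vert\sqrt\rho\sqrt\sigma\Vert_1$. Expectations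 are over the random $U$. Noise on $n$ qubits (with fixed parameters): Pauli, $\mathcal N=\mathcal N_p^{\otimes n}$, $\mathcal N_p(\rho)=p_I\rho+p_XX\rho X+p_YY\rho Y+p_ZZ\rho Z$, $\vec p=(p_I,p_X,p_Y,p_Z)$ a probability vector. Erasure, $\mathcal N_e^{\otimes n}$, $\mathcal N_e(\rho)=(1-p)\rho+p|2\rangle\langle2|$ with $|2\rangle$ orthogonal to the qubit space. Amplitude damping, $\mathcal N_a^{\otimes n}$, $\mathcal N_a(\rho)=K_0\rho K_0^\dagger+K_1\rho K_1^\dagger$, $K_0=|0\rangle\langle0|+\sqrt{1-p}|1\rangle\langle1|$, $K_1=\sqrt p|0\rangle\langle1|$. $ZZ$-coupling: the composition over $i=1,\dots,n-1$ of the channels $\rho\mapsto(1-p)\rho+pZ_iZ_{i+1}\rho Z_iZ_{i+1}$, for the physical qubits ordered along the line. *)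

(* Defs.v *)
From HB Require Import structures.
From mathcomp Require Export all_boot all_order all_algebra.
From mathcomp Require Export all_classical all_reals all_analysis.
From mathcomp Require Export complex mxtens.

Set Implicit Arguments.
Unset Strict Implicit.
Unset Printing Implicit Defensive.

Import Order.TTheory GRing.Theory Num.Theory.
Import numFieldNormedType.Exports.

Local Open Scope classical_set_scope.
Local Open Scope complex_scope.
Local Open Scope sesquilinear_scope.
Local Open Scope ring_scope.

(** The Hilbert space with orthonormal basis labelled by [T] is C^T; an
    operator on it is a matrix indexed through [enum_rank], so that the
    library's matrix theory applies. Tensor products are obtained by taking
    products of label types: [S * A] for a bipartite system and
    [{ffun 'I_n -> 'I_a}] for [n] particles of dimension [a]. *)

Definition qop (R : realType) (T : finType) := 'M[R[i]]_#|T|.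

Definition entry (R : realType) (T : finType) (A : qop R T) (x y : T) : R[i] :=
  A (enum_rank x) (enum_rank y).

Definition mkop (R : realType) (T : finType) (f : T -> T -> R[i]) : qop R T :=
  \matrix_(i, j) f (enum_val i) (enum_val j).

(* On R[i], [0 <= z] includes "z is real"; hence Hermitianness is implied. *)
Definition psd (R : realType) (n : nat) (A : 'M[R[i]]_n) : Prop :=
  forall u : 'rV[R[i]]_n, 0 <= (u *m A *m u ^t*) 0 0.

(* Functional calculus through the spectral decomposition; it is the positive
   square root when [A] is positive semidefinite. *)
Definition sqrtmx (R : realType) (n : nat) (A : 'M[R[i]]_n) : 'M[R[i]]_n :=
  invmx (spectralmx A) *m diag_mx (map_mx sqrtC (spectral_diag A))
    *m spectralmx A.

Definition trace_norm (R : realType) (n : nat) (A : 'M[R[i]]_n) : R :=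
  complex.Re (\tr (sqrtmx (A ^t* *m A))).

Definition fidelity (R : realType) (n : nat) (rho sigma : 'M[R[i]]_n) : R :=
  trace_norm (sqrtmx rho *m sqrtmx sigma).

Definition purified_distance (R : realType) (n : nat)
    (rho sigma : 'M[R[i]]_n) : R :=
  Num.sqrt (1 - fidelity rho sigma ^+ 2).

(* Phi (x) id_A, computed blockwise in the A-labels. *)
Definition ampl (R : realType) (S S' A : finType) (Phi : qop R S -> qop R S')
    (X : qop R (S * A)%type) : qop R (S' * A)%type :=
  mkop (fun x y =>
    entry (Phi (mkop (fun s t => entry X (s, x.2) (t, y.2)))) x.1 y.1).

Definition completely_positive (R : realType) (S S' : finType)
    (Phi : qop R S -> qop R S') : Prop :=
  forall (r : nat) (X : qop R (S * 'I_r)%type), psd X -> psd (ampl Phi X).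

Definition trace_preserving (R : realType) (S S' : finType)
    (Phi : qop R S -> qop R S') : Prop :=
  forall X : qop R S, \tr (Phi X) = \tr X.

Definition is_channel (R : realType) (S S' : finType)
    (Phi : {linear qop R S -> qop R S'}) : Prop :=
  completely_positive Phi /\ trace_preserving Phi.

(* |phi><phi| for |phi> = #|L|^(-1/2) \sum_l |l>_L |l>_R *)
Definition max_entangled (R : realType) (L : finType) : qop R (L * L)%type :=
  mkop (fun x y => ((x.1 == x.2) && (y.1 == y.2))%:R / #|L|%:R).

(* The minimum over decoding channels is attained, hence it is the infimum. *)
Definition choi_error (R : realType) (L S S' : finType)
    (N : qop R S -> qop R S') (E : qop R L -> qop R S) : R :=
  inf [set x : R | exists2 D : {linear qop R S' -> qop R L}, is_channel D &
    x = purified_distance (max_entangled R L)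
          (ampl (fun rho => D (N (E rho))) (max_entangled R L))].

(* [R[i]^o] is [R[i]] as a normed space over itself, which gives matrices their
   usual topology. *)
Definition borel_mx (R : realType) (n : nat) :=
  g_sigma_algebraType (@open 'M[R[i]^o]_n).

HB.instance Definition _ (R : realType) (n : nat) :=
  Measurable.on (borel_mx R n).

(* The Haar probability measure on the unitary group U(n), as a measure on all
   n x n matrices carried by the unitary ones. *)
Definition is_haar (R : realType) (n : nat) (mu : probability (borel_mx R n) R)
    : Prop :=
  mu [set U : 'M[R[i]]_n | U \is unitarymx] = 1%E /\
  forall (V : 'M[R[i]]_n) (B : set (borel_mx R n)),
    V \is unitarymx -> measurable B ->
    mu [set U : 'M[R[i]]_n | B (V *m U)] = mu B /\
    mu [set U : 'M[R[i]]_n | B (U *m V)] = mu B.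

Definition mx_mean (R : realType) (n p : nat) (mu : probability (borel_mx R n) R)
    (F : 'M[R[i]]_n -> 'M[R[i]]_p) : 'M[R[i]]_p :=
  \matrix_(i, j) Complex (Rintegral mu setT (fun U => complex.Re (F U i j)))
                         (Rintegral mu setT (fun U => complex.Im (F U i j))).

Definition twirl2 (R : realType) (n : nat) (A : 'M[R[i]]_(n * n))
    (U : 'M[R[i]]_n) : 'M[R[i]]_(n * n) :=
  (U *t U) *m A *m (U *t U) ^t*.

(* A finite group of unitaries, listed without repetition, whose uniform second
   moment is that of the Haar measure. Inverses need no separate clause, since
   a finite set of unitaries closed under products is closed under inverses. *)
Definition unitary_2design_group (R : realType) (n : nat)
    (s : seq 'M[R[i]]_n) : Prop :=
  [/\ uniq s, all (fun U => U \is unitarymx) s, 1%:M \in s,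
      (forall U V, U \in s -> V \in s -> U *m V \in s) &
      exists2 mu : probability (borel_mx R n) R, is_haar mu &
        forall A : 'M[R[i]]_(n * n),
          (size s)%:R^-1 *: (\sum_(U <- s) twirl2 A U) = mx_mean mu (twirl2 A)].

Definition is_uniform_on (R : realType) (n : nat) (s : seq 'M[R[i]]_n)
    (mu : probability (borel_mx R n) R) : Prop :=
  forall B : set (borel_mx R n), measurable B ->
    mu B = ((\sum_(U <- s) \1_B U) / (size s)%:R)%:E.

Definition gate_law (R : realType) (n : nat) (mu : probability (borel_mx R n) R)
    : Prop :=
  is_haar mu \/
  exists2 s : seq 'M[R[i]]_n, unitary_2design_group s & is_uniform_on s mu.

(* For a finite family, the product rule for subfamilies follows from the one
   for the full family by taking some of the [B i] equal to [setT]. *)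
Definition mutually_independent (d d' : measure_display)
    (Omega : measurableType d) (T : measurableType d') (R : realType)
    (P : probability Omega R) (I : finType) (X : I -> {RV P >-> T}) : Prop :=
  forall B : I -> set T, (forall i, measurable (B i)) ->
    P (\bigcap_i (X i @^-1` B i)) = (\prod_(i : I) P (X i @^-1` B i))%E.

(** Layers, gates and qudits are numbered from 0. Layer [l] is the
    (l+1)-th one, so for [l] even its i-th gate acts on qudits 2i, 2i+1 and for
    [l] odd on qudits 2i+1, 2i+2 modulo k. *)

Lemma gate_ring_gt0 (k : nat) (i : 'I_(k./2)) : (0 < k)%N.
Proof. by case: k i => // -[]. Qed.

Definition ring_site (k : nat) (i : 'I_(k./2)) (j : nat) : 'I_k :=
  Ordinal (ltn_pmod j (gate_ring_gt0 i)).

Definition gate_fst (k l : nat) (i : 'I_(k./2)) : 'I_k :=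
  ring_site i (i.*2 + odd l)%N.

Definition gate_snd (k l : nat) (i : 'I_(k./2)) : 'I_k :=
  ring_site i (i.*2 + odd l).+1.

(* Tensor product of the gates [g i], placed on the pairs of layer [l]. For even
   [k] these pairs partition the ring. *)
Definition layer_op (R : realType) (k : nat) (Q : finType) (l : nat)
    (g : 'I_(k./2) -> qop R (Q * Q)%type) : qop R {ffun 'I_k -> Q} :=
  mkop (fun x y : {ffun 'I_k -> Q} => \prod_(i < k./2)
    entry (g i) (x (gate_fst l i), x (gate_snd l i))
                (y (gate_fst l i), y (gate_snd l i))).

(* The last layer is the leftmost factor. *)
Definition brickwork_op (R : realType) (k : nat) (Q : finType) (d : nat)
    (g : 'I_d -> 'I_(k./2) -> qop R (Q * Q)%type) : qop R {ffun 'I_k -> Q} :=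
  \big[mulmx/1%:M]_(l < d) layer_op (rev_ord l) (g (rev_ord l)).

Definition brickwork_ensemble (R : realType) (k : nat) (Q : finType) (d : nat)
    (disp : measure_display) (Omega : measurableType disp)
    (P : probability Omega R)
    (g : 'I_d -> 'I_(k./2) -> {RV P >-> borel_mx R #|{: Q * Q}|}) : Prop :=
  [/\ forall l i w, (g l i w : 'M[R[i]]_#|{: Q * Q}|) \is unitarymx,
      mutually_independent (fun li : 'I_d * 'I_(k./2) => g li.1 li.2) &
      exists2 mu : probability (borel_mx R #|{: Q * Q}|) R, gate_law mu &
        forall l i (B : set (borel_mx R #|{: Q * Q}|)), measurable B ->
          distribution P (g l i) B = mu B].

(** Qubit [b] of qudit [a] is the physical qubit [a * m + b]
    ([mxtens_index (a, b)]), where [m = n / k]. *)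

Definition qubits (n : nat) := {ffun 'I_n -> 'I_2}.

Definition group_qubits (k m : nat) (x : qubits (k * m)) :
    {ffun 'I_k -> qubits m} :=
  [ffun a => [ffun b => x (mxtens_index (a, b))]].

Definition on_qubits (R : realType) (k m : nat)
    (U : qop R {ffun 'I_k -> qubits m}) : qop R (qubits (k * m)) :=
  mkop (fun x y => entry U (group_qubits x) (group_qubits y)).

(* [pos a] is the place, inside qudit [a], of the qubit carrying the a-th
   logical qubit. *)
Definition logical_part (k m : nat) (pos : 'I_k -> 'I_m) (x : qubits (k * m)) :
    qubits k :=
  [ffun a => x (mxtens_index (a, pos a))].

Definition ancillas_zero (k m : nat) (pos : 'I_k -> 'I_m) (x : qubits (k * m)) :
    bool :=
  [forall a, forall b, (b != pos a) ==> (x (mxtens_index (a, b)) == 0)].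

(* rho (x) |0><0| on the ancillas *)
Definition with_ancillas (R : realType) (k m : nat) (pos : 'I_k -> 'I_m)
    (rho : qop R (qubits k)) : qop R (qubits (k * m)) :=
  mkop (fun x y => (ancillas_zero pos x && ancillas_zero pos y)%:R *
    entry rho (logical_part pos x) (logical_part pos y)).

Definition encoder (R : realType) (k m : nat) (pos : 'I_k -> 'I_m)
    (U : qop R {ffun 'I_k -> qubits m}) (rho : qop R (qubits k)) :
    qop R (qubits (k * m)) :=
  on_qubits U *m with_ancillas pos rho *m (on_qubits U) ^t*.

Definition pauliX (R : realType) : 'M[R[i]]_2 := delta_mx 0 1 + delta_mx 1 0.
Definition pauliY (R : realType) : 'M[R[i]]_2 :=
  'i *: (delta_mx 1 0 - delta_mx 0 1).
Definition pauliZ (R : realType) : 'M[R[i]]_2 := delta_mx 0 0 - delta_mx 1 1.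

Definition pauli_channel (R : realType) (pI pX pY pZ : R) (rho : 'M[R[i]]_2) :
    'M[R[i]]_2 :=
  pI%:C *: rho + pX%:C *: (pauliX R *m rho *m pauliX R)
    + pY%:C *: (pauliY R *m rho *m pauliY R)
    + pZ%:C *: (pauliZ R *m rho *m pauliZ R).

(* The trace makes rho |-> (1 - p) rho + p |2><2| linear on all operators. *)
Definition erasure_channel (R : realType) (p : R) (rho : 'M[R[i]]_2) :
    'M[R[i]]_3 :=
  (block_mx ((1 - p)%:C *: rho) 0 0 (p%:C * \tr rho)%:M : 'M[R[i]]_(2 + 1)).

Definition damping_K0 (R : realType) (p : R) : 'M[R[i]]_2 :=
  delta_mx 0 0 + (Num.sqrt (1 - p))%:C *: delta_mx 1 1.
Definition damping_K1 (R : realType) (p : R) : 'M[R[i]]_2 :=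
  (Num.sqrt p)%:C *: delta_mx 0 1.

Definition damping_channel (R : realType) (p : R) (rho : 'M[R[i]]_2) :
    'M[R[i]]_2 :=
  damping_K0 p *m rho *m (damping_K0 p) ^t*
    + damping_K1 p *m rho *m (damping_K1 p) ^t*.

(* Phi^{(x) n} for linear [Phi], by expansion in matrix units. *)
Definition local_noise (R : realType) (a b : nat)
    (Phi : 'M[R[i]]_a -> 'M[R[i]]_b) (n : nat)
    (rho : qop R {ffun 'I_n -> 'I_a}) : qop R {ffun 'I_n -> 'I_b} :=
  mkop (fun y y' : {ffun 'I_n -> 'I_b} =>
    \sum_(x : {ffun 'I_n -> 'I_a}) \sum_(x' : {ffun 'I_n -> 'I_a})
      entry rho x x' *
        \prod_(i < n) Phi (delta_mx (x i) (x' i)) (y i) (y' i)).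

Definition site_op (R : realType) (n : nat) (i : 'I_n) (A : 'M[R[i]]_2) :
    qop R (qubits n) :=
  mkop (fun x y : qubits n =>
    [forall j, (j != i) ==> (x j == y j)]%:R * A (x i) (y i)).

Lemma next_site_subproof (n : nat) (i : 'I_n.-1) : (i.+1 < n)%N.
Proof. by rewrite -ltn_predRL. Qed.

Definition this_site (n : nat) (i : 'I_n.-1) : 'I_n := widen_ord (leq_pred n) i.
Definition next_site (n : nat) (i : 'I_n.-1) : 'I_n :=
  Ordinal (next_site_subproof i).

Definition zz_step (R : realType) (p : R) (n : nat) (i : 'I_n.-1)
    (rho : qop R (qubits n)) : qop R (qubits n) :=
  let ZZ := site_op (this_site i) (pauliZ R) *m site_op (next_site i) (pauliZ R)
  in (1 - p)%:C *: rho + p%:C *: (ZZ *m rho *m ZZ).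

Definition zz_noise (R : realType) (p : R) (n : nat) (rho : qop R (qubits n)) :
    qop R (qubits n) :=
  foldr (@zz_step R p n) rho (enum 'I_n.-1).

Definition log2 (R : realType) (x : R) : R := ln x / ln 2.

Definition pauli_f (R : realType) (pI pX pY pZ : R) : R :=
  2 * log2 (Num.sqrt pI + Num.sqrt pX + Num.sqrt pY + Num.sqrt pZ).

Definition brickwork_eta (R : realType) (m : nat) : R :=
  (2 ^ m)%:R / ((2 ^ m)%:R ^+ 2 + 1).

Definition brickwork_depth (R : realType) (m k : nat) (eps : R) : R :=
  log2 (k%:R / eps)
    + log2 k%:R / log2 (1 / (2 * brickwork_eta R m))
    + log2 (expR 1 - 1) / log2 (1 / (2 * brickwork_eta R m))
    + 1.

(* [n0] may depend on the rate and the noise, but not on [eps]: an integer depth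
   forces eps to vary with n, and holding eventually along every choice of
   eps(n) amounts to uniformity in eps. *)
Definition brickwork_choi_bound (R : realType) (m b : nat)
    (noise : forall n : nat, qop R (qubits n) -> qop R {ffun 'I_n -> 'I_b})
    (c : R) : Prop :=
  exists n0 : nat, forall (k : nat) (eps : R) (d : nat), let n := (k * m)%N in
    (0 < k)%N -> ~~ odd k -> (n0 <= n)%N ->
    0 < eps < k%:R -> (0 < d)%N -> d%:R = brickwork_depth m k eps ->
    forall (pos : 'I_k -> 'I_m)
      (disp : measure_display) (Omega : measurableType disp)
      (P : probability Omega R)
      (g : 'I_d -> 'I_(k./2) ->
           {RV P >-> borel_mx R #|{: qubits m * qubits m}|}),
    brickwork_ensemble g ->
    ('E_P[fun w => choi_error (noise n)
             (encoder pos (brickwork_op (fun l i => g l i w)))]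
      <= ((2 `^ (- (n%:R * c)) + (eps / k%:R) `^ (n%:R / k%:R - 2))
            `^ (1 / 4))%:E)%E.

(* Main.v *)
Require Import Defs.
From HB Require Import structures.
From mathcomp Require Import fingroup perm measurable_realfun ring lra zify.
Set Implicit Arguments.
Unset Strict Implicit.
Unset Printing Implicit Defensive.
Import Order.TTheory GRing.Theory Num.Theory.
Import numFieldNormedType.Exports.
Local Open Scope classical_set_scope.
Local Open Scope complex_scope.
Local Open Scope sesquilinear_scope.
Local Open Scope ring_scope.

(** Let K_a be the Kraus operators of the noise, V the encoding isometry,
    M_a = K_a V and lam_a = tr(K_a^* K_a) / 2^n; for the noises considered the
    K_a are orthogonal. Put
      J = 2^-k \sum_(a, b) (lam_a lam_b)^(-1/2) tr(M_b^* M_a M_a^* M_b).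
    Decoding with the operators lam_b^(-1/4) M_b^* Gamma^(-1/2), where
    Gamma = \sum_b lam_b^(-1/2) M_b M_b^*, shows that the fourth power of the
    Choi error is at most J - 1, so by tangent lines of x |-> x^(1/4) only the
    mean of J matters.

    J is a quadratic functional of the projector P = V V^*, and a random gate
    maps an operator on two copies of its qudits into the span of the identity
    and the swap. After every layer the mean of P (x) P is thus a combination of
    strings in {identity, swap}^(k/2), and each further layer contracts a string
    by 5 eta / 2 per domain wall. The noise weighs an identity on a qudit by at
    most w^m relative to a swap. The all-swap string contributes 1 to J, the
    all-identity string (2 w^m)^k = 2^(-n c), and the strings with walls are
    summed by a transfer matrix; their total is of order
    k (5 eta / 2)^(2 (d - 1)), which at the given depth is below
    (eps / k)^(n/k - 2) as soon as k is large. For n/k <= 2 the bound exceeds 1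
    and there is nothing to prove. *)

(** * Bounded measurable complex functions *)

(** The string coefficients admit no induction of their own: a string also receives all strings
    whose surplus walls annihilate in the next layer, and a bound by the number of walls does not
    survive the sum over these. The induction therefore runs on the dual side, on the pairings
    [wall_pair] with test functions [wall_fun b]. For a uniform [b] the test function is the
    normalised trace of the doubled operator against the identity or the swap; both commute with U
    (x) U, so this pairing is conserved exactly, annihilations included. For other [b] it is the
    same away from the walls of [b] and vanishes unless these walls are present; a layer then sends
    it to something dominated by test functions with equally many walls, at the price of eta per
    wall. A non-uniform string on a ring has at least two walls, so the error decays like the square
    of the contraction per layer. The depth formula by itself only controls (2 eta)^(d - 1); the
    surplus decay absorbs all constants once the depth is large, and the depth is forced to be large
    by [k] being large. *)

Section BoundedMeasurable.
Context (R : realType).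
Local Notation C := R[i].

Definition cbounded (T : Type) (M : R) (f : T -> C) : Prop :=
  forall x, `|complex.Re (f x)| <= M /\ `|complex.Im (f x)| <= M.

(** Boundedness is included so that the class is closed under products and every member is
    integrable for any probability. *)
Definition bmeas d (T : measurableType d) (f : T -> C) : Prop :=
  [/\ measurable_fun setT (fun x => complex.Re (f x)),
      measurable_fun setT (fun x => complex.Im (f x)) &
      exists M, cbounded M f].

Lemma cbounded_ge0 (T : Type) (M : R) (f : T -> C) (x : T) :
  cbounded M f -> 0 <= M.
Proof. by move=> /(_ x)[+ _]; apply: le_trans. Qed.

Section Closure.
Context d (T : measurableType d).
Implicit Types f g : T -> C.

Lemma bmeas_cst (c : C) : bmeas (fun _ : T => c).
Proof.
split; [exact: measurable_cst|exact: measurable_cst|].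
exists (`|complex.Re c| + `|complex.Im c|) => x.
by rewrite lerDl lerDr !normr_ge0.
Qed.

Lemma bmeasD f g : bmeas f -> bmeas g -> bmeas (fun x => f x + g x).
Proof.
move=> [f1 f2 [M fM]] [g1 g2 [N gN]]; split.
- under eq_fun do rewrite raddfD; exact: measurable_funD.
- under eq_fun do rewrite raddfD; exact: measurable_funD.
exists (M + N) => x; have [a b] := fM x; have [c e] := gN x.
by rewrite !raddfD; split; apply: (le_trans (ler_normD _ _)); apply: lerD.
Qed.

Lemma ReM (x y : C) : complex.Re (x * y) =
  complex.Re x * complex.Re y - complex.Im x * complex.Im y.
Proof. by case: x; case: y. Qed.

Lemma ImM (x y : C) : complex.Im (x * y) =
  complex.Re x * complex.Im y + complex.Im x * complex.Re y.
Proof. by case: x; case: y. Qed.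

Lemma cboundedM (S : Type) (M N : R) (f g : S -> C) :
  cbounded M f -> cbounded N g -> cbounded (2 * (M * N)) (fun x => f x * g x).
Proof.
move=> fM gN x; have [a b] := fM x; have [c e] := gN x.
rewrite ReM ImM mulr_natl mulr2n.
split; [apply: (le_trans (ler_normB _ _))|apply: (le_trans (ler_normD _ _))];
  by rewrite !normrM; apply: lerD; apply: ler_pM.
Qed.

Lemma bmeasM f g : bmeas f -> bmeas g -> bmeas (fun x => f x * g x).
Proof.
move=> [f1 f2 [M fM]] [g1 g2 [N gN]]; split.
- under eq_fun do rewrite ReM.
  by apply: measurable_funB; apply: measurable_funM.
- under eq_fun do rewrite ImM.
  by apply: measurable_funD; apply: measurable_funM.
by exists (2 * (M * N)); apply: cboundedM.
Qed.

Lemma bmeasZ c f : bmeas f -> bmeas (fun x => c * f x).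
Proof. by move=> ?; apply: bmeasM => //; apply: bmeas_cst. Qed.

Lemma bmeas_conj f : bmeas f -> bmeas (fun x => (f x)^*).
Proof.
move=> [f1 f2 [M fM]].
have Re_ x : complex.Re ((f x)^*) = complex.Re (f x) by case: (f x).
have Im_ x : complex.Im ((f x)^*) = - complex.Im (f x) by case: (f x).
split.
- by under eq_fun do rewrite Re_.
- under eq_fun do rewrite Im_.
  by apply: measurableT_comp => //; apply: measurable_oppr.
by exists M => x; rewrite Re_ Im_ normrN.
Qed.

Lemma bmeas_sum (I : Type) (r : seq I) (Q : pred I) (F : I -> T -> C) :
  (forall i, bmeas (F i)) -> bmeas (fun x => \sum_(i <- r | Q i) F i x).
Proof.
move=> h; elim: r => [|i r IH].
  by under eq_fun do rewrite big_nil; apply: bmeas_cst.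
under eq_fun do rewrite big_cons.
by case: (Q i) => //; apply: bmeasD.
Qed.

Lemma bmeas_prod (I : Type) (r : seq I) (Q : pred I) (F : I -> T -> C) :
  (forall i, bmeas (F i)) -> bmeas (fun x => \prod_(i <- r | Q i) F i x).
Proof.
move=> h; elim: r => [|i r IH].
  by under eq_fun do rewrite big_nil; apply: bmeas_cst.
under eq_fun do rewrite big_cons.
by case: (Q i) => //; apply: bmeasM.
Qed.

Lemma bmeas_indic (B : set T) :
  measurable B -> bmeas (fun x => (\1_B x)%:C).
Proof.
move=> mB; split => /=; [exact: measurable_indic|exact: measurable_cst|].
exists 1 => x /=; rewrite normr0 ler01; split=> //.
by rewrite indicE; case: (_ \in _); rewrite ?normr0 ?normr1 ?ler01.
Qed.

End Closure.

Lemma bmeas_comp d d' (T : measurableType d) (T' : measurableType d')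
    (f : T' -> C) (X : T -> T') :
  bmeas f -> measurable_fun setT X -> bmeas (fun x => f (X x)).
Proof.
move=> [f1 f2 [M fM]] mX; split.
- exact: (measurableT_comp f1 mX).
- exact: (measurableT_comp f2 mX).
by exists M => x; apply: fM.
Qed.

End BoundedMeasurable.
Arguments bmeas_cst {R d T} c.

Section ComplexExpectation.
Context (R : realType) d (T : measurableType d) (P : probability T R).
Local Notation C := R[i].
Implicit Types f g : T -> C.

(** Integrated by real and imaginary parts, exactly like the entries of [mx_mean], so that the
    design property can be read entry by entry. *)
Definition cmean f : C :=
  Complex (Rintegral P setT (fun x => complex.Re (f x)))
          (Rintegral P setT (fun x => complex.Im (f x))).

Lemma bounded_integrable (h : T -> R) (M : R) : measurable_fun setT h ->
  (forall x, `|h x| <= M) -> P.-integrable setT (EFin \o h).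
Proof.
move=> mh hM; apply: measurable_bounded_integrable => //.
  by have := @probability_setT _ _ _ P => /= ->; rewrite ltry.
exists M; split; first exact: num_real.
by move=> y My x _ /=; apply: (le_trans (hM x)); apply: ltW.
Qed.

Lemma bmeas_integrableRe f : bmeas f ->
  P.-integrable setT (EFin \o (fun x => complex.Re (f x))).
Proof.
by move=> [? ? [M fM]]; apply: (bounded_integrable (M := M)) => // x;
  have [] := fM x.
Qed.

Lemma bmeas_integrableIm f : bmeas f ->
  P.-integrable setT (EFin \o (fun x => complex.Im (f x))).
Proof.
by move=> [? ? [M fM]]; apply: (bounded_integrable (M := M)) => // x;
  have [] := fM x.
Qed.

Lemma cmeanD f g : bmeas f -> bmeas g ->
  cmean (fun x => f x + g x) = cmean f + cmean g.
Proof.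
move=> bf bg; apply/eqP; rewrite eq_complex /=; apply/andP; split; apply/eqP.
  under eq_Rintegral do rewrite raddfD.
  by rewrite RintegralD //; exact: bmeas_integrableRe.
under eq_Rintegral do rewrite raddfD.
by rewrite RintegralD //; exact: bmeas_integrableIm.
Qed.

Lemma RintZ (r : R) (h : T -> R) : P.-integrable setT (EFin \o h) ->
  \int[P]_x (r * h x) = r * \int[P]_x h x.
Proof. by move=> ih; rewrite RintegralZl. Qed.

Lemma cmeanZ c f : bmeas f -> cmean (fun x => c * f x) = c * cmean f.
Proof.
move=> bf.
have iR := bmeas_integrableRe bf; have iI := bmeas_integrableIm bf.
have iZ (r : R) (h : T -> R) : P.-integrable setT (EFin \o h) ->
    P.-integrable setT (EFin \o (fun x => r * h x)).
  by move=> /(integrableZl measurableT r).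
apply/eqP; rewrite eq_complex ReM ImM /=; apply/andP; split; apply/eqP.
  under eq_Rintegral do rewrite ReM.
  by rewrite RintegralB //; [rewrite !RintZ|exact: iZ..].
under eq_Rintegral do rewrite ImM.
by rewrite RintegralD //; [rewrite !RintZ|exact: iZ..].
Qed.

Lemma Rint_cst (r : R) : \int[P]_(x in setT) r = r.
Proof.
rewrite Rintegral_cst //; have := @probability_setT _ _ _ P => /= ->.
by rewrite mulr1.
Qed.

Lemma cmean_cst c : cmean (fun=> c) = c.
Proof.
by rewrite /cmean !Rint_cst; case: c.
Qed.

Lemma cmean_sum (I : Type) (r : seq I) (Q : pred I) (F : I -> T -> C) :
  (forall i, bmeas (F i)) ->
  cmean (fun x => \sum_(i <- r | Q i) F i x) =
  \sum_(i <- r | Q i) cmean (F i).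
Proof.
move=> h; elim: r => [|i r IH].
  under eq_fun do rewrite big_nil.
  by rewrite big_nil cmean_cst.
under eq_fun do rewrite big_cons.
rewrite big_cons; case: (Q i) => //.
by rewrite cmeanD ?IH //; apply: bmeas_sum.
Qed.

Lemma cmean_bounded f M : bmeas f -> cbounded M f ->
  `|complex.Re (cmean f)| <= M /\ `|complex.Im (cmean f)| <= M.
Proof.
move=> bf fM.
have aux (h : T -> R) : P.-integrable setT (EFin \o h) ->
    (forall x, `|h x| <= M) -> `|\int[P]_x h x| <= M.
  move=> ih hM; apply: (le_trans (le_normr_Rintegral _ ih)) => //.
  rewrite -[leRHS]Rint_cst; apply: le_Rintegral => //.
    exact: integrable_norm.
  apply: (bounded_integrable (M := `|M|)) => //.
by split; apply: aux; [exact: bmeas_integrableRe|move=> x; have [] := fM x|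
  exact: bmeas_integrableIm|move=> x; have [] := fM x].
Qed.

Lemma cmean_indic B : measurable B -> cmean (fun x => (\1_B x)%:C) =
  (fine (P B))%:C.
Proof.
move=> mB; rewrite /cmean /= Rint_cst; congr Complex.
by rewrite /Rintegral integral_indic // setIT.
Qed.

End ComplexExpectation.

Section AgreeOnIndicators.
Context (R : realType) d (T : measurableType d).
Local Notation C := R[i].

(** A linear functional continuous for the sup norm. Means, means weighted by other variables and
    finite averages are all of this kind, so [bfunctional_ext] reduces identities between them to
    indicators. *)
Definition bfunctional (L : (T -> C) -> C) : Prop :=
  [/\ forall f g, bmeas f -> bmeas g -> L (fun x => f x + g x) = L f + L g,
      forall c f, bmeas f -> L (fun x => c * f x) = c * L f &
      exists2 K : R, 0 <= K & forall f M, bmeas f -> cbounded M f ->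
        `|complex.Re (L f)| <= K * M /\ `|complex.Im (L f)| <= K * M].

Lemma bfunctional_sum L (I : Type) (r : seq I) (F : I -> T -> C) :
  bfunctional L -> (forall i, bmeas (F i)) ->
  L (fun x => \sum_(i <- r) F i x) = \sum_(i <- r) L (F i).
Proof.
move=> [LD LZ _] h; elim: r => [|i r IH].
  under eq_fun do rewrite big_nil.
  rewrite big_nil.
  by have := LZ 0 (fun=> 1) (bmeas_cst _); rewrite !mul0r.
under eq_fun do rewrite big_cons.
by rewrite big_cons LD ?IH //; apply: bmeas_sum.
Qed.

(* The count is the integer part of [t]. *)
Lemma count_le_approx (J : nat) (t : R) : 0 <= t <= J%:R ->
  `|t - \sum_(j < J) (if j.+1%:R <= t then 1 else 0)| <= 1.
Proof.
elim: J t => [|J IH] t /andP[t0 tJ].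
  by rewrite big_ord0 subr0 ger0_norm // (le_trans tJ).
rewrite big_ord_recr /=.
case: (leP J.+1%:R t) => h.
  have -> : t = J.+1%:R by apply/eqP; rewrite eq_le tJ h.
  rewrite (eq_bigr (fun=> 1)); last first.
    move=> i _; rewrite ler_nat ifT //; exact: ltnW (ltn_ord i).
  by rewrite sumr_const card_ord -natr1 subrr normr0.
rewrite addr0.
case: (leP t J%:R) => h2; first by apply: IH; rewrite t0.
rewrite (eq_bigr (fun=> 1)); last first.
  move=> i _; rewrite ifT //; apply: le_trans (ltW h2).
  by rewrite ler_nat ltn_ord.
rewrite sumr_const card_ord ger0_norm; last by rewrite subr_ge0 ltW.
by rewrite lerBlDr addrC natr1 ltW.
Qed.

(** A nonnegative bounded [r] is within 1/N of N^-1 times the sum of the indicators of the level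
    sets r >= (j + 1) / N. Both functionals agree on that step function and are O(1/N) on the
    remainder. Real functions follow by a shift, complex ones by linearity. *)
Lemma bfunctional_ext L1 L2 : bfunctional L1 -> bfunctional L2 ->
  (forall B, measurable B ->
     L1 (fun x => (\1_B x)%:C) = L2 (fun x => (\1_B x)%:C)) ->
  forall f, bmeas f -> L1 f = L2 f.
Proof.
move=> bL1 bL2 Lind.
have Lcst c : L1 (fun=> c) = L2 (fun=> c).
  have := Lind setT measurableT.
  have -> : (fun x : T => (\1_[set: T] x)%:C : C) = (fun=> 1).
    by apply/funext => x; rewrite indicT.
  move=> e; have [_ Z1 _] := bL1; have [_ Z2 _] := bL2.
  have := Z1 c (fun=> 1) (bmeas_cst _); have := Z2 c (fun=> 1) (bmeas_cst _).
  by rewrite mulr1 => -> ->; rewrite e.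
have Lnneg (r : T -> R) (M : R) : measurable_fun setT r ->
    (forall x, 0 <= r x <= M) -> 0 < M ->
    L1 (fun x => (r x)%:C) = L2 (fun x => (r x)%:C).
  move=> mr rM M0.
  have br : bmeas (fun x => (r x)%:C : C).
    split => //=; exists M => x /=; have /andP[a b] := rM x.
    by rewrite normr0 ger0_norm //; split=> //; apply: ltW.
  have [L1D L1Z [K1 K10 L1B]] := bL1; have [L2D L2Z [K2 K20 L2B]] := bL2.
  have key (N : nat) : (0 < N)%N ->
      `|complex.Re (L1 (fun x => (r x)%:C) - L2 (fun x => (r x)%:C))|
        <= (K1 + K2) * N%:R^-1 /\
      `|complex.Im (L1 (fun x => (r x)%:C) - L2 (fun x => (r x)%:C))|
        <= (K1 + K2) * N%:R^-1.
    move=> N0; have N0' : 0 < N%:R :> R by rewrite ltr0n.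
    (* Enough levels of height 1/N to reach [M]. *)
    pose J := (Num.truncn (M * N%:R)).+1.
    have MJ : M * N%:R <= J%:R by apply/ltW/truncnS_gt.
    pose B (j : 'I_J) := [set x | j.+1%:R / N%:R <= r x].
    have mB j : measurable (B j).
      rewrite -[B j]setTI; apply: (measurable_fun_le measurableT) => //.
    pose s x : C := \sum_(j < J) (N%:R^-1)%:C * (\1_(B j) x)%:C.
    have bs : bmeas s.
      by apply: bmeas_sum => j; apply: bmeasZ; apply: bmeas_indic.
    have Ls : L1 s = L2 s.
      rewrite /s !bfunctional_sum //; try by
        move=> j; apply: bmeasZ; apply: bmeas_indic.
      apply: eq_bigr => j _.
      by rewrite L1Z ?L2Z ?Lind //; apply: bmeas_indic.
    pose e x := (r x)%:C - s x.
    have eE x : e x = ((r x - N%:R^-1 * \sum_(j < J)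
        (if j.+1%:R <= r x * N%:R then 1 else 0)))%:C.
      rewrite /e /s rmorphB rmorphM /= rmorph_sum /= mulr_sumr.
      congr (_ - _); apply: eq_bigr => j _; congr (_ * _%:C).
      rewrite indicE -ler_pdivrMr //.
      by case: ifPn => h; [rewrite mem_set|rewrite memNset //; apply/negP].
    have be : bmeas e.
      apply: bmeasD => //.
      under eq_fun do rewrite -mulN1r.
      exact: bmeasZ.
    have eb : cbounded N%:R^-1 e.
      move=> x; rewrite eE /= normr0 invr_ge0 ler0n; split=> //.
      have rN : r x = N%:R^-1 * (r x * N%:R).
        by rewrite mulrCA mulVf ?mulr1 // gt_eqF.
      rewrite [X in X - _]rN -mulrBr normrM ger0_norm ?invr_ge0 ?ler0n //.
      rewrite ler_piMr ?invr_ge0 ?ler0n //; apply: count_le_approx.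
      have /andP[a b] := rM x; rewrite mulr_ge0 //=.
      by apply: le_trans MJ; rewrite ler_pM2r.
    have rE : (fun x => (r x)%:C) = (fun x => e x + s x).
      by apply/funext => x; rewrite /e subrK.
    rewrite rE L1D // L2D // Ls opprD addrACA subrr addr0.
    have [a b] := L1B _ _ be eb; have [a' b'] := L2B _ _ be eb.
    rewrite !raddfB mulrDl; split; apply: (le_trans (ler_normB _ _));
      exact: lerD.
  have zero (z : R) (K : R) : 0 <= K ->
      (forall N : nat, (0 < N)%N -> `|z| <= K * N%:R^-1) -> z = 0.
    move=> K0 h; apply/eqP; rewrite -normr_le0 leNgt; apply/negP => z0.
    pose N := (Num.truncn (K / `|z|)).+1.
    have := h N isT; rewrite ler_pdivlMr ?ltr0n // leNgt => /negP; apply.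
    by rewrite -ltr_pdivrMl // mulrC; apply: truncnS_gt.
  apply/eqP; rewrite -subr_eq0; apply/eqP.
  have K0 : 0 <= K1 + K2 by apply: addr_ge0.
  have := zero _ _ K0 (fun N N0 => (key N N0).1).
  have := zero _ _ K0 (fun N N0 => (key N N0).2).
  by case: (_ - _) => a b /= -> ->.
have Lreal (r : T -> R) (M : R) : measurable_fun setT r ->
    (forall x, `|r x| <= M) -> L1 (fun x => (r x)%:C) = L2 (fun x => (r x)%:C).
  move=> mr rM.
  have M'0 : 0 < 2 * `|M| + 1 by rewrite ltr_wpDl // mulr_ge0.
  (* The shift makes the function nonnegative; on the constant removed afterwards the functionals
     agree by [Lcst]. *)
  pose r' x := r x + `|M|.
  have mr' : measurable_fun setT r' by apply: measurable_funD.
  have h x : 0 <= r' x <= 2 * `|M| + 1.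
    have := rM x; have := ler_norm M; rewrite ler_norml /r'; lra.
  have e := Lnneg r' _ mr' h M'0.
  have br' : bmeas (fun x => (r' x)%:C : C).
    split => //=; exists (2 * `|M| + 1) => x /=; have /andP[a b] := h x.
    by rewrite normr0 ger0_norm //; split=> //; apply: ltW.
  have -> : (fun x => (r x)%:C : C) = (fun x => (r' x)%:C + (- `|M|)%:C).
    by apply/funext => x; rewrite -rmorphD /= /r' addrK.
  have [L1D _ _] := bL1; have [L2D _ _] := bL2.
  rewrite L1D ?L2D ?e ?Lcst //; exact: bmeas_cst.
move=> f [f1 f2 [M fM]].
have b1 : bmeas (fun x => (complex.Re (f x))%:C).
  split => //=; exists M => x /=; have [a b] := fM x.
  by rewrite normr0; split=> //; apply: (le_trans _ a).
have b2 : bmeas (fun x => (complex.Im (f x))%:C).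
  split => //=; exists M => x /=; have [a b] := fM x.
  by rewrite normr0; split=> //; apply: (le_trans _ a).
have -> : f = fun x => (complex.Re (f x))%:C + 'i%C * (complex.Im (f x))%:C.
  by apply/funext => x; rewrite [LHS]complexE.
have [L1D L1Z _] := bL1; have [L2D L2Z _] := bL2.
have bi := bmeasZ 'i%C b2.
rewrite L1D // L2D // L1Z // L2Z //.
by rewrite (Lreal _ M) ?(Lreal (fun x => complex.Im _) M) // => x;
  have [] := fM x.
Qed.

(** The weight [h] stands for the factors of all other random variables while a single factor is
    varied. *)
Lemma bfunctional_cmean d' (T' : measurableType d') (P : probability T' R)
    (X : T' -> T) (h : T' -> C) : measurable_fun setT X -> bmeas h ->
  bfunctional (fun f => cmean P (fun w => f (X w) * h w)).
Proof.
move=> mX bh; have [_ _ [N hN]] := bh; split.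
- move=> f g bf bg; under eq_fun do rewrite mulrDl.
  by rewrite cmeanD //; apply: bmeasM => //; apply: bmeas_comp.
- move=> c f bf; under eq_fun do rewrite -mulrA.
  by rewrite cmeanZ //; apply: bmeasM => //; apply: bmeas_comp.
exists (2 * `|N|) => // f M bf fM.
have -> : 2 * `|N| * M = 2 * (M * `|N|) by rewrite [M * _]mulrC mulrA.
apply: cmean_bounded; first by apply: bmeasM => //; apply: bmeas_comp.
apply: (cboundedM (f := f \o X)).
  by move=> w; apply: fM.
by move=> w; have [a b] := hN w; split; apply: (le_trans _ (ler_norm N)).
Qed.

Lemma bfunctional_cmean1 d' (T' : measurableType d') (P : probability T' R)
    (X : T' -> T) : measurable_fun setT X ->
  bfunctional (fun f => cmean P (fun w => f (X w))).
Proof.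
move=> mX; have := bfunctional_cmean P mX (bmeas_cst 1).
by congr bfunctional; apply/funext => f; congr cmean; apply/funext => w;
  rewrite mulr1.
Qed.

Lemma bfunctional_scale L c : bfunctional L -> bfunctional (fun f => L f * c).
Proof.
move=> [LD LZ [K K0 LK]]; split.
- by move=> f g bf bg; rewrite LD // mulrDl.
- by move=> a f bf; rewrite LZ // mulrA.
pose N := `|complex.Re c| + `|complex.Im c|.
have cN : cbounded N (fun _ : unit => c).
  by move=> _; rewrite lerDl lerDr !normr_ge0.
exists (2 * (K * N)); first by rewrite mulr_ge0 // mulr_ge0 // addr_ge0.
move=> f M bf fM.
have := cboundedM (f := fun _ : unit => L f) (fun=> LK f M bf fM) cN tt.
by rewrite -!mulrA [M * N]mulrC.
Qed.

End AgreeOnIndicators.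

Section Independence.
Context (R : realType) d (Omega : measurableType d) (P : probability Omega R).
Local Notation C := R[i].

(** When all factors are indicators this is the definition of independence. The factors are then
    made arbitrary one at a time, both sides being bounded functionals of the factor under
    consideration. *)
Lemma independent_cmean_prod d' (T : measurableType d') (I : finType)
    (X : I -> {RV P >-> T}) (f : I -> T -> C) :
  mutually_independent X -> (forall i, bmeas (f i)) ->
  cmean P (fun w => \prod_i f i (X i w)) =
  \prod_i cmean P (fun w => f i (X i w)).
Proof.
move=> iX bf.
have mX i : measurable_fun setT (X i) by [].
(* The list [s] contains the indices whose factor need not be an indicator. *)
suff : forall s : seq I, forall f : I -> T -> C, (forall i, bmeas (f i)) ->
    (forall i, i \notin s ->
       exists2 B, measurable B & f i = (fun x => (\1_B x)%:C)) ->
    cmean P (fun w => \prod_i f i (X i w)) =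
    \prod_i cmean P (fun w => f i (X i w)).
  by move=> /(_ (enum I) f bf); apply => i; rewrite mem_enum.
elim => [|i0 s IH] {bf}f bf fs.
  have /choice[B hB] : forall i, exists B, measurable B /\
      f i = (fun x => (\1_B x)%:C).
    by move=> i; have [//|B mB ->] := fs i; exists B.
  have mXB i : measurable (X i @^-1` B i).
    by rewrite -[_ @^-1` _]setTI; apply: mX => //; have [] := hB i.
  have -> : (fun w => \prod_i f i (X i w)) =
      (fun w => (\1_(\bigcap_i (X i @^-1` B i)) w)%:C).
    apply/funext => w.
    case: (pselect (forall i, B i (X i w))) => h.
      rewrite indicE mem_set; last by move=> i _; apply: h.
      rewrite big1 // => i _; have [_ ->] := hB i.
      by rewrite indicE mem_set.
    rewrite indicE memNset; last by move=> h'; apply: h => i; apply: h'.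
    move/existsNP: h => [i hi]; rewrite (bigD1 i) //= (hB i).2.
    by rewrite indicE memNset ?mul0r.
  rewrite cmean_indic; last first.
    by apply: fin_bigcap_measurable => //; apply: finite_finset.
  rewrite iX; last by move=> i; have [] := hB i.
  under [RHS]eq_bigr => i _ do rewrite (hB i).2 (_ :
      (fun w => (\1_(B i) (X i w))%:C) = fun w => (\1_(X i @^-1` B i) w)%:C) //
      cmean_indic //.
  rewrite -rmorph_prod /=; congr (_ %:C).
  under eq_bigr => i _ do rewrite -[P _]fineK ?fin_num_measure//.
  by rewrite prodEFin.
pose f' (phi : T -> C) i := if i == i0 then phi else f i.
pose h w := \prod_(i | i != i0) f i (X i w).
have bh : bmeas h.
  by apply: bmeas_prod => i; apply: bmeas_comp.
have bL1 := bfunctional_cmean P (mX i0) bh.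
have bL2 := bfunctional_scale (\prod_(i | i != i0) cmean P (fun w => f i (X i w)))
  (bfunctional_cmean1 P (mX i0)).
have E1 phi : cmean P (fun w => \prod_i f' phi i (X i w)) =
    cmean P (fun w => phi (X i0 w) * h w).
  congr cmean; apply/funext => w; rewrite (bigD1 i0) //= /f' eqxx; congr (_ * _).
  by apply: eq_bigr => i /negbTE ->.
have E2 phi : \prod_i cmean P (fun w => f' phi i (X i w)) =
    cmean P (fun w => phi (X i0 w)) *
    \prod_(i | i != i0) cmean P (fun w => f i (X i w)).
  rewrite (bigD1 i0) //= /f' eqxx; congr (_ * _).
  by apply: eq_bigr => i /negbTE ->.
have f'E : f' (f i0) = f.
  by apply/funext => i; rewrite /f'; case: eqP => // ->.
rewrite -f'E E1 E2.
apply: (bfunctional_ext bL1 bL2) => // B mB.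
rewrite -(E1 (fun x => (\1_B x)%:C)) -(E2 (fun x => (\1_B x)%:C)).
apply: IH => i.
  by rewrite /f'; case: eqP => _ //; apply: bmeas_indic.
rewrite /f'; case: eqP => [_ _|ne is_]; first by exists B.
by apply: fs; rewrite inE negb_or is_ andbT; apply/eqP.
Qed.

Lemma cmean_distribution d' (T : measurableType d') (X : {RV P >-> T})
    (mu : probability T R) (f : T -> C) :
  (forall B, measurable B -> distribution P X B = mu B) -> bmeas f ->
  cmean P (fun w => f (X w)) = cmean mu f.
Proof.
move=> hX bf.
have mX : measurable_fun setT X by [].
apply: (bfunctional_ext (bfunctional_cmean1 P mX)
  (bfunctional_cmean1 mu (@measurable_id _ _ setT))) => // B mB.
rewrite (_ : (fun w => (\1_B (X w))%:C) = fun w => (\1_(X @^-1` B) w)%:C) //.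
rewrite !cmean_indic //; first by rewrite -hX.
by rewrite -[_ @^-1` _]setTI; apply: mX.
Qed.

End Independence.

(** * Second moment of a random gate *)

Section BorelMatrices.
Context (R : realType).
Local Notation C := R[i].

Lemma mx_open_ball n (A : set 'M[C^o]_n) :
  (forall M, A M -> exists2 e : C, 0 < e &
     forall M' : 'M[C]_n, (forall i j, `|M i j - M' i j| < e) -> A M') ->
  open A.
Proof.
move=> h; rewrite openE => M AM; have [e e0 he] := h M AM.
rewrite /interior; apply/nbhs_ballP; exists e => // M' [_ MM'].
by apply: he => i j; have := MM' i j.
Qed.

Lemma mx_open_ballP n (A : set 'M[C^o]_n) (M : 'M[C]_n) : open A -> A M ->
  exists2 e : C, 0 < e &
    forall M' : 'M[C]_n, (forall i j, `|M i j - M' i j| < e) -> A M'.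
Proof.
rewrite openE => oA AM; have /nbhs_ballP[e /= e0 he] := oA M AM.
by exists e => // M' MM'; apply: he; split=> // i j; apply: MM'.
Qed.

Lemma borel_open n (A : set (borel_mx R n)) :
  open (A : set 'M[C^o]_n) -> measurable A.
Proof. by move=> oA; apply: sub_gen_smallest. Qed.

Lemma measurable_mxP d (T : measurableType d) n (X : T -> borel_mx R n) :
  (forall A : set 'M[C^o]_n, open A -> measurable (X @^-1` A)) ->
  measurable_fun setT X.
Proof.
move=> h.
apply: (@measurability _ _ T (borel_mx R n) setT X (@open 'M[C^o]_n) erefl).
by move=> _ [A oA <-]; rewrite setTI; apply: h.
Qed.

Lemma normc_ge_Im (z : C) : `|complex.Im z|%:C <= `|z|.
Proof.
rewrite normc_def lecR -sqrtr_sqr ler_wsqrtr // lerDr sqr_ge0 //.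
Qed.

Lemma measurable_entry n (i j : 'I_n) (p : C -> R) :
  (forall x y, p (x - y) = p x - p y) -> (forall x, `|p x|%:C <= `|x|) ->
  measurable_fun setT (fun U : borel_mx R n => p ((U : 'M[C]_n) i j)).
Proof.
move=> pB pn; apply: (measurability _ (RGenOInfty.measurableE R)).
move=> _ [_ [a ->] <-]; rewrite setTI; apply: borel_open.
apply: mx_open_ball => M /=; rewrite in_itv /= andbT => aM.
exists (p (M i j) - a)%:C; first by rewrite ltcR subr_gt0.
move=> M' /(_ i j) h; rewrite in_itv /= andbT.
have := le_lt_trans (pn _) h; rewrite ltcR pB => h'.
by have := le_lt_trans (ler_norm _) h'; rewrite ltrD2l ltrN2.
Qed.

Lemma measurable_mulmx n (V : 'M[C]_n) :
  measurable_fun setT (fun U : borel_mx R n => V *m U : borel_mx R n).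
Proof.
apply: measurable_mxP => A oA; apply: borel_open; apply: mx_open_ball.
move=> M /= /(mx_open_ballP oA)[e e0 he].
pose S : C := \sum_i \sum_k `|V i k|.
have S0 : 0 <= S by apply: sumr_ge0 => i _; apply: sumr_ge0.
(* The added 1 keeps the radius positive and well defined when [V] is zero. *)
have S1 : 0 < 1 + S by apply: ltr_pwDl.
exists (e / (1 + S)); first by rewrite divr_gt0.
move=> M' hM; apply: he => i j.
rewrite !mxE -sumrB; apply: (@le_lt_trans _ _ (\sum_k `|V i k| * (e / (1 + S)))).
  apply: (le_trans (ler_norm_sum _ _ _)); apply: ler_sum => k _.
  by rewrite -mulrBr normrM ler_wpM2l // ltW.
rewrite -mulr_suml mulrCA gtr_pMr // ltr_pdivrMr // mul1r.
apply: (@le_lt_trans _ _ S); last by rewrite ltrDr.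
have -> : S = \sum_k `|V i k| + \sum_(l | l != i) \sum_k `|V l k|.
  by rewrite /S (bigD1 i).
by rewrite lerDl; apply: sumr_ge0 => ? _; apply: sumr_ge0.
Qed.

(** The variant of [bmeas] without a bound, since entries are unbounded on the space of all
    matrices. *)
Definition cmeas d (T : measurableType d) (f : T -> C) : Prop :=
  measurable_fun setT (fun x => complex.Re (f x)) /\
  measurable_fun setT (fun x => complex.Im (f x)).

Lemma cmeas_entry n (i j : 'I_n) :
  cmeas (fun U : borel_mx R n => (U : 'M[C]_n) i j).
Proof.
split; apply: measurable_entry.
- by move=> x y; rewrite raddfB.
- exact: normc_ge_Re.
- by move=> x y; rewrite raddfB.
- exact: normc_ge_Im.
Qed.

Lemma cmeasM d (T : measurableType d) (f g : T -> C) :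
  cmeas f -> cmeas g -> cmeas (fun x => f x * g x).
Proof.
move=> [f1 f2] [g1 g2]; split.
- under eq_fun do rewrite ReM.
  by apply: measurable_funB; apply: measurable_funM.
- under eq_fun do rewrite ImM.
  by apply: measurable_funD; apply: measurable_funM.
Qed.

Lemma cmeas_conj d (T : measurableType d) (f : T -> C) :
  cmeas f -> cmeas (fun x => (f x)^*).
Proof.
move=> [f1 f2].
have Re_ x : complex.Re ((f x)^*) = complex.Re (f x) by case: (f x).
have Im_ x : complex.Im ((f x)^*) = - complex.Im (f x) by case: (f x).
split.
- by under eq_fun do rewrite Re_.
- under eq_fun do rewrite Im_.
  by apply: measurableT_comp => //; apply: measurable_oppr.
Qed.

Lemma cmeas_sum d (T : measurableType d) (I : Type) (r : seq I)
    (F : I -> T -> C) :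
  (forall i, cmeas (F i)) -> cmeas (fun x => \sum_(i <- r) F i x).
Proof.
move=> h; elim: r => [|i r [I1 I2]].
  by split; under eq_fun do rewrite big_nil; exact: measurable_cst.
by have [h1 h2] := h i; split; under eq_fun do rewrite big_cons raddfD;
  apply: measurable_funD.
Qed.

Lemma measurable_unitarymx n :
  measurable ([set U : 'M[C]_n | U \is unitarymx] : set (borel_mx R n)).
Proof.
pose E (p : 'I_n * 'I_n) (U : 'M[C]_n) : C := \sum_k U p.1 k * (U p.2 k)^*.
have mE p : cmeas (E p : borel_mx R n -> C).
  apply: cmeas_sum => k; apply: cmeasM; first exact: cmeas_entry.
  by apply: cmeas_conj; apply: cmeas_entry.
have -> : [set U : 'M[C]_n | U \is unitarymx] =
    \bigcap_p ((fun U => complex.Re (E p U)) @^-1` [set (p.1 == p.2)%:R] `&`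
               (fun U => complex.Im (E p U)) @^-1` [set 0]).
  apply/seteqP; split => U /=.
    move/unitarymxP => UU [i j] _ /=.
    have := congr1 (fun A : 'M[C]_n => A i j) UU; rewrite !mxE.
    under eq_bigr do rewrite !mxE.
    by rewrite /E /= => ->; case: eqP.
  move=> h; apply/unitarymxP/matrixP => i j; rewrite !mxE.
  under eq_bigr do rewrite !mxE.
  have [/= h1 h2] := h (i, j) I; apply/eqP; rewrite eq_complex.
  by move: h1 h2; rewrite /E /= => -> ->; case: (i == j); rewrite /= !eqxx.
apply: fin_bigcap_measurable => [|p _]; first exact: finite_finset.
have [m1 m2] := mE p.
by apply: measurableI; rewrite -[_ @^-1` _]setTI; [apply: m1|apply: m2].
Qed.

(** Gate laws live on all matrices, where entries are unbounded. Multiplying by this indicator makes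
    polynomials in the entries bounded, and changes no mean under a law carried by the unitaries. *)
Definition uind n (U : 'M[C]_n) : C := (U \is unitarymx)%:R.

Lemma uindE n : @uind n =
  fun U => (\1_([set V : 'M[C]_n | V \is unitarymx] : set (borel_mx R n)) U)%:C.
Proof.
apply/funext => U; rewrite /uind indicE.
by case: (boolP (U \is _)) => h; [rewrite mem_set|rewrite memNset //; apply/negP].
Qed.

Lemma bmeas_uind n : bmeas (@uind n : borel_mx R n -> C).
Proof. by rewrite uindE; apply: bmeas_indic; apply: measurable_unitarymx. Qed.

Lemma unitarymx_entry_le1 n (U : 'M[C]_n) i j :
  U \is unitarymx -> `|U i j| <= 1.
Proof.
move=> /unitarymxP /(congr1 (fun A : 'M[C]_n => A i i)).
rewrite !mxE eqxx => UU.
have : `|U i j| ^+ 2 <= 1.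
  rewrite -[leRHS]UU (bigD1 j) //= !mxE -normCK lerDl.
  by apply: sumr_ge0 => k _; rewrite !mxE mul_conjC_ge0.
by rewrite expr_le1.
Qed.

Lemma bmeas_uentry n (i j : 'I_n) :
  bmeas (fun U : borel_mx R n => uind U * (U : 'M[C]_n) i j).
Proof.
have [m1 m2] : cmeas (fun U : borel_mx R n => uind U * (U : 'M[C]_n) i j).
  apply: cmeasM; last exact: cmeas_entry.
  by have [? ? _] := bmeas_uind n.
split=> //; exists 1 => U.
have h : `|uind U * (U : 'M[C]_n) i j| <= 1.
  rewrite /uind; case: (boolP (U \is _)) => h; rewrite ?mul0r ?normr0 ?ler01 //.
  by rewrite mul1r; apply: unitarymx_entry_le1.
have := le_trans (normc_ge_Re _) h; have := le_trans (normc_ge_Im _) h.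
by rewrite !lecR.
Qed.

End BorelMatrices.

(** * The commutant of the operators V (x) V *)

Section Commutant.
Context (R : realType) (n : nat).
Local Notation C := R[i].

Lemma tens_sum (F : 'I_(n * n) -> C) :
  \sum_i F i = \sum_a \sum_b F (mxtens_index (a, b)).
Proof.
rewrite pair_bigA /= (reindex (@mxtens_index n n)) /=; last first.
  by exists (@mxtens_unindex n n) => i _; rewrite (mxtens_indexK, mxtens_unindexK).
by apply: eq_bigr => -[].
Qed.

Definition tens_entry (T : 'M[C]_(n * n)) (a b c d : 'I_n) : C :=
  T (mxtens_index (a, b)) (mxtens_index (c, d)).

Variable T : 'M[C]_(n * n).
Hypothesis Tcomm : forall V : 'M[C]_n, V \is unitarymx ->
  T *m (V *t V) = (V *t V) *m T.
Local Notation t := (tens_entry T).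

Lemma commE (V : 'M[C]_n) a b e f : V \is unitarymx ->
  \sum_c \sum_d t a b c d * (V c e * V d f) =
  \sum_c \sum_d V a c * V b d * t c d e f.
Proof.
move=> /Tcomm /(congr1 (fun A : 'M[C]_(n * n) => tens_entry A a b e f)).
rewrite /tens_entry !mxE !tens_sum => h.
under eq_bigr do under eq_bigr do rewrite -tensmxE.
by rewrite h; apply: eq_bigr => c _; apply: eq_bigr => d _; rewrite tensmxE.
Qed.

Lemma comm_perm (s : {perm 'I_n}) a b c d : t (s a) (s b) (s c) (s d) = t a b c d.
Proof.
have uS : (perm_mx s : 'M[C]_n) \is unitarymx.
  apply/unitarymxP; rewrite tr_perm_mx map_perm_mx -perm_mxM.
  by rewrite mulgV perm_mx1.
have := commE a b (s c) (s d) uS.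
have E (x y : 'I_n) : (perm_mx s : 'M[C]_n) x y = (y == s x)%:R.
  by rewrite !mxE eq_sym.
rewrite (bigD1 c) //= (bigD1 d) //= [X in _ + X + _]big1 ?addr0; last first.
  move=> i /negbTE h; rewrite !E !(inj_eq perm_inj).
  by rewrite [d == i]eq_sym h !mulr0.
rewrite [X in _ + X]big1 ?addr0; last first.
  move=> j /negbTE h; apply: big1 => i _; rewrite !E !(inj_eq perm_inj).
  by rewrite [c == j]eq_sym h mul0r mulr0.
rewrite !E !eqxx !mulr1 => ->.
rewrite (bigD1 (s a)) //= (bigD1 (s b)) //= [X in _ + X + _]big1 ?addr0; last first.
  by move=> i /negbTE h; rewrite !E h mulr0 mul0r.
rewrite [X in _ + X]big1 ?addr0; last first.
  by move=> j /negbTE h; apply: big1 => i _; rewrite !E h !mul0r.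
by rewrite !E !eqxx !mul1r.
Qed.

(** Commutation with the diagonal unitary that has phase i at [x] and 1 elsewhere. The phase i is
    used because its powers 0, 1 and 2 are distinct, so a nonzero entry has [x] equally often among
    its row and its column indices; -1 would confuse 0 with 2. *)
Lemma comm_phase x a b e f : t a b e f != 0 ->
  ((e == x) + (f == x) = (a == x) + (b == x))%N.
Proof.
pose v y : C := if y == x then 'i else 1.
pose V : 'M[C]_n := diag_mx (\row_y v y).
have VE y z : V y z = if y == z then v y else 0.
  by rewrite !mxE; case: eqP.
have uV : V \is unitarymx.
  apply/unitarymxP/matrixP => i j; rewrite !mxE (bigD1 i) //= big1 ?addr0.
    rewrite !mxE eqxx [j == i]eq_sym; case: eqP => [->|_]; last first.
      by rewrite /= conjC0 mulr0.
    rewrite /= !mulr1n -normCK /v; case: eqP => _; last by rewrite normr1 expr1n.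
    by rewrite normCi expr1n.
  by move=> k; rewrite eq_sym => /negbTE h; rewrite !mxE h mul0r.
move=> t0; have := commE a b e f uV.
rewrite (bigD1 e) //= (bigD1 f) //= [X in _ + X + _]big1 ?addr0; last first.
  by move=> i /negbTE h; rewrite !VE h !mulr0.
rewrite [X in _ + X]big1 ?addr0; last first.
  by move=> j /negbTE h; apply: big1 => i _; rewrite !VE h !mul0r mulr0.
rewrite (bigD1 a) //= (bigD1 b) //= [X in _ + X + _]big1 ?addr0; last first.
  by move=> i /negbTE h; rewrite !VE [b == i]eq_sym h !mulr0 mul0r.
rewrite [X in _ + X]big1 ?addr0; last first.
  by move=> j /negbTE h; apply: big1 => i _; rewrite !VE [a == j]eq_sym h !mul0r.
rewrite !VE !eqxx mulrC => /(mulIf t0); rewrite /v.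
have i1 : ('i : C) != 1.
  by apply/eqP => /(congr1 (fun x => x ^+ 2)); rewrite sqrCi expr1n => /eqP;
    rewrite eq_sym -subr_eq0 opprK (_ : 1 + 1 = 2%:R) // pnatr_eq0.
have i2 : ('i * 'i : C) = -1 by rewrite -expr2 sqrCi.
have i3 : (-1 : C) != 1.
  by rewrite eq_sym -subr_eq0 opprK (_ : 1 + 1 = 2%:R) // pnatr_eq0.
have i4 : (-1 : C) != 'i.
  apply/eqP => h; have := i2; rewrite -h mulrNN mulr1 => /eqP.
  by rewrite eq_sym; apply/negP.
by do 4![case: eqP => _]; rewrite ?mulr1 ?mul1r ?i2 //=; move/eqP;
  rewrite ?(negPf i1) ?(negPf i3) ?(negPf i4) // eq_sym
   ?(negPf i1) ?(negPf i3) ?(negPf i4).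
Qed.

Lemma comm_supp a b e f : t a b e f != 0 ->
  (e == a) && (f == b) || (e == b) && (f == a).
Proof.
move=> h; have := comm_phase a h; have := comm_phase b h.
rewrite !eqxx [b == a]eq_sym; case: (altP (a =P b)) => [->|ab].
  by case: eqP; case: eqP.
case: (altP (e =P a)) => [->|ea] /=.
  by rewrite (negPf ab); case: eqP.
by case: (altP (f =P a)) => [->|fa] //=; rewrite (negPf ab); case: eqP.
Qed.

(** Phases and permutations leave three free values: those at (x, y, x, y), (x, y, y, x) and (x, x,
    x, x) with x and y distinct. A reflection that mixes two basis vectors shows that the third is
    the sum of the other two. *)
Lemma commutant_span : (1 < n)%N ->
  exists al be, forall a b c d,
    t a b c d = al * ((a == c) && (b == d))%:R + be * ((a == d) && (b == c))%:R.
Proof.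
move=> n1.
pose x0 : 'I_n := Ordinal (ltnW n1); pose y0 : 'I_n := Ordinal n1.
have xy : x0 != y0 by [].
pose al := t x0 y0 x0 y0; pose be := t x0 y0 y0 x0.
have tr_ab a b : a != b -> exists s : {perm 'I_n}, s a = x0 /\ s b = y0.
  move=> ab; exists (tperm a x0 * tperm (tperm a x0 b) y0)%g.
  rewrite !permM tpermL tpermD; last 2 first.
  - by rewrite -[X in _ == X](tpermL a x0) (inj_eq perm_inj) eq_sym.
  - by rewrite eq_sym.
  by rewrite tpermL.
have A a b : a != b -> t a b a b = al.
  by move=> /tr_ab[s [sa sb]]; rewrite -(comm_perm s) sa sb.
have B a b : a != b -> t a b b a = be.
  by move=> /tr_ab[s [sa sb]]; rewrite -(comm_perm s) sa sb.
have G0 : t x0 x0 x0 x0 = al + be.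
  (* The Householder reflection along (1, 2) has rational entries: 3/5 and -4/5 in its first row.
     The direction (1, 1) would only permute the two vectors. *)
  pose u : 'rV[C]_n := delta_mx 0 x0 + 2%:R *: delta_mx 0 y0.
  pose V : 'M[C]_n := 1%:M - (2%:R / 5%:R) *: (u^T *m u).
  have uE j : u 0 j = (j == x0)%:R + 2%:R * (j == y0)%:R by rewrite !mxE.
  have VE i j : V i j = (i == j)%:R - (2%:R / 5%:R) * (u 0 i * u 0 j).
    by rewrite !mxE big_ord1 !mxE.
  have Vt : V ^t* = V.
    apply/matrixP => i j; rewrite [LHS]mxE [X in X^*]mxE !VE !uE.
    rewrite rmorphB !rmorphM fmorphV !rmorphD !rmorphM !rmorph_nat.
    by rewrite !rmorph1 eq_sym; congr (_ - _ * _); rewrite mulrC.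
  have uu : u *m u^T = 5%:R%:M.
    apply/matrixP => i j; rewrite !ord1 !mxE (bigD1 x0) //= (bigD1 y0) //=.
    rewrite big1 ?addr0; last first.
      move=> k /andP[/negbTE h1 /negbTE h2].
      by rewrite [u^T _ _]mxE uE h1 h2 mulr0 addr0 mul0r.
    rewrite ![u^T _ _]mxE !uE !eqxx [y0 == x0]eq_sym (negPf xy) /=.
    by rewrite mulr1n; ring.
  have uV : V \is unitarymx.
    apply/unitarymxP; rewrite Vt /V mulmxBr !mulmxBl mul1mx mulmx1.
    rewrite mul1mx -scalemxAl -scalemxAr mulmxA -[u^T *m u *m u^T]mulmxA uu.
    rewrite mul_mx_scalar -scalemxAl; move: (u^T *m u) => X.
    by apply/matrixP => i j; rewrite !mxE; field.
  (* Both sides are multiples of V x0 x0 * V x0 y0 = -12/25, which can be cancelled. *)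
  have := commE x0 x0 x0 y0 uV.
  have t0 a b e f : ~~ ((e == a) && (f == b) || (e == b) && (f == a)) ->
      t a b e f = 0.
    by move=> h; apply/eqP; apply: contraNT h; apply: comm_supp.
  rewrite (bigD1 x0) //= (bigD1 x0) //= [X in _ + X + _]big1 ?addr0; last first.
    by move=> i h; rewrite t0 ?mul0r // (negPf h) andbF.
  rewrite [X in _ + X]big1 ?addr0; last first.
    move=> j h; apply: big1 => i _.
    by rewrite t0 ?mul0r // (negPf h).
  rewrite (bigD1 x0) //= (bigD1 y0) //= [X in _ + X + _]big1 ?addr0; last first.
    move=> i h; rewrite t0 ?mulr0 // eqxx /= [y0 == i]eq_sym (negPf h) /=.
    by rewrite [y0 == x0]eq_sym (negPf xy) andbF.
  rewrite (bigD1 y0) //= (bigD1 x0) //= [X in _ + X + _]big1 ?addr0; last first.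
    move=> i h; rewrite t0 ?mulr0 // eqxx andbT [x0 == i]eq_sym (negPf h).
    by rewrite (negPf xy).
  rewrite [X in _ + (_ + X)]big1 ?addr0; last first.
    move=> j /andP[h1 h2]; apply: big1 => i _; rewrite t0 ?mulr0 //.
    by rewrite [x0 == j]eq_sym (negPf h1) /= [y0 == j]eq_sym (negPf h2) andbF.
  rewrite [t y0 x0 x0 y0]B 1?eq_sym // [V x0 y0 * V x0 x0]mulrC -mulrDr mulrC.
  have V0 : V x0 x0 * V x0 y0 != 0.
    rewrite !VE !uE !eqxx (negPf xy) [y0 == x0]eq_sym (negPf xy) /=.
    rewrite (_ : _ * _ = - (12%:R / 25%:R)); last by field; rewrite ?pnatr_eq0.
    by rewrite oppr_eq0 mulf_neq0 ?invr_eq0 ?pnatr_eq0.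
  by move/(mulfI V0).
have G a : t a a a a = al + be.
  by rewrite -(comm_perm (tperm a x0)) tpermL.
exists al, be => a b c d.
case: (boolP ((a == c) && (b == d))) => [/andP[/eqP<- /eqP<-]|h1].
  rewrite mulr1 [b == a]eq_sym andbb.
  by case: (altP (a =P b)) => [<-|ab]; rewrite ?mulr1 // mulr0 addr0 A.
rewrite mulr0 add0r.
case: (boolP ((a == d) && (b == c))) => [/andP[/eqP ad /eqP bc]|h2].
  subst d c; rewrite mulr1 B //; apply: contraNneq h1 => ->; by rewrite eqxx.
rewrite mulr0; apply/eqP; apply: contraT => /comm_supp.
rewrite [c == a]eq_sym [d == b]eq_sym [c == b]eq_sym [d == a]eq_sym.
by rewrite (negPf h1) andbC (negPf h2).
Qed.

End Commutant.

Lemma adjmxE (R : realType) m p (A : 'M[R[i]]_(m, p)) i j :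
  (A ^t*) i j = (A j i)^*.
Proof. by rewrite !mxE. Qed.

Section SecondMoment.
Context (R : realType) (n : nat).
Local Notation C := R[i].
Implicit Types (mu : probability (borel_mx R n) R) (A : 'M[C]_(n * n)).

Definition tens_tr A : C := \sum_a \sum_b tens_entry A a b a b.
Definition tens_trF A : C := \sum_a \sum_b tens_entry A a b b a.

(** Weingarten's formula of order two: the element of the span of identity and swap that has the
    same trace and the same trace against the swap as [A]. *)
Definition haar_twirl A (a b c d : 'I_n) : C :=
  (n%:R * tens_tr A - tens_trF A) / (n%:R * (n%:R ^+ 2 - 1)) *
     ((a == c) && (b == d))%:R +
  (n%:R * tens_trF A - tens_tr A) / (n%:R * (n%:R ^+ 2 - 1)) *
     ((a == d) && (b == c))%:R.

(** The only property of the gate law on which the averaging of the circuit relies; it holds for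
    Haar gates and for designs alike. *)
Definition second_moment mu : Prop := forall A a b c d,
  cmean mu (fun U => uind U * tens_entry (twirl2 A U) a b c d) =
  haar_twirl A a b c d.

Lemma twirl2E A (U : 'M[C]_n) a b c d :
  tens_entry (twirl2 A U) a b c d =
  \sum_e \sum_f \sum_g \sum_h tens_entry A e f g h *
    (U a e * U b f * ((U c g)^* * (U d h)^*)).
Proof.
rewrite /tens_entry /twirl2 mxE tens_sum.
under eq_bigr => g _ do under eq_bigr => h _ do
  (rewrite mxE tens_sum mulr_suml; under eq_bigr => e _ do rewrite mulr_suml).
under eq_bigr do rewrite exchange_big /=.
rewrite exchange_big /=; apply: eq_bigr => e _.
under eq_bigr do rewrite exchange_big /=.
rewrite exchange_big /=; apply: eq_bigr => f _.
apply: eq_bigr => g _; apply: eq_bigr => h _.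
rewrite adjmxE !tensmxE rmorphM.
by rewrite mulrAC mulrC.
Qed.

Lemma bmeas_twirl2 A a b c d :
  bmeas (fun U : borel_mx R n => uind U * tens_entry (twirl2 A U) a b c d).
Proof.
pose v i j (U : 'M[C]_n) : C := uind U * U i j.
have -> : (fun U : borel_mx R n => uind U * tens_entry (twirl2 A U) a b c d) =
  (fun U => \sum_e \sum_f \sum_g \sum_h tens_entry A e f g h *
    (v a e U * v b f U * ((v c g U)^* * (v d h U)^*))).
  apply/funext => U; rewrite twirl2E mulr_sumr; apply: eq_bigr => e _.
  rewrite mulr_sumr; apply: eq_bigr => f _; rewrite mulr_sumr.
  apply: eq_bigr => g _; rewrite mulr_sumr; apply: eq_bigr => h _.
  rewrite /v /uind; case: (U \is _); rewrite ?mul1r // !mul0r ?mulr0 //.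
do 4!(apply: bmeas_sum => ?); apply: bmeasZ.
apply: bmeasM; apply: bmeasM; try exact: bmeas_uentry;
  apply: bmeas_conj; exact: bmeas_uentry.
Qed.

Lemma cmean_haar_invariant mu (V : 'M[C]_n) (f : 'M[C]_n -> C) :
  is_haar mu -> V \is unitarymx -> bmeas (f : borel_mx R n -> C) ->
  cmean mu (fun U => f (V *m U)) = cmean mu f.
Proof.
move=> [_ inv] uV bf.
have mV := measurable_mulmx V.
apply: (bfunctional_ext (bfunctional_cmean1 mu mV)
  (bfunctional_cmean1 mu (@measurable_id _ _ setT)) _ bf) => B mB.
have mVB : measurable ((fun U : borel_mx R n => V *m U : borel_mx R n) @^-1` B).
  by rewrite -[_ @^-1` _]setTI; apply: mV.
rewrite [X in X = _](_ : _ = cmean mu (fun U : borel_mx R n =>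
  (\1_((fun U : borel_mx R n => V *m U : borel_mx R n) @^-1` B) U)%:C)) //.
rewrite !cmean_indic //; congr (fine _ )%:C.
by have [+ _] := inv V B uV mB.
Qed.

Lemma unitary_adjK m (V : 'M[C]_m) : V \is unitarymx -> V ^t* *m V = 1%:M.
Proof. by move=> /unitarymxP; apply: mulmx1C. Qed.

Lemma mul_unitary_is (V U : 'M[C]_n) : V \is unitarymx ->
  (V *m U \is unitarymx) = (U \is unitarymx).
Proof.
move=> uV; apply/idP/idP => h; last exact: mul_unitarymx.
have -> : U = V ^t* *m (V *m U).
  by rewrite mulmxA unitary_adjK // mul1mx.
apply: mul_unitarymx; [by rewrite trmxC_unitary|exact: h].
Qed.

Lemma tensmx_adj (V : 'M[C]_n) : (V *t V) ^t* = V ^t* *t V ^t*.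
Proof.
apply/matrixP => i j.
rewrite -(mxtens_unindexK i) -(mxtens_unindexK j).
case: (mxtens_unindex i) => a b; case: (mxtens_unindex j) => c d.
by rewrite adjmxE !tensmxE !adjmxE rmorphM.
Qed.

Lemma tensmx_unitary (V : 'M[C]_n) : V \is unitarymx -> V *t V \is unitarymx.
Proof.
move=> /unitarymxP uV; apply/unitarymxP.
rewrite tensmx_adj tensmx_mul uV.
apply/matrixP => i j.
rewrite -(mxtens_unindexK i) -(mxtens_unindexK j).
case: (mxtens_unindex i) => a b; case: (mxtens_unindex j) => c d.
rewrite tensmxE !mxE (can_eq (@mxtens_indexK n n)) xpair_eqE.
by case: eqP => _ /=; case: eqP => _; rewrite ?mulr1 ?mulr0.
Qed.

Lemma tens_trE A : tens_tr A = \tr A.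
Proof. by rewrite /mxtrace tens_sum. Qed.

Lemma twirl2_tr A (U : 'M[C]_n) : U \is unitarymx ->
  tens_tr (twirl2 A U) = tens_tr A.
Proof.
move=> uU; rewrite !tens_trE /twirl2.
by rewrite mxtrace_mulC mulmxA unitary_adjK ?mul1mx // tensmx_unitary.
Qed.

(** [tens_trF] is the trace against the swap, and the swap commutes with U (x) U. *)
Lemma twirl2_trF A (U : 'M[C]_n) : U \is unitarymx ->
  tens_trF (twirl2 A U) = tens_trF A.
Proof.
move=> uU.
pose sw (i : 'I_(n * n)) := mxtens_index ((mxtens_unindex i).2, (mxtens_unindex i).1).
have swK : involutive sw.
  by move=> i; rewrite /sw mxtens_indexK -[RHS]mxtens_unindexK; case: mxtens_unindex.
pose F : 'M[C]_(n * n) := \matrix_(i, j) (j == sw i)%:R.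
have trFE B : tens_trF B = \tr (B *m F).
  rewrite /mxtrace tens_sum; apply: eq_bigr => a _; apply: eq_bigr => b _.
  rewrite mxE (bigD1 (mxtens_index (b, a))) //= big1 ?addr0.
    by rewrite mxE /sw mxtens_indexK eqxx mulr1.
  move=> i h; rewrite mxE; case: eqP => [e|]; last by rewrite mulr0.
  by move: h; rewrite -(swK i) -e /sw mxtens_indexK eqxx.
have FW : F *m (U *t U) = (U *t U) *m F.
  apply/matrixP => i j; rewrite !mxE (bigD1 (sw i)) //= big1 ?addr0; last first.
    by move=> k /negbTE h; rewrite mxE h mul0r.
  rewrite (bigD1 (sw j)) //= big1 ?addr0; last first.
    move=> k h; rewrite [F _ _]mxE; case: eqP => [e|]; last by rewrite mulr0.
    by move: h; rewrite e swK eqxx.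
  rewrite ![F _ _]mxE swK !eqxx mulr1 mul1r.
  rewrite -(mxtens_unindexK i) -(mxtens_unindexK j) /sw !mxtens_indexK.
  by rewrite !tensmxE mulrC.
rewrite !trFE /twirl2 -!mulmxA.
rewrite mxtrace_mulC -!mulmxA FW [_ *m (_ *m F)]mulmxA unitary_adjK ?mul1mx //.
exact: tensmx_unitary.
Qed.

(** By left invariance the mean twirl is fixed under conjugation by every V (x) V, hence a
    combination of identity and swap. Its trace and swap trace equal those of [A], and these two
    linear equations fix the two coefficients. *)
Lemma haar_second_moment mu : (1 < n)%N -> is_haar mu -> second_moment mu.
Proof.
move=> n1 hmu A.
pose T : 'M[C]_(n * n) := \matrix_(i, j)
  cmean mu (fun U => uind U * twirl2 A U i j).
have TE a b c d : tens_entry T a b c d =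
    cmean mu (fun U => uind U * tens_entry (twirl2 A U) a b c d).
  by rewrite /tens_entry mxE.
have TV (V : 'M[C]_n) : V \is unitarymx -> T = twirl2 T V.
  move=> uV; apply/matrixP => i j.
  rewrite -(mxtens_unindexK i) -(mxtens_unindexK j).
  case: (mxtens_unindex i) => a b; case: (mxtens_unindex j) => c d.
  rewrite -!/(tens_entry _ _ _ _ _) TE twirl2E.
  rewrite -(cmean_haar_invariant hmu uV (bmeas_twirl2 A a b c d)).
  have -> : (fun U : 'M[C]_n => uind (V *m U) *
        tens_entry (twirl2 A (V *m U)) a b c d) =
      (fun U => \sum_e \sum_f \sum_g \sum_h
        (V a e * V b f * ((V c g)^* * (V d h)^*)) *
          (uind U * tens_entry (twirl2 A U) e f g h)).
    apply/funext => U.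
    have -> : twirl2 A (V *m U) = twirl2 (twirl2 A U) V.
      by rewrite /twirl2 -tensmx_mul trmx_mul map_mxM !mulmxA.
    rewrite /uind mul_unitary_is // twirl2E !mulr_sumr.
    apply: eq_bigr => e _; rewrite mulr_sumr; apply: eq_bigr => f _.
    rewrite mulr_sumr; apply: eq_bigr => g _; rewrite mulr_sumr.
    by apply: eq_bigr => h _; rewrite mulrA mulrC.
  have bZ := fun e f g h => bmeasZ (V a e * V b f * ((V c g)^* * (V d h)^*))
    (bmeas_twirl2 A e f g h).
  rewrite cmean_sum; last by move=> e; do 3!(apply: bmeas_sum => ?).
  apply: eq_bigr => e _.
  rewrite cmean_sum; last by move=> f; do 2!(apply: bmeas_sum => ?).
  apply: eq_bigr => f _.
  rewrite cmean_sum; last by move=> g; apply: bmeas_sum.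
  apply: eq_bigr => g _; rewrite cmean_sum //.
  apply: eq_bigr => h _; rewrite cmeanZ; last exact: bmeas_twirl2.
  by rewrite mulrC TE.
have Tcomm (V : 'M[C]_n) : V \is unitarymx -> T *m (V *t V) = (V *t V) *m T.
  move=> uV; have uW := tensmx_unitary uV.
  rewrite [in LHS](TV V uV) /twirl2; move: (V *t V) uW => W uW.
  by have := congr1 (mulmx (W *m T)) (unitary_adjK uW); rewrite mulmxA mulmx1.
have [al [be Tab]] := commutant_span Tcomm n1.
have one : cmean mu (fun U : 'M[C]_n => uind U) = 1.
  rewrite uindE cmean_indic; last exact: measurable_unitarymx.
  by case: hmu => -> _.
(* A sum of entries of the twirl that is constant on unitaries keeps its value in the mean. The maps
   [g] and [h] select the trace or the swap trace. *)
have L (g h : 'I_n -> 'I_n -> 'I_n) (x : C) :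
    (forall U : 'M[C]_n, U \is unitarymx ->
      \sum_a \sum_b tens_entry (twirl2 A U) a b (g a b) (h a b) = x) ->
    \sum_a \sum_b tens_entry T a b (g a b) (h a b) = x.
  move=> gh; rewrite -[RHS]mulr1 -one -cmeanZ; last exact: bmeas_uind.
  have -> : (fun U : 'M[C]_n => x * uind U) = (fun U => \sum_a \sum_b
      uind U * tens_entry (twirl2 A U) a b (g a b) (h a b)).
    apply/funext => U; under [RHS]eq_bigr do rewrite -mulr_sumr.
    rewrite -mulr_sumr mulrC /uind; case: (boolP (U \is _)) => uU.
      by rewrite gh.
    by rewrite !mul0r.
  rewrite cmean_sum; last first.
    by move=> ?; apply: bmeas_sum => ?; apply: bmeas_twirl2.
  apply: eq_bigr => a _; rewrite cmean_sum; last first.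
    by move=> ?; apply: bmeas_twirl2.
  by apply: eq_bigr => b _; rewrite TE.
have Ttr : tens_tr T = tens_tr A by apply: L => U; apply: twirl2_tr.
have TtrF : tens_trF T = tens_trF A.
  by apply: (L (fun _ b => b) (fun a _ => a)) => U; apply: twirl2_trF.
have n0 : (n%:R : C) != 0 by rewrite pnatr_eq0 -lt0n ltnW.
have n2 : (n%:R ^+ 2 - 1 : C) != 0.
  by rewrite subr_eq0 -natrX pnatr_eq1 -(exp1n 2) eqn_exp2r // gtn_eqF.
have s1 (x : C) : \sum_(a < n) \sum_(b < n) x = n%:R ^+ 2 * x.
  by rewrite !sumr_const !card_ord -mulrnA -[x *+ _]mulr_natl natrM expr2.
have s2 (x : C) : \sum_(a < n) \sum_(b < n) x * (a == b)%:R = n%:R * x.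
  transitivity (\sum_(a < n) x); last by rewrite sumr_const card_ord mulr_natl.
  apply: eq_bigr => a _.
  rewrite (bigD1 a) //= big1 ?addr0 ?eqxx ?mulr1 // => b.
  by rewrite eq_sym => /negbTE ->; rewrite mulr0.
have e1 : tens_tr A = al * n%:R ^+ 2 + be * n%:R.
  rewrite -Ttr /tens_tr; under eq_bigr do under eq_bigr do
    rewrite Tab !eqxx mulr1 [_ && (_ == _)]andbC eq_sym andbb.
  under eq_bigr do rewrite big_split /=.
  by rewrite big_split /= s1 s2; ring.
have e2 : tens_trF A = al * n%:R + be * n%:R ^+ 2.
  rewrite -TtrF /tens_trF; under eq_bigr do under eq_bigr do
    rewrite Tab !eqxx mulr1 [_ && (_ == _)]andbC eq_sym andbb.
  under eq_bigr do rewrite big_split /=.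
  by rewrite big_split /= s1 s2; ring.
move=> a b c d; rewrite -TE Tab /haar_twirl e1 e2.
congr (_ * _ + _ * _); field; by rewrite n0 n2.
Qed.

End SecondMoment.

Section GateLaw.
Context (R : realType) (n : nat).
Local Notation C := R[i].
Implicit Types (mu : probability (borel_mx R n) R).

Lemma cmean_uniform (s : seq 'M[C]_n) mu (f : 'M[C]_n -> C) :
  is_uniform_on s mu -> bmeas (f : borel_mx R n -> C) ->
  cmean mu f = (size s)%:R^-1 * \sum_(U <- s) f U.
Proof.
move=> us bf.
have b1 := bfunctional_cmean1 mu (@measurable_id _ (borel_mx R n) setT).
pose L2 (f : borel_mx R n -> C) : C := (size s)%:R^-1 * \sum_(U <- s) f U.
have b2 : bfunctional L2.
  rewrite /L2; split.
  - by move=> g h _ _; rewrite big_split mulrDr.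
  - by move=> c g _; rewrite -mulr_sumr mulrCA.
  exists 1 => // g M bg gM.
  have rs : (size s)%:R^-1 = ((size s)%:R^-1 : R)%:C.
    by rewrite fmorphV rmorph_nat.
  rewrite rs ReM ImM /= !mul0r subr0 addr0 mul1r.
  have M0 : 0 <= M by apply: cbounded_ge0 gM; exact: 0.
  have h (p : {additive C -> R}) : (forall U, `|p (g U)| <= M) ->
      `|(size s)%:R^-1 * p (\sum_(U <- s) g U)| <= M.
    move=> pM; rewrite raddf_sum normrM ger0_norm ?invr_ge0 ?ler0n //.
    have [->|s0] := eqVneq (size s) 0%N; first by rewrite invr0 mul0r.
    rewrite ler_pdivrMl ?ltr0n ?lt0n //.
    apply: (le_trans (ler_norm_sum _ _ _)).
    apply: (@le_trans _ _ (\sum_(U <- s) M)); first by apply: ler_sum.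
    by rewrite big_const_seq count_predT iter_addr_0 mulr_natl.
  by split; apply: h => U; have [] := gM U.
apply: (bfunctional_ext b1 b2 _ bf) => B mB.
rewrite cmean_indic // us //= mulrC rmorphM rmorph_sum.
by rewrite fmorphV rmorph_nat.
Qed.

(** The indicator [uind] is 1 almost everywhere. This links [mx_mean], which integrates the bare
    entries, to the bounded functions used here. *)
Lemma mx_mean_unitary mu (F : 'M[C]_n -> C) :
  mu [set U : 'M[C]_n | U \is unitarymx] = 1%E ->
  cmeas (F : borel_mx R n -> C) ->
  bmeas (fun U : borel_mx R n => uind U * F U) ->
  cmean mu F = cmean mu (fun U => uind U * F U).
Proof.
move=> mu1 [F1 F2] [G1 G2 _].
have mu0 : mu (~` [set U : 'M[C]_n | U \is unitarymx]) = 0%E.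
  have := probability_setC mu (@measurable_unitarymx R n).
  by rewrite mu1 subee.
have ae (p : C -> R) : measurable_fun setT (fun U : borel_mx R n => p (F U)) ->
    measurable_fun setT (fun U : borel_mx R n => p (uind U * F U)) ->
    Rintegral mu setT (fun U => p (F U)) =
    Rintegral mu setT (fun U => p (uind U * F U)).
  move=> m1 m2; congr fine; apply: ae_eq_integral => //.
  - by apply/measurable_EFinP.
  - by apply/measurable_EFinP.
  exists (~` [set U : 'M[C]_n | U \is unitarymx]); split=> //.
    by apply: measurableC; exact: measurable_unitarymx.
  move=> U /= h uU; apply: h => _; rewrite /uind uU mul1r //.
by congr Complex; apply: ae.
Qed.

Lemma gate_second_moment mu : (1 < n)%N -> gate_law mu -> second_moment mu.
Proof.
move=> n1 [hmu|[s [us allu _ _ [nu hnu hs]] uni]]; first exact: haar_second_moment.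
move=> A a b c d; rewrite -(haar_second_moment n1 hnu).
rewrite (cmean_uniform uni (bmeas_twirl2 A a b c d)).
rewrite -mx_mean_unitary; last exact: bmeas_twirl2.
- have := congr1 (fun B => tens_entry B a b c d) (hs A).
  rewrite /tens_entry [in X in _ = X -> _]mxE => e; apply: etrans e.
  rewrite mxE summxE; congr (_ * _); rewrite big_seq [RHS]big_seq.
  apply: eq_bigr => U Us; rewrite /uind.
  by have /allP/(_ _ Us) -> := allu; rewrite mul1r.
- by case: hnu.
have -> : (fun U : 'M[C]_n => tens_entry (twirl2 A U) a b c d) =
  (fun U => \sum_e \sum_f \sum_g \sum_h tens_entry A e f g h *
    (U a e * U b f * ((U c g)^* * (U d h)^*))).
  by apply/funext => U; rewrite twirl2E.
do 4!(apply: cmeas_sum => ?); apply: cmeasM; first by split; exact: measurable_cst.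
apply: cmeasM; apply: cmeasM; try exact: cmeas_entry;
  apply: cmeas_conj; exact: cmeas_entry.
Qed.

End GateLaw.

(** * Domain walls *)

Section DomainWalls.
Context (R : realFieldType) (G : finType).
Variables (S P L L' : G -> G).
Hypotheses (SK : cancel S P) (PK : cancel P S).
Hypotheses (LK : cancel L L') (LK' : cancel L' L).
Hypothesis SL : forall i, L (S i) = S (L i).
Variables (q eta : R).
Hypothesis q_gt0 : 0 < q.
Hypothesis eta_def : eta = q / (q ^+ 2 + 1).
Implicit Types (a b : {ffun G -> bool}) (c : {ffun G -> bool} -> R).

Definition wall b i := b i != b (S i).
Definition nwalls b := (\sum_i wall b i)%N.
Definition near b i := [exists j, wall b j && ((i == j) || (i == S j))].

(** Coefficient of the symbol [z] after the mean of a gate whose two qudits carry the symbols [x]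
    and [y] (see [gate_coef_string]). *)
Definition gate_wt (x y z : bool) : R := if x == y then (z == x)%:R else eta.

(** [S] steps around the ring of gates, and gate [i] of the new layer meets the gates [L i] and
    [S (L i)] of the old one. *)
Definition wall_step c b : R :=
  \sum_a c a * \prod_i gate_wt (a (L i)) (a (S (L i))) (b i).

Definition site_wt b i (z : bool) : R :=
  if z == b i then 1 else if near b i then 0 else q ^- 2.

(* The walls of [b] are required to be present in [a]; elsewhere a mismatch
   costs q^-2, which makes the uniform strings conserved by [wall_step]. *)
Definition wall_fun b a : R := \prod_i site_wt b i (a i).

Definition wall_pair c b : R := \sum_a c a * wall_fun b a.

(** The values 1 and 1/4 per gate are the exact pairings of the first layer with the two uniform
    strings, before any wall constraint (see [string_coef_bound]). *)
Definition string_wt b : R := \prod_i (if b i then 1 else 4^-1).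

Let q0 : q != 0. Proof. exact: lt0r_neq0. Qed.
Let q2 : q ^+ 2 + 1 != 0.
Proof. by rewrite lt0r_neq0 // addr_gt0 ?exprn_gt0. Qed.

Lemma eta_ge0 : 0 <= eta.
Proof. by rewrite eta_def divr_ge0 ?addr_ge0 ?exprn_ge0 ?ltW. Qed.

Lemma eta_le : eta <= q^-1.
Proof.
rewrite eta_def ler_pdivrMr ?addr_gt0 ?exprn_gt0 //.
rewrite mulrDr mulr1 expr2 mulrA mulVf // mul1r lerDl invr_ge0; exact: ltW.
Qed.

Lemma nearE b i : near b i = wall b i || wall b (P i).
Proof.
apply/existsP/orP => [[j /andP[wj /orP[/eqP->|/eqP->]]]|[w|w]].
- by left.
- by right; rewrite SK.
- by exists i; rewrite w eqxx.
- by exists (P i); rewrite w PK eqxx orbT.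
Qed.

(** The dual action of a gate on the test function. On a mismatched input, the site weights 1 and
    q^-2 away from walls give eta (1 + q^-2) = q^-1, while the forbidden symbol near a wall leaves
    only eta. *)
Definition gate_fun b i (x y : bool) : R :=
  if x == y then site_wt b i x else if near b i then eta else q^-1.

Lemma gate_funE b i x y :
  \sum_z gate_wt x y z * site_wt b i z = gate_fun b i x y.
Proof.
rewrite big_bool /gate_wt /gate_fun /site_wt.
have e : eta * (1 + q ^- 2) = q^-1 by rewrite eta_def; field; rewrite q0 q2.
case: x; case: y => /=; rewrite ?mul1r ?mul0r ?addr0 ?add0r //;
  case: (b i) => /=; case: (near b i); rewrite ?mulr0 ?mulr1 ?addr0 ?add0r //;
  rewrite -e; ring.
Qed.

Lemma gate_fun_ge0 b i x y : 0 <= gate_fun b i x y.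
Proof.
rewrite /gate_fun /site_wt; case: eqP => _; last first.
  by case: near; rewrite ?eta_ge0 ?invr_ge0 ?ltW.
by case: eqP => _ //; case: near => //; rewrite invr_ge0 exprn_ge0 ?ltW.
Qed.

Lemma wall_pair_step c b : wall_pair (wall_step c) b =
  \sum_a c a * \prod_i gate_fun b i (a (L i)) (a (S (L i))).
Proof.
rewrite /wall_pair /wall_step.
under eq_bigr do rewrite mulr_suml.
rewrite exchange_big /=; apply: eq_bigr => a _.
under eq_bigr do rewrite -mulrA.
rewrite -mulr_sumr; congr (_ * _).
under [RHS]eq_bigr do rewrite -gate_funE.
rewrite bigA_distr_bigA /=; apply: eq_bigr => b' _.
by rewrite /wall_fun -big_split.
Qed.

(* The links of layer l+1 are the pairs of layer l: the link to the right of
   gate [i] is the pair [S (L i)]. *)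
Definition wall_moves b : pred {ffun G -> bool} := fun a =>
  [forall i, ~~ wall b i ==> (a (S (L i)) == b i)].

(** The predecessor of [b] to which [a] is charged. A wall of [b] between gates [i] and [S i] lies
    over the old gate [S (L i)], and the symbol of [a] there decides to which side it moves. *)
Definition moved b a : {ffun G -> bool} :=
  [ffun e => if wall b (L' (P e)) then a e else b (L' (P e))].

Lemma movedE b a i :
  moved b a (S (L i)) = if wall b i then a (S (L i)) else b i.
Proof. by rewrite ffunE SK LK. Qed.

Lemma movedEl b a i :
  moved b a (L i) = if wall b (P i) then a (L i) else b i.
Proof.
have -> : L i = S (L (P i)) by rewrite -SL PK.
rewrite movedE; case: ifPn => //; rewrite /wall PK => /negPn/eqP //.
Qed.

Lemma moved_moves b a : wall_moves b (moved b a).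
Proof. by apply/forallP => i; apply/implyP => h; rewrite movedE (negPf h). Qed.

Section Good.
Variables (b a : {ffun G -> bool}).
Hypothesis good : forall i, near b i ->
  ~~ ((a (L i) == a (S (L i))) && (a (L i) != b i)).

(** A wall of [moved b a] at [L i] is counted by the mismatches of the two inputs of gate [i] with
    [b i]; [good] excludes two of them. Regrouped by links, each wall of [b] yields exactly one
    mismatch, as its old gate differs from exactly one of the two sides. *)
Lemma nwalls_moved : nwalls (moved b a) = nwalls b.
Proof.
rewrite /nwalls (reindex_inj (can_inj LK)) /=.
transitivity (\sum_i ((moved b a (L i) != b i) + (moved b a (S (L i)) != b i)))%N.
  apply: eq_bigr => i _; rewrite /wall movedE movedEl.
  have := good (i := i); rewrite nearE.
  case: (wall b i); case: (wall b (P i)); case: (a (L i)); case: (a (S (L i)));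
    case: (b i) => //= h; by have := h isT.
rewrite big_split /= (reindex_inj (can_inj SK)) /= -big_split /=.
apply: eq_bigr => i _; rewrite SL movedE /wall.
by case: (b i); case: (b (S i)); case: (a (S (L i))).
Qed.

(** Each gate is bounded by a product over its two sides, a mismatch costing eta at a wall of [b]
    and q^-1 elsewhere. Regrouped by links, a wall has one mismatched side and gives eta; a link
    without wall has both sides or none, and q^-1 twice is the site weight q^-2. *)
Lemma gate_fun_good : \prod_i gate_fun b i (a (L i)) (a (S (L i))) <=
  eta ^+ nwalls b * wall_fun (moved b a) a.
Proof.
pose side (w m : bool) : R := if m then if w then eta else q^-1 else 1.
have step1 : \prod_i gate_fun b i (a (L i)) (a (S (L i))) <= \prod_i
    (side (wall b (P i)) (a (L i) != b i) * side (wall b i) (a (S (L i)) != b i)).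
  apply: ler_prod => i _; rewrite gate_fun_ge0 /=.
  have := good (i := i); rewrite /gate_fun /site_wt nearE /side.
  have := eta_le; have := eta_ge0.
  have q1 : q ^- 2 = q^-1 * q^-1 by rewrite -exprVn expr2.
  case: (wall b i); case: (wall b (P i)); case: (a (L i)); case: (a (S (L i)));
   case: (b i) => //= e0 e1 h; rewrite ?mulr1 ?mul1r ?q1 //; by have := h isT.
apply: (le_trans step1); rewrite big_split /= (reindex_inj (can_inj SK)) /=.
rewrite -big_split /=.
have -> : eta ^+ nwalls b = \prod_i (if wall b i then eta else 1).
  rewrite /nwalls [RHS](eq_bigr (fun i => eta ^+ (wall b i))); last first.
    by move=> i _; case: (wall b i).
  by rewrite prodrXr.
have -> : wall_fun (moved b a) a =
    \prod_i site_wt (moved b a) (S (L i)) (a (S (L i))).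
  rewrite /wall_fun (reindex_inj (h := S \o L)) //.
  by apply: inj_comp; [exact: can_inj SK|exact: can_inj LK].
rewrite -big_split /=; apply: ler_prod => i _.
rewrite SK SL; apply/andP; split.
  have s0 w m : 0 <= side w m.
    by rewrite /side; case: m => //; case: w; rewrite ?eta_ge0 ?invr_ge0 ?ltW.
  exact: mulr_ge0.
(* Next to a wall of [moved b a] the string [a] agrees with it, so the vanishing site weight never
   occurs on the right-hand side. *)
have nr : near (moved b a) (S (L i)) -> a (S (L i)) = moved b a (S (L i)).
  rewrite nearE SK => /orP[w|]; last first.
    rewrite /wall movedE movedEl; have := good (i := i); rewrite nearE.
    case: (wall b i) => //; case: (wall b (P i)); case: (a (L i));
    case: (a (S (L i))); case: (b i) => //= h _; by have := h isT.
  move: w; rewrite /wall -SL movedE movedEl SK.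
  have := good (i := S i); rewrite nearE SK.
  case: (wall b i) => //.
  case: (wall b (S i)); case: (a (L (S i)));
    case: (a (S (L (S i)))); case: (b (S i)) => //= h _; by have := h isT.
rewrite /site_wt movedE /side.
have q1 : q ^- 2 = q^-1 * q^-1 by rewrite -exprVn expr2.
move: nr; rewrite movedE /wall.
case: (b i); case: (b (S i)); case: (a (S (L i))) => //= nr;
  rewrite ?mulr1 ?mul1r // ?q1; case: (near _ _) nr => // h; by have := h isT.
Qed.

End Good.

(** If [good] fails, some gate next to a wall sees two equal symbols opposite to [b]; its weight is
    0 and so is the whole product. *)
Lemma gate_fun_le b a : \prod_i gate_fun b i (a (L i)) (a (S (L i))) <=
  eta ^+ nwalls b *
  \sum_(a' | wall_moves b a' && (nwalls a' == nwalls b)) wall_fun a' a.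
Proof.
have wf0 a' : 0 <= wall_fun a' a.
  apply: prodr_ge0 => i _; rewrite /site_wt; case: eqP => // _.
  by case: near => //; rewrite invr_ge0 exprn_ge0 ?ltW.
case: (boolP [forall i, near b i ==>
    ~~ ((a (L i) == a (S (L i))) && (a (L i) != b i))]) => [/forallP g|].
  have good i : near b i -> ~~ ((a (L i) == a (S (L i))) && (a (L i) != b i)).
    by have /implyP := g i.
  apply: (le_trans (gate_fun_good good)).
  apply: ler_wpM2l; first by rewrite exprn_ge0 ?eta_ge0.
  rewrite (bigD1 (moved b a)) ?moved_moves ?nwalls_moved ?eqxx //= lerDl.
  exact: sumr_ge0.
case/forallPn => i; rewrite negb_imply negbK => /andP[ni /andP[e ne]].
rewrite (bigD1 i) //= /gate_fun e /site_wt (negPf ne) ni mul0r.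
by rewrite mulr_ge0 ?sumr_ge0 ?exprn_ge0 ?eta_ge0.
Qed.

(** The origin of 5/2. The old gate under a wall is free, which gives 1 + 1/4 = 5/4, while the wall
    accounts for 1/2 in [string_wt b] when that weight is split evenly between adjacent links; the
    quotient is 5/2. Other links reproduce their share exactly. *)
Lemma string_wt_moves b :
  \sum_(a | wall_moves b a) string_wt a = (5 / 2) ^+ nwalls b * string_wt b.
Proof.
pose w (z : bool) : R := if z then 1 else 4^-1.
pose F i z : R := if wall b i || (z == b i) then w z else 0.
transitivity (\prod_i \sum_z F i z).
  rewrite bigA_distr_bigA /=.
  pose h a : {ffun G -> bool} := [ffun i => a (S (L i))].
  pose h' a : {ffun G -> bool} := [ffun e => a (L' (P e))].
  have hK : cancel h h' by move=> a; apply/ffunP => e; rewrite !ffunE LK' PK.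
  have hK' : cancel h' h by move=> a; apply/ffunP => e; rewrite !ffunE SK LK.
  rewrite [RHS](reindex_inj (can_inj hK)) /= [LHS]big_mkcond /=.
  apply: eq_bigr => a _; rewrite /wall_moves.
  case: (boolP [forall i, _]) => [/forallP g|].
    rewrite /string_wt (reindex_inj (h := S \o L)) /=; last first.
      by apply: inj_comp; [exact: can_inj SK|exact: can_inj LK].
    apply: eq_bigr => i _; rewrite ffunE /F -/(w _).
    by have := g i; case: (wall b i) => //= ->.
  case/forallPn => i; rewrite negb_imply => /andP[/negbTE h1 /negbTE h2].
  by rewrite (bigD1 i) //= /F ffunE h1 h2 mul0r.
have -> : (5 / 2) ^+ nwalls b = \prod_i (if wall b i then 5 / 2 else 1) :> R.
  rewrite /nwalls [RHS](eq_bigr (fun i => (5 / 2) ^+ (wall b i))); last first.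
    by move=> i _; case: (wall b i).
  by rewrite prodrXr.
(* Square roots of the site weights, one for each of the two links of a site. *)
pose r (z : bool) : R := if z then 1 else 2^-1.
have -> : string_wt b = \prod_i (r (b i) * r (b (S i))).
  have e : \prod_i r (b i) = \prod_i r (b (S i)).
    exact: (reindex_inj (can_inj SK)).
  rewrite big_split /= -e -big_split /=; apply: eq_bigr => i _; rewrite /r; case: (b i).
    by rewrite mulr1.
  by field.
rewrite -big_split /=; apply: eq_bigr => i _.
by rewrite big_bool /F /wall /w /r; case: (b i); case: (b (S i)) => /=; field.
Qed.

(** All predecessors in [gate_fun_le] have as many walls as [b], so the hypothesis enters with a
    single exponent; eta comes from that lemma and 5/2 from [string_wt_moves]. *)
Lemma wall_step_bound c be : (forall a, 0 <= c a) -> 0 <= be ->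
  (forall b, wall_pair c b <= string_wt b * be ^+ nwalls b) ->
  forall b, wall_pair (wall_step c) b <=
    string_wt b * (5 / 2 * eta * be) ^+ nwalls b.
Proof.
move=> c0 be0 h b; rewrite wall_pair_step.
apply: (@le_trans _ _ (eta ^+ nwalls b *
  \sum_(a' | wall_moves b a' && (nwalls a' == nwalls b)) wall_pair c a')).
  rewrite /wall_pair exchange_big /= mulr_sumr; apply: ler_sum => a _.
  rewrite -mulr_sumr mulrCA; apply: ler_wpM2l => //; exact: gate_fun_le.
have -> : string_wt b * (5 / 2 * eta * be) ^+ nwalls b =
    eta ^+ nwalls b * ((5 / 2) ^+ nwalls b * string_wt b * be ^+ nwalls b).
  by set x := 5 / 2; rewrite !exprMn; ring.
apply: ler_wpM2l; first by rewrite exprn_ge0 ?eta_ge0.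
apply: (@le_trans _ _ (\sum_(a' | wall_moves b a' && (nwalls a' == nwalls b))
   string_wt a' * be ^+ nwalls b)).
  by apply: ler_sum => a' /andP[_ /eqP <-].
rewrite -mulr_suml; apply: ler_wpM2r; first exact: exprn_ge0.
rewrite -string_wt_moves big_mkcondr /=; apply: ler_sum => a _.
by case: ifP => // _; apply: prodr_ge0 => i _; case: (a i); rewrite ?invr_ge0.
Qed.

Lemma wall_step_ge0 c b : (forall a, 0 <= c a) -> 0 <= wall_step c b.
Proof.
move=> c0; apply: sumr_ge0 => a _; apply: mulr_ge0 => //.
apply: prodr_ge0 => i _; rewrite /gate_wt; case: eqP => _; last exact: eta_ge0.
by case: eqP.
Qed.

End DomainWalls.

(** * Transfer matrices for sums over strings on a ring *)

Section RingSum.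
Context (R : realFieldType) (A : finType).

Definition ffun_cons (n : nat) (x : A) (f : {ffun 'I_n -> A}) :
    {ffun 'I_n.+1 -> A} :=
  [ffun i => if unlift ord0 i is Some j then f j else x].

Lemma sum_ffun_cons n (F : {ffun 'I_n.+1 -> A} -> R) :
  \sum_f F f = \sum_x \sum_(f : {ffun 'I_n -> A}) F (ffun_cons x f).
Proof.
rewrite pair_bigA /=.
pose h (f : {ffun 'I_n.+1 -> A}) := (f ord0, [ffun i => f (lift ord0 i)]).
rewrite (reindex (fun p : A * {ffun 'I_n -> A} => ffun_cons p.1 p.2)) //.
exists h => [[x f]|f] _; rewrite /h.
  congr pair; first by rewrite ffunE unlift_none.
  by apply/ffunP => i; rewrite !ffunE liftK.
by apply/ffunP => i; rewrite !ffunE; case: unliftP => [j|] -> //; rewrite ffunE.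
Qed.

Variable T : A -> A -> R.

Definition chain_site n (x : A) (f : {ffun 'I_n -> A}) (y : A) (i : nat) : A :=
  if i is j.+1 then (if insub j is Some k then f k else y) else x.

(** The entry (x, y) of the matrix power T^(n+1). *)
Definition chain_sum n (x y : A) : R := \sum_(f : {ffun 'I_n -> A})
  \prod_(i < n.+1) T (chain_site x f y i) (chain_site x f y i.+1).

Lemma chain_site_cons n x z (f : {ffun 'I_n -> A}) y i :
  chain_site x (ffun_cons z f) y i.+1 = chain_site z f y i.
Proof.
have insE p (j : 'I_p) : insub (j : nat) = Some j.
  exact: (valK j).
case: i => [|i] /=.
  by rewrite (insE _ (ord0 : 'I_n.+1)) ffunE unlift_none.
case: (ltnP i n) => h.
  rewrite (insE _ (lift ord0 (Ordinal h))) (insE _ (Ordinal h)) ffunE.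
  by rewrite liftK.
by rewrite !insubF // ?ltnS; apply/negbTE; rewrite -leqNgt.
Qed.

Lemma chain_sum0 x y : chain_sum 0 x y = T x y.
Proof.
rewrite /chain_sum (eq_bigr (fun=> T x y)) => [|f _].
  by rewrite sumr_const card_ffun card_ord expn0 mulr1n.
by rewrite big_ord_recl big_ord0 mulr1 /= insubF.
Qed.

Lemma chain_sumS n x y :
  chain_sum n.+1 x y = \sum_z T x z * chain_sum n z y.
Proof.
rewrite /chain_sum sum_ffun_cons; apply: eq_bigr => z _.
rewrite mulr_sumr; apply: eq_bigr => f _.
rewrite big_ord_recl; congr (_ * _); first by rewrite chain_site_cons.
by apply: eq_bigr => i _; rewrite !chain_site_cons.
Qed.

(** The ring is cut at site 0, whose symbol serves as both ends of a chain: the sum is the trace of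
    T^(n+1). *)
Lemma ring_sum n : \sum_(b : {ffun 'I_n.+1 -> A}) \prod_i T (b i) (b (ordS i)) =
  \sum_x chain_sum n x x.
Proof.
rewrite sum_ffun_cons; apply: eq_bigr => x _; apply: eq_bigr => f _.
have e i : ffun_cons x f i = chain_site x f x i.
  rewrite ffunE; case: unliftP => [j|] -> //=.
  by have := valK j => /= ->.
apply: eq_bigr => i _; rewrite !e; congr T.
rewrite /= ; have := ltn_ord i; rewrite ltnS leq_eqVlt => /orP[/eqP ->|h].
  by rewrite modnn /= insubF // ltnn.
by rewrite modn_small.
Qed.

End RingSum.

Section MixedSum.
Context (R : realFieldType) (Y be : R).
Hypotheses (Y0 : 0 <= Y) (Y1 : Y < 1) (be0 : 0 <= be).

Definition wall_transfer (x y : bool) : R :=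
  (if x then Y else 1) * (if x == y then 1 else be).

(** [kap] = Y + Y^2 + ... weighs a run of identities of any length, and [mu] weighs such runs
    counted with their length, as is needed for a run through the cut. [lam] is the growth per site
    when a run enclosed by two walls may occur. *)
Let nu := (1 - Y)^-1.
Let kap := Y * nu.
Let mu := nu * kap.
Let lam := 1 + be ^+ 2 * kap.
Local Notation Z := (chain_sum wall_transfer).

Let nu1 : 0 < 1 - Y. Proof. by rewrite subr_gt0. Qed.
Let nu0 : 0 <= nu. Proof. by rewrite invr_ge0 ltW. Qed.
Let kap0 : 0 <= kap. Proof. exact: mulr_ge0. Qed.
Let mu0 : 0 <= mu. Proof. exact: mulr_ge0. Qed.
Let lam1 : 1 <= lam. Proof. by rewrite lerDl mulr_ge0 ?exprn_ge0. Qed.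
Let lamn n : 0 <= lam ^+ n.
Proof. by rewrite exprn_ge0 // (le_trans _ lam1). Qed.
Let nuK : (1 - Y) * nu = 1. Proof. by rewrite divff // lt0r_neq0. Qed.

Lemma chain_sum_false n :
  Z n false false <= lam ^+ n.+1 /\ Z n true false <= be * kap * lam ^+ n.+1.
Proof.
elim: n => [|n [D E]].
  rewrite !chain_sum0 /wall_transfer /= !mulr1 expr1; split=> //.
  rewrite [Y * be]mulrC -mulrA; apply: ler_wpM2l => //.
  rewrite -[leLHS]mulr1; apply: ler_pM => //.
  rewrite /kap ler_peMr // -nuK ler_piMl // gerBl //.
rewrite !chain_sumS !big_bool /wall_transfer /= !mulr1 !mul1r.
have D' := ler_wpM2l (mulr_ge0 Y0 be0) D.
have E' := ler_wpM2l Y0 E; have E'' := ler_wpM2l be0 E.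
split.
  apply: le_trans (lerD E'' D) _; rewrite [lam ^+ n.+2]exprS.
  set t := lam ^+ n.+1; rewrite le_eqVlt; apply/orP; left; apply/eqP.
  by rewrite /lam; ring.
apply: le_trans (lerD E' D') _.
have -> : Y * (be * kap * lam ^+ n.+1) + Y * be * lam ^+ n.+1 =
    be * kap * lam ^+ n.+1.
  have -> : Y * (be * kap * lam ^+ n.+1) + Y * be * lam ^+ n.+1 =
    be * Y * lam ^+ n.+1 * (kap + 1) by ring.
  have -> : kap + 1 = nu by rewrite -nuK /kap; ring.
  by rewrite /kap; ring.
rewrite [lam ^+ n.+2]exprS mulrA; apply: ler_wpM2r => //.
by rewrite ler_peMr // mulr_ge0.
Qed.

(** The subtracted power of [Y] makes the second recurrence close exactly, since 1 - nu = - Y nu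
    turns the leftover of one step into the subtracted term of the next. *)
Lemma chain_sum_true n :
  Z n true true <= Y ^+ n.+1 + be ^+ 2 * mu * lam ^+ n.+1 /\
  Z n false true <= be * nu * (lam ^+ n.+1 - Y ^+ n.+1).
Proof.
elim: n => [|n [A B]].
  rewrite !chain_sum0 /wall_transfer /= !mulr1 !expr1 mul1r; split.
    by rewrite lerDl mulr_ge0 ?mulr_ge0 ?exprn_ge0 ?(le_trans _ lam1).
  rewrite -{1}[be]mulr1 -mulrA; apply: ler_wpM2l => //.
  by rewrite -nuK mulrC; apply: ler_wpM2l => //; rewrite lerB.
rewrite !chain_sumS !big_bool /wall_transfer /= !mulr1 !mul1r.
have A' := ler_wpM2l Y0 A; have A'' := ler_wpM2l be0 A.
have B' := ler_wpM2l (mulr_ge0 Y0 be0) B.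
have Yn : 0 <= Y ^+ n.+1 by rewrite exprn_ge0.
have kn : kap + 1 = nu by rewrite -nuK /kap; ring.
have mk : Y * (mu + nu) = mu.
  by rewrite /mu -[X in _ * (_ + X)]mulr1 -mulrDr kn /kap; ring.
split.
  apply: le_trans (lerD A' B') _.
  have -> : Y * (Y ^+ n.+1 + be ^+ 2 * mu * lam ^+ n.+1) +
     Y * be * (be * nu * (lam ^+ n.+1 - Y ^+ n.+1)) =
     Y ^+ n.+2 + be ^+ 2 * (Y * (mu + nu)) * lam ^+ n.+1
       - Y * be * (be * nu * Y ^+ n.+1) by rewrite [Y ^+ n.+2]exprS; ring.
  rewrite mk.
  apply: (@le_trans _ _ (Y ^+ n.+2 + be ^+ 2 * mu * lam ^+ n.+1)).
    by rewrite lerBlDr lerDl !mulr_ge0.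
  rewrite lerD2l; apply: ler_wpM2l; first by rewrite mulr_ge0 ?exprn_ge0.
  by rewrite [leRHS]exprS ler_peMl.
apply: le_trans (lerD A'' B) _.
have -> : be * (Y ^+ n.+1 + be ^+ 2 * mu * lam ^+ n.+1) +
   be * nu * (lam ^+ n.+1 - Y ^+ n.+1) =
   be * Y ^+ n.+1 * (1 - nu) + be * lam ^+ n.+1 * (nu + be ^+ 2 * mu) by ring.
rewrite le_eqVlt; apply/orP; left; apply/eqP.
have -> : 1 - nu = - (Y * nu) by rewrite -nuK; ring.
have -> : nu + be ^+ 2 * mu = nu * lam by rewrite /lam /mu; ring.
by rewrite [lam ^+ n.+2]exprS [Y ^+ n.+2]exprS; ring.
Qed.

Lemma ring_wall_sum n :
  \sum_(b : {ffun 'I_n.+1 -> bool})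
     (\prod_i (if b i then Y else 1)) * be ^+ nwalls (@ordS n.+1) b <=
  Y ^+ n.+1 + (1 + be ^+ 2 * mu) * lam ^+ n.+1.
Proof.
have -> : \sum_(b : {ffun 'I_n.+1 -> bool})
     (\prod_i (if b i then Y else 1)) * be ^+ nwalls (@ordS n.+1) b =
   \sum_(b : {ffun 'I_n.+1 -> bool}) \prod_i wall_transfer (b i) (b (ordS i)).
  apply: eq_bigr => b _; rewrite big_split /=; congr (_ * _).
  rewrite /nwalls -prodrXr; apply: eq_bigr => i _; rewrite /wall.
  by case: (b i); case: (b (ordS i)).
rewrite ring_sum big_bool.
have [A _] := chain_sum_true n; have [D _] := chain_sum_false n.
apply: le_trans (lerD A D) _; lra.
Qed.

End MixedSum.

(** * Decoding *)

Section Operators.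
Context (R : realType).
Local Notation C := R[i].

(** [rentry] and [mkrop] are the rectangular counterparts of [entry] and [mkop], for Kraus operators
    between different spaces. *)
Definition rentry (T1 T2 : finType) (A : 'M[C]_(#|T1|, #|T2|)) (x : T1) (y : T2) : C :=
  A (enum_rank x) (enum_rank y).

Definition mkrop (T1 T2 : finType) (f : T1 -> T2 -> C) : 'M[C]_(#|T1|, #|T2|) :=
  \matrix_(i, j) f (enum_val i) (enum_val j).

Lemma rentryE (T1 T2 : finType) (f : T1 -> T2 -> C) x y : rentry (mkrop f) x y = f x y.
Proof. by rewrite /rentry mxE !enum_rankK. Qed.

Lemma entryE (T : finType) (f : T -> T -> C) x y : entry (mkop f) x y = f x y.
Proof. exact: rentryE. Qed.

Lemma rentryP (T1 T2 : finType) (A B : 'M[C]_(#|T1|, #|T2|)) : rentry A =2 rentry B -> A = B.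
Proof.
move=> h; apply/matrixP => i j.
by have := h (enum_val i) (enum_val j); rewrite /rentry !enum_valK.
Qed.

Lemma sum_enum_rank (T : finType) (F : 'I_#|T| -> C) :
  \sum_i F i = \sum_(x : T) F (enum_rank x).
Proof.
rewrite (reindex (@enum_rank T)) //.
by exists (@enum_val T T) => i _; rewrite ?enum_rankK ?enum_valK.
Qed.

Lemma rentryM (T1 T2 T3 : finType) (A : 'M[C]_(#|T1|, #|T2|)) (B : 'M[C]_(#|T2|, #|T3|)) x y :
  rentry (A *m B) x y = \sum_z rentry A x z * rentry B z y.
Proof. by rewrite /rentry mxE sum_enum_rank. Qed.

Lemma rentry_adj (T1 T2 : finType) (A : 'M[C]_(#|T1|, #|T2|)) x y :
  rentry (A ^t* : 'M[C]_(#|T2|, #|T1|)) x y = (rentry A y x)^*.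
Proof. by rewrite /rentry !mxE. Qed.

Lemma rentry_sum (T1 T2 : finType) (I : finType) (A : I -> 'M[C]_(#|T1|, #|T2|)) x y :
  rentry (\sum_i A i) x y = \sum_i rentry (A i) x y.
Proof. by rewrite /rentry summxE. Qed.

Lemma tr_rentry (T : finType) (A : qop R T) : \tr A = \sum_x entry A x x.
Proof. by rewrite /mxtrace sum_enum_rank. Qed.

Lemma adjmxM m n p (A : 'M[C]_(m, n)) (B : 'M[C]_(n, p)) :
  (A *m B) ^t* = B ^t* *m A ^t*.
Proof. by rewrite trmx_mul map_mxM. Qed.

Lemma psd_congr m n (A : 'M[C]_n) (B : 'M[C]_(m, n)) :
  psd A -> psd (B *m A *m B ^t*).
Proof.
move=> h u; have := h (u *m B); congr (0 <= _).
by rewrite adjmxM !mulmxA.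
Qed.

Lemma psd_sum n (I : finType) (A : I -> 'M[C]_n) :
  (forall i, psd (A i)) -> psd (\sum_i A i).
Proof.
move=> h u; rewrite mulmx_sumr mulmx_suml summxE.
by apply: sumr_ge0 => i _; apply: h.
Qed.

Section Kraus.
Context (S S' J : finType) (K : J -> 'M[C]_(#|S'|, #|S|)).

Definition kraus_map (X : qop R S) : qop R S' := \sum_j K j *m X *m (K j) ^t*.

Lemma kraus_map_linear : linear kraus_map.
Proof.
move=> c X Y; rewrite /kraus_map scaler_sumr -big_split /=.
by apply: eq_bigr => j _; rewrite mulmxDr mulmxDl -scalemxAr -scalemxAl.
Qed.

HB.instance Definition _ :=
  GRing.isLinear.Build C (qop R S) (qop R S') _ kraus_map kraus_map_linear.

(** The operator B (x) 1 on S * A. *)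
Definition amp_op (A : finType) (B : 'M[C]_(#|S'|, #|S|)) :
    'M[C]_(#|{: S' * A}|, #|{: S * A}|) :=
  mkrop (fun x s => rentry B x.1 s.1 * (x.2 == s.2)%:R).

Lemma ampl_kraus (A : finType) (X : qop R (S * A)%type) :
  ampl kraus_map X = \sum_j amp_op A (K j) *m X *m (amp_op A (K j)) ^t*.
Proof.
apply: rentryP => x y; rewrite rentryE rentry_sum /kraus_map.
rewrite -[entry _ _ _]/(rentry _ _ _) rentry_sum; apply: eq_bigr => j _.
rewrite !rentryM.
transitivity (\sum_(t : S) \sum_(s : S) rentry (K j) x.1 s *
    entry X (s, x.2) (t, y.2) * (rentry (K j) y.1 t)^*).
  apply: eq_bigr => t _; rewrite rentry_adj rentryM mulr_suml.
  by apply: eq_bigr => s _; rewrite -[rentry (mkop _) _ _]/(entry _ _ _) entryE.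
have sumpair (F : S * A -> C) (z : A) : (forall s, s.2 != z -> F s = 0) ->
    \sum_s F s = \sum_(s : S) F (s, z).
  move=> h; rewrite (eq_bigr (fun p => F (p.1, p.2))); last by case.
  rewrite -(pair_bigA _ (fun s a => F (s, a))) /=.
  apply: eq_bigr => s _; rewrite (bigD1 z) //= big1 ?addr0 // => a az.
  exact: h.
rewrite [RHS](sumpair _ y.2); last first.
  by move=> s; rewrite rentry_adj rentryE eq_sym => /negbTE ->; rewrite mulr0 conjC0 mulr0.
apply: eq_bigr => t _; rewrite rentry_adj rentryE eqxx mulr1 rentryM mulr_suml.
rewrite [RHS](sumpair _ x.2); last first.
  by move=> s; rewrite rentryE eq_sym => /negbTE ->; rewrite mulr0 !mul0r.
by apply: eq_bigr => s _; rewrite rentryE eqxx mulr1.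
Qed.

Lemma kraus_cp : completely_positive kraus_map.
Proof.
move=> r X hX; rewrite ampl_kraus; apply: psd_sum => j; exact: psd_congr.
Qed.

Lemma kraus_tp : \sum_j (K j) ^t* *m K j = 1%:M -> trace_preserving kraus_map.
Proof.
move=> h X; rewrite /kraus_map raddf_sum /=.
under eq_bigr do rewrite mxtrace_mulC mulmxA.
by rewrite -raddf_sum /= -mulmx_suml h mul1mx.
Qed.

End Kraus.

Lemma kraus_map_comp (S1 S2 S3 J1 J2 : finType)
    (K : J1 -> 'M[C]_(#|S2|, #|S1|)) (D : J2 -> 'M[C]_(#|S3|, #|S2|)) X :
  kraus_map D (kraus_map K X) = kraus_map (fun ji : J2 * J1 => D ji.1 *m K ji.2) X.
Proof.
rewrite /kraus_map -(pair_bigA _ (fun j i => D j *m K i *m X *m (D j *m K i) ^t*)) /=.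
apply: eq_bigr => j _; rewrite mulmx_sumr mulmx_suml; apply: eq_bigr => i _.
by rewrite adjmxM !mulmxA.
Qed.

End Operators.

(** * Fidelity with a pure state and entanglement fidelity *)

Section SquareRoots.
Context (R : realType).
Local Notation C := R[i].

Lemma herm_normal n (A : 'M[C]_n) : A ^t* = A -> A \is normalmx.
Proof. by move=> h; apply/normalmxP; rewrite h. Qed.

(** Every eigenvalue is 0 or [c], so its square root is the eigenvalue divided by the root of [c].
    For c = 0 all eigenvalues vanish, in accordance with the convention 0^-1 = 0. *)
Lemma sqrtmx_scaled_idem n (A : 'M[C]_n) (c : C) :
  A ^t* = A -> A *m A = c *: A -> sqrtmx A = (sqrtC c)^-1 *: A.
Proof.
move=> /herm_normal/orthomx_spectralP; rewrite /sqrtmx.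
set Q := spectralmx A; set s := spectral_diag A => AE AA.
have uQ : Q \in unitmx by exact: spectral_unit.
clearbody Q s.
have ss : diag_mx s *m diag_mx s = c *: diag_mx s.
  have -> : diag_mx s = Q *m A *m invmx Q.
    by rewrite AE !mulmxA (mulmxV uQ) mul1mx (mulmxK uQ).
  by rewrite !mulmxA (mulmxKV uQ) -[Q *m A *m A]mulmxA AA -scalemxAr -scalemxAl.
have sE i : s 0 i * s 0 i = c * s 0 i.
  have := congr1 (fun B : 'M[C]_n => B i i) ss.
  by rewrite mulmx_diag !mxE eqxx !mulr1n.
have e : diag_mx (map_mx sqrtC s) = (sqrtC c)^-1 *: diag_mx s; last first.
  by rewrite e AE -scalemxAr -scalemxAl.
apply/matrixP => i j; rewrite !mxE; case: eqP => _; last by rewrite mulr0.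
rewrite !mulr1n; have /eqP := sE i; rewrite -subr_eq0 -mulrBl mulf_eq0.
case/orP => [|/eqP ->]; last by rewrite sqrtC0 mulr0.
rewrite subr_eq0 => /eqP ->.
have [->|c0] := eqVneq c 0; first by rewrite sqrtC0 mulr0.
by rewrite -{3}[c]sqrtCK expr2 mulKf // sqrtC_eq0.
Qed.

Lemma sqrtmx_psd n (A : 'M[C]_n) : A ^t* = A -> psd A ->
  (sqrtmx A) ^t* = sqrtmx A /\ sqrtmx A *m sqrtmx A = A.
Proof.
move=> hA pA; have /orthomx_spectralP := herm_normal hA; rewrite /sqrtmx.
set Q := spectralmx A; set s := spectral_diag A => AE.
have uQ : Q \in unitmx by exact: spectral_unit.
have Qu : Q \is unitarymx by exact: spectral_unitarymx.
clearbody Q s.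
have s0 i : 0 <= s 0 i.
  have := pA (row i Q); congr (0 <= _).
  have -> : row i Q *m A *m (row i Q) ^t* = row i (Q *m A) *m (row i Q) ^t*.
    by rewrite row_mul.
  have -> : Q *m A = diag_mx s *m Q by rewrite AE !mulmxA (mulmxV uQ) mul1mx.
  rewrite row_mul -mulmxA.
  have -> : Q *m (row i Q) ^t* = (row i 1%:M) ^t*.
    apply/matrixP => a b; have := unitarymxP Qu => /matrixP/(_ a i).
    rewrite !mxE => h; rewrite [RHS]rmorph_nat eq_sym -h.
    by apply: eq_bigr => k _; rewrite !mxE.
  rewrite mxE (bigD1 i) //= big1 ?addr0.
    by rewrite !mxE eqxx !mulr1n rmorph1 mulr1.
  by move=> k /negbTE h; rewrite !mxE [i == k]eq_sym h mulr0n mul0r.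
have sq i : (sqrtC (s 0 i))^* = sqrtC (s 0 i).
  by apply/CrealP; apply: ger0_real; rewrite sqrtC_ge0.
pose D := diag_mx (map_mx sqrtC s).
have hD : D ^t* = D.
  apply/matrixP => i j; rewrite !mxE eq_sym; case: eqP => [->|_].
    by rewrite !mulr1n sq.
  by rewrite !mulr0n rmorph0.
have DD : D *m D = diag_mx s.
  rewrite mulmx_diag; congr diag_mx.
  by apply/matrixP => i j; rewrite !mxE !ord1 -expr2 sqrtCK.
rewrite -/D; clearbody D; split.
  by rewrite (invmx_unitary Qu) !adjmxM trmxCK hD mulmxA.
by rewrite AE !mulmxA (mulmxK uQ) -[invmx Q *m D *m D]mulmxA DD.
Qed.

(* The hypotheses on [phi] say that it is a rank-one projector. *)
Lemma fidelity_pure n (phi rho : 'M[C]_n) :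
  phi ^t* = phi -> phi *m phi = phi ->
  (forall X : 'M[C]_n, phi *m X *m phi = \tr (phi *m X) *: phi) ->
  rho ^t* = rho -> psd rho ->
  fidelity phi rho = complex.Re (sqrtC (\tr (phi *m rho))).
Proof.
move=> hphi phi2 phi1 hrho prho.
have [hs s2] := sqrtmx_psd hrho prho.
rewrite /fidelity /trace_norm.
have -> : sqrtmx phi = phi.
  by rewrite (sqrtmx_scaled_idem (c := 1)) ?sqrtC1 ?invr1 ?scale1r.
set f := \tr (phi *m rho); set s := sqrtmx rho in hs s2 *; clearbody s.
(* With phi of rank one, s phi s squares to [f] times itself, so its square root is explicit. *)
have AE : (phi *m s) ^t* *m (phi *m s) = s *m phi *m s.
  by rewrite adjmxM hs hphi -[LHS]mulmxA [phi *m (phi *m s)]mulmxA phi2 mulmxA.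
rewrite AE (sqrtmx_scaled_idem (c := f)).
- rewrite mxtraceZ mxtrace_mulC mulmxA s2 mxtrace_mulC -/f.
  have [->|f0] := eqVneq f 0; first by rewrite mulr0 sqrtC0.
  by rewrite -{2}[f]sqrtCK expr2 mulKf // sqrtC_eq0.
- by rewrite !adjmxM hs hphi mulmxA.
rewrite !mulmxA -[_ *m s *m s]mulmxA s2.
rewrite -[s *m phi *m rho *m phi]mulmxA -[s *m phi *m _]mulmxA.
by rewrite [phi *m (_ *m _)]mulmxA phi1 -/f -scalemxAr -scalemxAl.
Qed.

Section Entangled.
Context (L : finType) (l0 : L).
Local Notation phi := (max_entangled R L).
Local Notation N := (#|L|%:R : C).

Let N0 : N != 0.
Proof. by rewrite pnatr_eq0 -lt0n; apply/card_gt0P; exists l0. Qed.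

Definition ent_vec : 'rV[C]_#|{: L * L}| :=
  \row_j ((enum_val j).1 == (enum_val j).2)%:R.

Lemma ent_vecE : phi = N^-1 *: (ent_vec ^t* *m ent_vec).
Proof.
apply/matrixP => i j; rewrite !mxE big_ord1 !mxE rmorph_nat mulrC.
by rewrite -natrM mulnb.
Qed.

Lemma sum_ent_vec (F : L * L -> C) :
  \sum_(x : L * L) (x.1 == x.2)%:R * F x = \sum_l F (l, l).
Proof.
rewrite (eq_bigr (fun x => (x.1 == x.2)%:R * F (x.1, x.2))); last by case.
rewrite -(pair_bigA _ (fun a b => (a == b)%:R * F (a, b))) /=.
apply: eq_bigr => a _; rewrite (bigD1 a) //= eqxx mul1r big1 ?addr0 // => b.
by rewrite eq_sym => /negbTE ->; rewrite mul0r.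
Qed.

Lemma ent_vec_norm : ent_vec *m ent_vec ^t* = N%:M.
Proof.
apply/matrixP => i j; rewrite !ord1 mxE.
under eq_bigr do rewrite !mxE rmorph_nat.
rewrite sum_enum_rank; under eq_bigr do rewrite enum_rankK.
rewrite (sum_ent_vec (fun x => (x.1 == x.2)%:R)) mxE eqxx.
under eq_bigr do rewrite eqxx.
by rewrite sumr_const mulr1n.
Qed.

Lemma max_entangled_herm : phi ^t* = phi.
Proof.
rewrite ent_vecE linearZ /= map_mxZ fmorphV rmorph_nat.
by rewrite adjmxM trmxCK.
Qed.

Lemma max_entangled_rank1 (X : 'M[C]_#|{: L * L}|) :
  phi *m X *m phi = \tr (phi *m X) *: phi.
Proof.
rewrite ent_vecE -!scalemxAl -!scalemxAr mxtraceZ; set v := ent_vec.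
have tE : \tr (v ^t* *m v *m X) = (v *m X *m v ^t*) 0 0.
  by rewrite -[v ^t* *m v *m X]mulmxA mxtrace_mulC /mxtrace big_ord1.
have -> : v ^t* *m v *m X *m (v ^t* *m v) = v ^t* *m (v *m X *m v ^t*) *m v.
  by rewrite !mulmxA.
rewrite tE [v *m X *m v ^t*]mx11_scalar; set t := (v *m X *m v ^t*) 0 0.
rewrite mul_mx_scalar -scalemxAl mxE eqxx mulr1n !scalerA.
by congr (_ *: _); ring.
Qed.

Lemma max_entangled_idem : phi *m phi = phi.
Proof.
rewrite ent_vecE -!scalemxAl -!scalemxAr !mulmxA -[ent_vec^t* *m _ *m _]mulmxA.
rewrite ent_vec_norm mul_mx_scalar -scalemxAl !scalerA; congr (_ *: _).
by rewrite mulVf // mulr1.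
Qed.

Context (J : finType) (K : J -> 'M[C]_(#|L|, #|L|)).

(** The vectorisation of [K j], that is K_j (x) 1 applied to the unnormalised entangled vector. *)
Let w j : 'cV[C]_#|{: L * L}| :=
  \col_i rentry (K j) (enum_val i).1 (enum_val i).2.

Lemma ampl_max_entangled :
  ampl (kraus_map K) phi = N^-1 *: \sum_j w j *m (w j) ^t*.
Proof.
apply: rentryP => x y; rewrite rentryE /kraus_map.
rewrite -[entry _ _ _]/(rentry _ _ _) rentry_sum.
rewrite /rentry mxE summxE mulr_sumr; apply: eq_bigr => j _.
rewrite [RHS](_ : _ = N^-1 * (rentry (K j) x.1 x.2 * (rentry (K j) y.1 y.2)^*));
  last by rewrite mxE big_ord1 !mxE !enum_rankK.
rewrite -/(rentry _ _ _) rentryM (bigD1 y.2) //= big1 ?addr0; last first.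
  move=> z /negbTE h; rewrite rentryM big1 ?mul0r // => s _.
  rewrite -[rentry (mkop _) _ _]/(entry _ _ _) entryE entryE /= h andbF.
  by rewrite mul0r mulr0.
rewrite rentry_adj rentryM (bigD1 x.2) //= big1 ?addr0; last first.
  move=> z /negbTE h.
  rewrite -[rentry (mkop _) _ _]/(entry _ _ _) entryE entryE /= h.
  by rewrite mul0r mulr0.
rewrite -[rentry (mkop _) _ _]/(entry _ _ _) !entryE /= !eqxx mul1r; ring.
Qed.

Lemma ampl_max_entangled_herm :
  (ampl (kraus_map K) phi) ^t* = ampl (kraus_map K) phi.
Proof.
rewrite ampl_max_entangled linearZ /= map_mxZ fmorphV rmorph_nat.
congr (_ *: _); rewrite linear_sum /= map_mx_sum; apply: eq_bigr => j _.
by rewrite adjmxM trmxCK.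
Qed.

Lemma ampl_max_entangled_psd : psd (ampl (kraus_map K) phi).
Proof.
rewrite ampl_max_entangled => u; rewrite -scalemxAr -scalemxAl mxE.
apply: mulr_ge0; first by rewrite invr_ge0 ler0n.
rewrite mulmx_sumr mulmx_suml summxE; apply: sumr_ge0 => j _.
rewrite mulmxA -[u *m w j *m _ *m _]mulmxA -adjmxM [u *m w j]mx11_scalar.
rewrite mxE big_ord1 adjmxE; exact: mul_conjC_ge0.
Qed.

(** The entanglement fidelity in terms of Kraus operators: the inner product of [ent_vec] with the
    vectorised K_j is tr K_j. *)
Lemma ampl_max_entangled_tr :
  \tr (phi *m ampl (kraus_map K) phi) = N ^- 2 * \sum_j `|\tr (K j)| ^+ 2.
Proof.
rewrite ampl_max_entangled -scalemxAr mxtraceZ mulmx_sumr raddf_sum /=.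
rewrite expr2 invfM -mulrA; congr (_ * _); rewrite mulr_sumr.
apply: eq_bigr => j _; rewrite ent_vecE -scalemxAl mxtraceZ; congr (_ * _).
rewrite -mulmxA mxtrace_mulC !mulmxA -[_ *m (w j) ^t* *m _]mulmxA -adjmxM.
have -> : ent_vec *m w j = (\tr (K j))%:M.
  apply/matrixP => a b; rewrite !ord1 !mxE eqxx mulr1n sum_enum_rank.
  under eq_bigr do rewrite !mxE enum_rankK.
  rewrite (sum_ent_vec (fun x => rentry (K j) x.1 x.2)) /=.
  by rewrite [RHS]tr_rentry.
rewrite /mxtrace big_ord1 mxE big_ord1 adjmxE mxE eqxx mulr1n normCK.
by rewrite -/(\tr (K j)).
Qed.

End Entangled.

End SquareRoots.

Lemma adjmxZ (R : realType) m n (c : R[i]) (A : 'M[R[i]]_(m, n)) :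
  (c *: A) ^t* = c^* *: A ^t*.
Proof. by apply/matrixP => i j; rewrite !mxE rmorphM. Qed.

Lemma adjmxZ_real (R : realType) m n (c : R) (A : 'M[R[i]]_(m, n)) :
  (c%:C *: A) ^t* = c%:C *: A ^t*.
Proof. by rewrite adjmxZ; congr (_ *: _); apply: conjc_real. Qed.

Lemma unitary_conjM (R : realType) m p (Q : 'M[R[i]]_m) (A : 'M[R[i]]_(p, m)) (B : 'M[R[i]]_(m, p)) :
  Q \is unitarymx -> A *m Q ^t* *m (Q *m B) = A *m B.
Proof.
move=> /unitary_adjK QQ.
by rewrite -mulmxA [X in _ *m X]mulmxA QQ mul1mx.
Qed.

Lemma unitary_conj_tr (R : realType) m (Q A : 'M[R[i]]_m) :
  Q \is unitarymx -> \tr (Q *m A *m Q ^t*) = \tr A.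
Proof. by move=> /unitary_adjK QQ; rewrite mxtrace_mulC mulmxA QQ mul1mx. Qed.

Lemma adjmxZ_sq (R : realType) m n (c : R) (A : 'M[R[i]]_(m, n)) : 0 <= c ->
  ((Num.sqrt c)%:C *: A) ^t* *m ((Num.sqrt c)%:C *: A) = c%:C *: (A ^t* *m A).
Proof.
move=> c0; rewrite adjmxZ_real -scalemxAl -scalemxAr scalerA -rmorphM.
by rewrite -expr2 sqr_sqrtr.
Qed.

(** * A recovery map of Petz type and its error *)

Section Decoder.
Context (R : realType) (L S S' J : finType) (l0 : L).
Local Notation C := R[i].
Context (M : J -> 'M[C]_(#|S'|, #|L|)) (lam : J -> R).

(** The squared Hilbert-Schmidt norm of the adjoint of M_b times M_a; perfect correctability makes
    it vanish for distinct a and b. *)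
Definition overlap (a b : J) : R :=
  complex.Re (\tr ((M b) ^t* *m M a *m (M a) ^t* *m M b)).

Hypothesis lam_ge0 : forall j, 0 <= lam j.
Hypothesis lam_sum : \sum_j lam j = 1.
Hypothesis lam0 : forall j, lam j = 0 -> M j = 0.
Hypothesis M_tr : \sum_j \tr ((M j) ^t* *m M j) = #|L|%:R.

Let N : R := #|L|%:R.
Let N0 : 0 < N.
Proof. by rewrite ltr0n; apply/card_gt0P; exists l0. Qed.

(** The quantity J of the overview. A vanishing [lam] has inverse 0 and its operator vanishes by
    [lam0]. *)
Definition overlap_sum : R :=
  N^-1 * \sum_a \sum_b (Num.sqrt (lam a) * Num.sqrt (lam b))^-1 * overlap a b.

Lemma adj_tr_ge0 m p (A : 'M[C]_(m, p)) : 0 <= \tr (A *m A ^t*).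
Proof.
apply: sumr_ge0 => i _; rewrite mxE; apply: sumr_ge0 => j _.
by rewrite adjmxE mul_conjC_ge0.
Qed.

Lemma ReE (z : C) : 0 <= z -> z = (complex.Re z)%:C.
Proof. by move=> /ger0_real/complex_realP[x ->]. Qed.

Lemma Re_ge0 (z : C) : 0 <= z -> 0 <= complex.Re z.
Proof. by move=> z0; rewrite -lecR -ReE. Qed.

Lemma overlapE a b :
  (overlap a b)%:C = \tr ((M b) ^t* *m M a *m (M a) ^t* *m M b).
Proof.
rewrite -ReE // -mulmxA -{2}[M b]trmxCK -{1}adjmxM -{1}[M a]trmxCK.
have := adj_tr_ge0 ((M b) ^t* *m M a); congr (0 <= \tr _).
by rewrite adjmxM trmxCK !mulmxA.
Qed.

Let mu j : R := (Num.sqrt (lam j))^-1.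
Let mu0 j : 0 <= mu j. Proof. by rewrite invr_ge0 sqrtr_ge0. Qed.

Let Gam : 'M[C]_#|S'| := \sum_j (mu j)%:C *: (M j *m (M j) ^t*).

Lemma Gam_herm : Gam ^t* = Gam.
Proof.
rewrite /Gam raddf_sum /= map_mx_sum; apply: eq_bigr => j _.
by rewrite adjmxZ_real adjmxM trmxCK.
Qed.

Lemma Gam_diag : exists2 Q : 'M[C]_#|S'|, Q \is unitarymx &
  exists s, Q *m Gam *m Q ^t* = diag_mx s.
Proof.
have /orthomx_spectralP := herm_normal Gam_herm.
have Qu : spectralmx Gam \is unitarymx by exact: spectral_unitarymx.
move: Qu; set Q := spectralmx Gam; set s := spectral_diag Gam; clearbody Q s.
move=> Qu; rewrite (invmx_unitary Qu) => GE; exists Q => //; exists s.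
have QQ := unitarymxP Qu.
by rewrite {1}GE !mulmxA QQ mul1mx -mulmxA QQ mulmx1.
Qed.

Section Diagonalized.
Context (Q : 'M[C]_#|S'|) (s : 'rV[C]_#|S'|).
Hypothesis Qu : Q \is unitarymx.
Hypothesis Gs : Q *m Gam *m Q ^t* = diag_mx s.

Let nu i j : R := complex.Re ((Q *m M j *m (Q *m M j) ^t*) i i).
Let gam i : R := \sum_j mu j * nu i j.

Let diag_ge0 m p (A : 'M[C]_(m, p)) i : 0 <= (A *m A ^t*) i i.
Proof.
rewrite mxE; apply: sumr_ge0 => j _; rewrite adjmxE; exact: mul_conjC_ge0.
Qed.

Let nuE i j : (nu i j)%:C = (Q *m M j *m (Q *m M j) ^t*) i i.
Proof. by rewrite -ReE ?diag_ge0. Qed.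

Let nu0 i j : 0 <= nu i j. Proof. by rewrite -lecR nuE diag_ge0. Qed.
Let gam0 i : 0 <= gam i.
Proof. by apply: sumr_ge0 => j _; apply: mulr_ge0. Qed.

Let gam_nu i j : gam i = 0 -> lam j != 0 -> nu i j = 0.
Proof.
move=> /eqP; rewrite psumr_eq0; last by move=> ? _; apply: mulr_ge0.
move=> /allP/(_ j (mem_index_enum _)) /=; rewrite mulf_eq0 invr_eq0 => /orP[|/eqP//].
by rewrite sqrtr_eq0 le_eqVlt ltNge lam_ge0 orbF => /eqP->; rewrite eqxx.
Qed.

Lemma Gam_spectral : Q *m Gam *m Q ^t* = diag_mx (\row_i (gam i)%:C).
Proof.
rewrite Gs; congr diag_mx; apply/matrixP => a i; rewrite ord1 [RHS]mxE.
have <- : diag_mx s i i = s 0 i by rewrite mxE eqxx mulr1n.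
rewrite -Gs /Gam mulmx_sumr mulmx_suml summxE rmorph_sum.
apply: eq_bigr => j _; rewrite -scalemxAr -scalemxAl mxE rmorphM /= nuE.
by rewrite adjmxM !mulmxA.
Qed.

(** Gamma^(-1/2) on the support of [Gam]: on the kernel the entry is the inverse of sqrt 0, which is
    0. *)
Let G : 'M[C]_#|S'| :=
  Q ^t* *m diag_mx (\row_i ((Num.sqrt (gam i))^-1)%:C) *m Q.

(* The operators [inr i] only restore trace preservation on the kernel of [Gam]. *)
Let Dec (j : J + 'I_#|S'|) : 'M[C]_(#|L|, #|S'|) :=
  match j with
  | inl b => (Num.sqrt (mu b))%:C *: ((M b) ^t* *m G)
  | inr i => (gam i == 0)%:R *: (delta_mx (enum_rank l0) i *m Q)
  end.

Lemma diag_row_adj m (r : 'I_m -> R) :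
  (diag_mx (\row_i (r i)%:C : 'rV[C]_m)) ^t* = diag_mx (\row_i (r i)%:C).
Proof.
apply/matrixP => i j; rewrite !mxE eq_sym; case: eqP => [->|_].
  by rewrite !mulr1n; apply: conjc_real.
by rewrite !mulr0n rmorph0.
Qed.

Lemma G_herm : G ^t* = G.
Proof. by rewrite /G !adjmxM trmxCK diag_row_adj mulmxA. Qed.

(** The operators [inl b] add up to G Gam G, the projector onto the support of [Gam], and the
    [inr i] to the projector onto its kernel. *)
Lemma Dec_sum : \sum_j (Dec j) ^t* *m Dec j = 1%:M.
Proof.
have QQ := unitary_adjK Qu.
rewrite big_sumType /=.
have -> : \sum_b ((Num.sqrt (mu b))%:C *: ((M b) ^t* *m G)) ^t* *m
    ((Num.sqrt (mu b))%:C *: ((M b) ^t* *m G)) = G *m Gam *m G.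
  rewrite /Gam mulmx_sumr mulmx_suml; apply: eq_bigr => b _.
  rewrite adjmxZ_sq // adjmxM trmxCK G_herm -scalemxAr -scalemxAl.
  by rewrite !mulmxA.
have -> : G *m Gam *m G = Q ^t* *m diag_mx (\row_i (gam i != 0)%:R) *m Q.
  rewrite /G; set d := diag_mx _.
  have -> : Q ^t* *m d *m Q *m Gam *m (Q ^t* *m d *m Q) =
      Q ^t* *m (d *m (Q *m Gam *m Q ^t*) *m d) *m Q by rewrite !mulmxA.
  rewrite Gam_spectral /d !mulmx_diag; set x := diag_mx _; set y := diag_mx _.
  suff -> : x = y by [].
  congr diag_mx; apply/matrixP => a i; rewrite !mxE -!rmorphM /=.
  have [->|g0] := eqVneq (gam i) 0; first by rewrite sqrtr0 invr0 mul0r mulr0.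
  rewrite -{2}[gam i]sqr_sqrtr // expr2 mulKf ?mulfV // sqrtr_eq0 -ltNge;
    by rewrite lt_def g0 gam0.
have -> : \sum_i ((gam i == 0)%:R *: (delta_mx (enum_rank l0) i *m Q)) ^t* *m
    ((gam i == 0)%:R *: (delta_mx (enum_rank l0) i *m Q)) =
    Q ^t* *m diag_mx (\row_i (gam i == 0)%:R) *m Q.
  transitivity (\sum_i (gam i == 0)%:R *: (Q ^t* *m delta_mx i i *m Q)).
    apply: eq_bigr => i _; rewrite adjmxZ rmorph_nat adjmxM.
    rewrite -!scalemxAl -!scalemxAr !scalerA -natrM mulnb andbb; congr (_ *: _).
    rewrite trmx_delta map_delta_mx !mulmxA; congr (_ *m _).
    by rewrite -mulmxA mul_delta_mx.
  rewrite diag_mx_sum_delta mulmx_sumr mulmx_suml; apply: eq_bigr => i _.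
  by rewrite -scalemxAr -scalemxAl mxE.
rewrite -mulmxDl -mulmxDr -raddfD /=.
have -> : \row_i (gam i != 0)%:R + \row_i (gam i == 0)%:R = const_mx 1 :> 'rV[C]_#|S'|.
  by apply/matrixP => a i; rewrite !mxE; case: eqP; rewrite ?addr0 ?add0r.
by rewrite diag_const_mx mulmx1.
Qed.

Let tau b : R := Num.sqrt (mu b) * \sum_i (Num.sqrt (gam i))^-1 * nu i b.

Let tr_diag m (A : 'M[C]_m) (r : 'I_m -> R) :
  \tr (diag_mx (\row_i (r i)%:C) *m A) = \sum_i (r i)%:C * A i i.
Proof.
apply: eq_bigr => i _; rewrite mxE (bigD1 i) //= big1 ?addr0.
  by rewrite !mxE eqxx mulr1n.
by move=> k; rewrite eq_sym => /negbTE h; rewrite !mxE h mulr0n mul0r.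
Qed.

Lemma tr_Dec b : \tr (Dec (inl b) *m M b) = (tau b)%:C.
Proof.
rewrite /= -scalemxAl mxtraceZ /tau rmorphM; congr (_ * _).
rewrite mxtrace_mulC /G !mulmxA mxtrace_mulC !mulmxA mxtrace_mulC.
rewrite tr_diag rmorph_sum; apply: eq_bigr => i _.
by rewrite rmorphM /= nuE adjmxM !mulmxA.
Qed.

Lemma nu_tr b : (\sum_i nu i b)%:C = \tr ((M b) ^t* *m M b).
Proof.
rewrite rmorph_sum; under eq_bigr do rewrite /= nuE.
rewrite -/(\tr _) mxtrace_mulC adjmxM.
by rewrite (unitary_conjM _ _ Qu).
Qed.

(** Both sides are the trace of Gam between M_b and its adjoint, one in the eigenbasis of [Gam], the
    other by the definition of [Gam]. *)
Lemma gam_tr b : \sum_i gam i * nu i b = \sum_a mu a * overlap a b.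
Proof.
suff : (\sum_i gam i * nu i b)%:C = (\sum_a mu a * overlap a b)%:C by case.
rewrite !rmorph_sum /=.
transitivity (\tr ((M b) ^t* *m Gam *m M b)); last first.
  rewrite /Gam mulmx_sumr mulmx_suml raddf_sum /=; apply: eq_bigr => a _.
  by rewrite -scalemxAr -scalemxAl mxtraceZ rmorphM /= overlapE !mulmxA.
under eq_bigr do rewrite rmorphM /= nuE.
rewrite -tr_diag -Gam_spectral.
have -> : Q *m M b *m (Q *m M b) ^t* = Q *m (M b *m (M b) ^t* *m Q ^t*).
  by rewrite adjmxM !mulmxA.
rewrite (unitary_conjM _ _ Qu).
have -> : Q *m Gam *m (M b *m (M b) ^t* *m Q ^t*) =
    Q *m (Gam *m M b *m (M b) ^t*) *m Q ^t* by rewrite !mulmxA.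
by rewrite (unitary_conj_tr _ Qu) mxtrace_mulC mulmxA.
Qed.

(** The tangent line at u = 1 of the convex function 2 u^(-1/2), with u = (y / x)^2. It replaces
    inverse roots of eigenvalues by expressions linear in them. *)
Lemma cubic_tangent (x y : R) : 0 < x -> 0 < y ->
  (3 - y ^+ 2 / x ^+ 2) <= 2 * (x / y).
Proof.
move=> x0 y0; rewrite -subr_ge0.
have -> : 2 * (x / y) - (3 - y ^+ 2 / x ^+ 2) =
   (y - x) ^+ 2 * (y + 2 * x) / (y * x ^+ 2).
  by field; rewrite !lt0r_neq0.
rewrite divr_ge0 // mulr_ge0 ?sqr_ge0 ?exprn_ge0 ?(ltW x0) ?(ltW y0) //.
by rewrite addr_ge0 ?mulr_ge0 ?ltW.
Qed.

(** [cubic_tangent] on every eigenvector, with u = gam_i lam_b^(-1/2). For a perfectly correctable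
    noise [Gam] acts on the range of M_b as the root of lam_b; then u = 1 and nothing is lost. *)
Lemma tau_ge b : 3 * (\sum_i nu i b) - mu b * (\sum_a mu a * overlap a b) <=
  2 * (Num.sqrt (lam b) * tau b).
Proof.
rewrite -gam_tr /tau !mulr_sumr -sumrB; apply: ler_sum => i _.
have [l0' | lb] := eqVneq (lam b) 0.
  have -> : nu i b = 0 by rewrite /nu lam0 // mulmx0 mul0mx mxE.
  by rewrite !mulr0 subr0.
have [g0|g0] := eqVneq (gam i) 0.
  by rewrite (gam_nu g0 lb) !mulr0 subr0.
have gp : 0 < gam i by rewrite lt_def g0 gam0.
have lp : 0 < lam b by rewrite lt_def lb lam_ge0.
pose y := Num.sqrt (gam i); pose r := Num.sqrt (lam b); pose x := Num.sqrt r.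
have y0 : 0 < y by rewrite sqrtr_gt0.
have r0 : 0 < r by rewrite sqrtr_gt0.
have x0 : 0 < x by rewrite sqrtr_gt0.
have yE : gam i = y ^+ 2 by rewrite sqr_sqrtr.
have rE : r = x ^+ 2 by rewrite sqr_sqrtr // ltW.
have muE : mu b = x ^- 2 by rewrite -rE.
have smuE : Num.sqrt (mu b) = x^-1.
  by rewrite muE -exprVn sqrtr_sqr ger0_norm // invr_ge0 ltW.
rewrite -/y -/r smuE muE rE yE.
have := ler_wpM2r (nu0 i b) (cubic_tangent x0 y0).
congr (_ <= _); first by field; rewrite lt0r_neq0.
by field; rewrite !lt0r_neq0.
Qed.

Lemma sum_tau_ge : N * (3 - overlap_sum) <= 2 * \sum_b Num.sqrt (lam b) * tau b.
Proof.
rewrite mulr_sumr; apply: le_trans (ler_sum _ (fun b _ => tau_ge b)).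
rewrite sumrB -mulr_sumr.
have -> : \sum_b \sum_i nu i b = N.
  have : (\sum_b \sum_i nu i b)%:C = N%:C.
    rewrite rmorph_sum; under eq_bigr do rewrite /= nu_tr.
    by rewrite M_tr rmorph_nat.
  by case.
rewrite mulrBr [N * 3]mulrC lerD2l lerN2 /overlap_sum mulrA divff ?lt0r_neq0 //.
rewrite mul1r exchange_big /=; apply: ler_sum => b _.
rewrite mulr_sumr; apply: ler_sum => a _.
by rewrite /mu invfM mulrA [X in X * _]mulrC.
Qed.

(** The diagonal terms suffice. With X the adjoint of M_a times M_a, the nonnegative trace of (X -
    lam_a)^2 bounds tr X^2 / lam_a below by 2 tr X - lam_a N, and these bounds add up to N. *)
Lemma overlap_sum_ge1 : 1 <= overlap_sum.
Proof.
have ov0 a b : 0 <= (Num.sqrt (lam a) * Num.sqrt (lam b))^-1 * overlap a b.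
  apply: mulr_ge0; first by rewrite invr_ge0 mulr_ge0 ?sqrtr_ge0.
  rewrite -lecR overlapE -mulmxA -{2}[M b]trmxCK -{1}adjmxM -{1}[M a]trmxCK.
  have := adj_tr_ge0 ((M b) ^t* *m M a); congr (0 <= \tr _).
  by rewrite adjmxM trmxCK !mulmxA.
rewrite /overlap_sum ler_pdivlMl // mulr1.
apply: (@le_trans _ _ (\sum_a
    (Num.sqrt (lam a) * Num.sqrt (lam a))^-1 * overlap a a)); last first.
  apply: ler_sum => a _; rewrite (bigD1 a) //= lerDl; exact: sumr_ge0.
pose t a := complex.Re (\tr ((M a) ^t* *m M a)).
have tE a : (t a)%:C = \tr ((M a) ^t* *m M a).
  rewrite -ReE // -{2}[M a]trmxCK; exact: adj_tr_ge0.
have tN : \sum_a t a = N.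
  have : (\sum_a t a)%:C = N%:C.
    rewrite rmorph_sum; under eq_bigr do rewrite /= tE.
    by rewrite M_tr rmorph_nat.
  by case.
have -> : N = \sum_a (2 * t a - lam a * N).
  by rewrite sumrB -mulr_sumr -mulr_suml tN lam_sum; ring.
apply: ler_sum => a _; rewrite -expr2 sqr_sqrtr //.
have [l00|l1] := eqVneq (lam a) 0.
  by rewrite /t lam0 // mulmx0 mxtrace0 l00 mulr0 mul0r subr0 invr0 mul0r.
have lp : 0 < lam a by rewrite lt_def l1 lam_ge0.
rewrite ler_pdivlMl // -subr_ge0.
set X := (M a) ^t* *m M a.
have hX : X ^t* = X by rewrite /X adjmxM trmxCK.
have := adj_tr_ge0 (X - (lam a)%:C%:M).
have hZ : (X - (lam a)%:C%:M) ^t* = X - (lam a)%:C%:M.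
  rewrite linearB /= map_mxB hX; congr (_ - _).
  apply/matrixP => i j; rewrite !mxE eq_sym; case: eqP => _.
    by rewrite !mulr1n; apply: conjc_real.
  by rewrite !mulr0n raddf0.
rewrite hZ mulmxBl !mulmxBr mul_mx_scalar !mul_scalar_mx scale_scalar_mx.
rewrite !raddfB /= !mxtraceZ mxtrace_scalar -/X -tE.
have -> : \tr (X *m X) = (overlap a a)%:C by rewrite overlapE /X !mulmxA.
rewrite -lecR; congr (_ <= _).
rewrite rmorphB !rmorphM rmorphB !rmorphM /= rmorph_nat /N rmorph_nat -mulr_natr.
by ring.
Qed.

(** Keep in the entanglement fidelity F of [Dec] only the terms where the decoder operator of [b]
    meets M_b. Cauchy-Schwarz and [sum_tau_ge] give F >= ((3 - J) / 2)^2 for J < 2, hence 1 - F <= J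
    - 1. This bounds the square of the error and, the error being at most 1, its fourth power; for J
    >= 2 the bound is trivial. *)
Lemma choi_error_le_diag (Nz : qop R S -> qop R S') (E : qop R L -> qop R S) :
  (forall X, Nz (E X) = kraus_map M X) ->
  [/\ 0 <= choi_error Nz E, choi_error Nz E <= 1 &
      choi_error Nz E ^+ 4 <= overlap_sum - 1].
Proof.
move=> NE; rewrite /choi_error; set A := (X in inf X).
pose P := purified_distance (max_entangled R L)
   (ampl (fun rho => kraus_map Dec (Nz (E rho))) (max_entangled R L)).
have AP : A P.
  exists (kraus_map Dec) => //; split; first exact: kraus_cp.
  apply: kraus_tp; exact: Dec_sum.
have A0 x : A x -> 0 <= x by move=> [D _ ->]; exact: sqrtr_ge0.
have lbA : has_lbound A by exists 0 => x /A0.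
have c0 : 0 <= inf A by apply: lb_le_inf => [|x /A0//]; exists P.
have cP : inf A <= P by exact: ge_inf.
have P0 : 0 <= P by exact: sqrtr_ge0.
pose K (ji : (J + 'I_#|S'|) * J) := Dec ji.1 *m M ji.2.
pose F := complex.Re (\tr (max_entangled R L *m
   ampl (kraus_map K) (max_entangled R L))).
have FE : F = N ^- 2 * \sum_ji complex.Re (`|\tr (K ji)| ^+ 2).
  rewrite /F ampl_max_entangled_tr.
  have -> : (#|L|%:R ^- 2 : C) = (N ^- 2)%:C.
    by rewrite fmorphV rmorphXn /= rmorph_nat.
  rewrite -raddf_sum; case: (\sum_ji _) => u v /=; rewrite mul0r subr0 //.
have F0 : 0 <= F.
  rewrite FE; apply: mulr_ge0; first by rewrite invr_ge0 exprn_ge0 // ltW.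
  by apply: sumr_ge0 => ji _; apply: Re_ge0; rewrite exprn_ge0.
have PE : P = Num.sqrt (1 - F).
  rewrite /P /purified_distance.
  have -> : (fun rho => kraus_map Dec (Nz (E rho))) = kraus_map K.
    by apply/funext => rho; rewrite NE kraus_map_comp.
  rewrite fidelity_pure.
  - congr (Num.sqrt (1 - _)).
    set z := \tr _.
    have z0 : 0 <= z.
      rewrite /z ampl_max_entangled_tr mulr_ge0 ?invr_ge0 ?exprn_ge0 ?ler0n //.
      by apply: sumr_ge0 => ji _; rewrite exprn_ge0.
    have s0 : 0 <= sqrtC z by rewrite sqrtC_ge0.
    have : (complex.Re (sqrtC z) ^+ 2)%:C = F%:C.
      by rewrite rmorphXn /= -ReE // sqrtCK /F -ReE.
    by case.
  - exact: max_entangled_herm.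
  - exact: (max_entangled_idem R l0).
  - by move=> X; apply: max_entangled_rank1.
  - exact: ampl_max_entangled_herm.
  - exact: ampl_max_entangled_psd.
have P1 : P <= 1.
  by rewrite PE -[leRHS]sqrtr1 ler_wsqrtr // lerBlDr lerDl.
have J1 := overlap_sum_ge1; set Q1 := overlap_sum in J1 *.
split=> //; first exact: le_trans cP P1.
apply: (@le_trans _ _ (P ^+ 4)); first by rewrite lerXn2r // ?nnegrE.
have [Q2|Q2] := leP 1 (Q1 - 1).
  by apply: le_trans Q2; rewrite exprn_ile1.
apply: (@le_trans _ _ (P ^+ 2)).
  by rewrite -[leRHS]mul1r (exprD P 2 2) ler_wpM2r ?exprn_ge0 // exprn_ile1.
pose sm := \sum_b Num.sqrt (lam b) * tau b.
have sF : sm ^+ 2 <= N ^+ 2 * F.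
  apply: (@le_trans _ _ (\sum_b tau b ^+ 2)).
    (* Cauchy-Schwarz of [tau] against the unit vector with entries the roots of lam_b. *)
    have : 0 <= \sum_b (tau b - sm * Num.sqrt (lam b)) ^+ 2.
      by apply: sumr_ge0 => b _; exact: sqr_ge0.
    have -> : \sum_b (tau b - sm * Num.sqrt (lam b)) ^+ 2 =
       \sum_b (tau b ^+ 2 - 2 * sm * (Num.sqrt (lam b) * tau b) + sm ^+ 2 * lam b).
      apply: eq_bigr => b _; rewrite -[X in _ = _ + _ * X](sqr_sqrtr (lam_ge0 b)); ring.
    rewrite big_split /= sumrB -!mulr_sumr lam_sum -/sm; lra.
  rewrite FE mulrA divff ?mul1r ?expf_neq0 ?lt0r_neq0 //.
  pose f (z : C) : R := complex.Re (`|z| ^+ 2).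
  have f0 z : 0 <= f z by apply: Re_ge0; rewrite exprn_ge0.
  have fR (x : R) : f x%:C = x ^+ 2.
    by rewrite /f -add_Re2_Im2 /= expr0n addr0.
  rewrite [leRHS](_ : _ = \sum_j \sum_i f (\tr (Dec j *m M i))); last first.
    by rewrite (pair_bigA _ (fun j i => f (\tr (Dec j *m M i)))).
  clearbody f; rewrite big_sumType -[leLHS]addr0; apply: lerD; last first.
    by apply: sumr_ge0 => i _; apply: sumr_ge0.
  apply: ler_sum => b _; rewrite (bigD1 b) // -[leLHS]addr0; apply: lerD.
    by rewrite tr_Dec fR.
  exact: sumr_ge0.
rewrite PE; case: (leP 0 (1 - F)) => h1F; last first.
  by rewrite ltr0_sqrtr // expr0n /= subr_ge0.
rewrite sqr_sqrtr //.
have := sum_tau_ge; rewrite -/sm -/Q1 => sg.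
have s0 : 0 <= N * (3 - Q1) by rewrite mulr_ge0 ?ltW //; lra.
have : (N * (3 - Q1)) ^+ 2 <= (2 * sm) ^+ 2.
  by rewrite lerXn2r // ?nnegrE // (le_trans s0).
rewrite !exprMn => h.
have h2 : N ^+ 2 * (3 - Q1) ^+ 2 <= N ^+ 2 * (4 * F).
  apply: (le_trans h); rewrite [N ^+ 2 * _]mulrCA -(natrX _ 2 2); exact: ler_wpM2l.
move: h2; rewrite ler_pM2l ?exprn_gt0 // => h2.
nra.
Qed.

End Diagonalized.

Lemma choi_error_le_overlap (Nz : qop R S -> qop R S') (E : qop R L -> qop R S) :
  (forall X, Nz (E X) = kraus_map M X) ->
  [/\ 0 <= choi_error Nz E, choi_error Nz E <= 1 &
      choi_error Nz E ^+ 4 <= overlap_sum - 1].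
Proof.
by move=> NE; have [Q Qu [s Gs]] := Gam_diag; apply: (choi_error_le_diag Qu Gs).
Qed.

End Decoder.

(** * The averaged circuit *)

Section Pairing.
Context (k : nat).
Hypothesis k_even : ~~ odd k.

Definition gate_site (l : nat) (p : 'I_(k./2) * bool) : 'I_k :=
  if p.2 then gate_snd l p.1 else gate_fst l p.1.

Lemma gate_siteE l p : gate_site l p = ((p.1.*2 + p.2 + odd l) %% k)%N :> nat.
Proof.
case: p => i [] /=; rewrite /gate_site /= ?addn0 //.
by rewrite addn1 addSn.
Qed.

Lemma gate_site_bij l : bijective (gate_site l).
Proof.
apply: inj_card_bij; last first.
  rewrite card_prod card_bool !card_ord muln2.
  by rewrite -[X in (X <= _)%N]odd_double_half (negPf k_even).
move=> [i c] [j c'] /(congr1 val) /=; rewrite !gate_siteE /= => /eqP.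
have small (a : 'I_(k./2)) (b : bool) : (a.*2 + b < k)%N.
  have := ltn_ord a; have := odd_double_half k; rewrite (negPf k_even).
  case: b; lia.
rewrite eqn_modDr !modn_small ?small // => /eqP e.
have ec : c = c' by have := congr1 odd e; rewrite !oddD !odd_double !oddb.
by congr pair => //; apply: val_inj => /=; move: e; rewrite ec; lia.
Qed.

Lemma prod_gates (R : comPzSemiRingType) l (F : 'I_k -> R) :
  \prod_j F j = \prod_i (F (gate_fst l i) * F (gate_snd l i)).
Proof.
have [h hK Kh] := gate_site_bij l.
rewrite (reindex (gate_site l)) /=; last by exists h => x _.
rewrite (eq_bigr (fun p => F (gate_site l (p.1, p.2)))); last by case.
rewrite -(pair_bigA _ (fun i c => F (gate_site l (i, c)))) /=.
by apply: eq_bigr => i _; rewrite big_bool /= mulrC.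
Qed.

Lemma sum_gates (R : comPzSemiRingType) (T : finType) l
    (F : 'I_(k./2) -> T -> T -> R) :
  \sum_(e : {ffun 'I_k -> T}) \prod_i F i (e (gate_fst l i)) (e (gate_snd l i)) =
  \prod_i \sum_a \sum_b F i a b.
Proof.
have [h hK Kh] := gate_site_bij l.
under [RHS]eq_bigr do rewrite pair_bigA.
rewrite bigA_distr_bigA /=.
pose f (e : {ffun 'I_k -> T}) : {ffun 'I_(k./2) -> T * T} :=
  [ffun i => (e (gate_fst l i), e (gate_snd l i))].
pose g (e : {ffun 'I_(k./2) -> T * T}) : {ffun 'I_k -> T} :=
  [ffun j => let p := h j in if p.2 then (e p.1).2 else (e p.1).1].
have ff i : h (gate_fst l i) = (i, false) by apply: (canLR hK).
have fs i : h (gate_snd l i) = (i, true) by apply: (canLR hK).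
rewrite (reindex f) /=.
  by apply: eq_bigr => e _; apply: eq_bigr => i _; rewrite ffunE.
exists g => e _; apply/ffunP => i; rewrite !ffunE.
  rewrite -[in RHS](Kh i) /gate_site; case: (h i) => a [] /=; by rewrite ffunE.
by rewrite ff fs /=; case: (e i).
Qed.

(** The gate of layer [l] that holds the first qudit of gate [i] of layer [l.+1]; its successor
    holds the second. It plays the role of [L] in the domain wall argument. *)
Definition gate_left (l : nat) (i : 'I_(k./2)) : 'I_(k./2) :=
  if odd l then ord_pred i else i.
Definition gate_left_inv (l : nat) (i : 'I_(k./2)) : 'I_(k./2) :=
  if odd l then ordS i else i.

Lemma gate_leftK l : cancel (gate_left l) (gate_left_inv l).
Proof.
by move=> i; rewrite /gate_left /gate_left_inv; case: odd => //; rewrite ord_predK.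
Qed.
Lemma gate_left_invK l : cancel (gate_left_inv l) (gate_left l).
Proof.
by move=> i; rewrite /gate_left /gate_left_inv; case: odd => //; rewrite ordSK.
Qed.
Lemma gate_leftS l i : gate_left l (ordS i) = ordS (gate_left l i).
Proof. by rewrite /gate_left; case: odd => //; rewrite ordSK ord_predK. Qed.

Lemma gate_fst_next l i : gate_fst l.+1 i = gate_snd l (gate_left l i).
Proof.
apply: val_inj => /=; rewrite /gate_left; case: (odd l) => /=; last first.
  by rewrite addn0 addn1.
have := ltn_ord i; have := odd_double_half k; rewrite (negPf k_even) add0n => kE.
move: i kE; case: (k./2) => [[]//|n] i kE ih.
have [i0|i0] := posnP (i : nat).
  rewrite i0; have -> : ((0 + n.+1).-1 %% n.+1 = n)%N by rewrite modn_small.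
  by rewrite addn1 -doubleS kE modnn mod0n.
rewrite addn0 /=; congr (_ %% _)%N.
have -> : ((i + n.+1).-1 %% n.+1 = i.-1)%N.
  have -> : ((i + n.+1).-1 = i.-1 + n.+1)%N by lia.
  by rewrite modnDr modn_small //; lia.
lia.
Qed.

Lemma gate_snd_next l i : gate_snd l.+1 i = gate_fst l (ordS (gate_left l i)).
Proof.
apply: val_inj => /=; rewrite /gate_left.
case: (odd l) => /=.
  have -> : (((i + k./2).-1 %% k./2).+1 %% k./2 = i)%N.
    by have := congr1 val (ord_predK i).
  by rewrite addn0 addn1.
have := ltn_ord i; have := odd_double_half k; rewrite (negPf k_even) add0n => kE ih.
have [e|ne] := eqVneq i.+1 k./2.
  by rewrite e modnn addn0 mod0n addn1 -doubleS e kE modnn.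
rewrite [(i.+1 %% _)%N]modn_small; last by lia.
by congr (_ %% _)%N; lia.
Qed.

Lemma gate_string_next (R : comPzSemiRingType) (T : Type) (F : bool -> T -> R) l
    (b : 'I_(k./2) -> bool) (e : 'I_k -> T) :
  \prod_i (F (b i) (e (gate_fst l i)) * F (b i) (e (gate_snd l i))) =
  \prod_i (F (b (gate_left l i)) (e (gate_fst l.+1 i)) *
           F (b (ordS (gate_left l i))) (e (gate_snd l.+1 i))).
Proof.
rewrite !big_split /= mulrC; congr (_ * _).
  rewrite (reindex_inj (can_inj (gate_leftK l))) /=.
  by apply: eq_bigr => i _; rewrite gate_fst_next.
rewrite (reindex_inj (h := fun i => ordS (gate_left l i))) /=; last first.
  move=> i j /(can_inj (@ordSK _)); exact: (can_inj (gate_leftK l)).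
by apply: eq_bigr => i _; rewrite gate_snd_next.
Qed.

End Pairing.

Section GateMoments.
Context (R : realType) (Q : finType).
Local Notation C := R[i].
Local Notation N := (#|{: Q * Q}|).

(* An entry of a doubled operator [A (x) B] at rows (x, x') and columns (y, y')
   is indexed by ((x, x'), (y, y')). *)
Definition quad := ((Q * Q) * (Q * Q))%type.

(** An entry of U (x) U (x) conj U (x) conj U; [a], [a'] label the four copies of the first qudit
    and [b], [b'] those of the second. *)
Definition gate_mono (a b a' b' : quad) (U : 'M[C]_N) : C :=
  rentry U (a.1.1, b.1.1) (a'.1.1, b'.1.1) *
  rentry U (a.1.2, b.1.2) (a'.1.2, b'.1.2) *
  ((rentry U (a.2.1, b.2.1) (a'.2.1, b'.2.1))^* *
   (rentry U (a.2.2, b.2.2) (a'.2.2, b'.2.2))^*).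

Definition ugate_mono a b a' b' (U : 'M[C]_N) : C := uind U * gate_mono a b a' b' U.

Lemma bmeas_ugate_mono a b a' b' :
  bmeas (ugate_mono a b a' b' : borel_mx R N -> C).
Proof.
pose v x y (U : 'M[C]_N) : C := uind U * U (enum_rank x) (enum_rank y).
have -> : ugate_mono a b a' b' = (fun U =>
  v (a.1.1, b.1.1) (a'.1.1, b'.1.1) U * v (a.1.2, b.1.2) (a'.1.2, b'.1.2) U *
  ((v (a.2.1, b.2.1) (a'.2.1, b'.2.1) U)^* *
   (v (a.2.2, b.2.2) (a'.2.2, b'.2.2) U)^*)).
  apply/funext => U; rewrite /ugate_mono /gate_mono /v /rentry /uind.
  by case: (U \is _); rewrite ?mul1r // !mul0r.
apply: bmeasM; apply: bmeasM; try exact: bmeas_uentry;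
  apply: bmeas_conj; exact: bmeas_uentry.
Qed.

(** The trace of a doubled operator on one qudit, and in [quad_trF] its trace against the swap. *)
Definition quad_tr (h : quad -> C) : C := \sum_z \sum_z' h ((z, z'), (z, z')).
Definition quad_trF (h : quad -> C) : C := \sum_z \sum_z' h ((z, z'), (z', z)).

(* [true] stands for the identity and [false] for the swap of the two copies. *)
Definition string_op (t : bool) (a : quad) : C :=
  if t then ((a.1.1 == a.2.1) && (a.1.2 == a.2.2))%:R
  else ((a.1.1 == a.2.2) && (a.1.2 == a.2.1))%:R.

(** The Weingarten coefficients of h (x) h', whose two traces are products over the qudits. *)
Definition gate_coef (h h' : quad -> C) (t : bool) : C :=
  let n : C := N%:R in
  let u := quad_tr h * quad_tr h' in
  let v := quad_trF h * quad_trF h' in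
  (if t then n * u - v else n * v - u) / (n * (n ^+ 2 - 1)).

Lemma sum_pair_quad (F : quad -> quad -> C) :
  \sum_a \sum_b F a b = \sum_(x : Q * Q) \sum_(x' : Q * Q) \sum_(y : Q * Q)
   \sum_(y' : Q * Q) F ((x.1, x'.1), (y.1, y'.1)) ((x.2, x'.2), (y.2, y'.2)).
Proof.
have S4 (G : (Q * Q) * (Q * Q) * ((Q * Q) * (Q * Q)) -> C) :
    \sum_(x : Q * Q) \sum_(x' : Q * Q) \sum_(y : Q * Q) \sum_(y' : Q * Q)
      G ((x, x'), (y, y')) = \sum_p G p.
  under eq_bigr => x _ do under eq_bigr => x' _ do
    rewrite (pair_bigA _ (fun y y' => G ((x, x'), (y, y')))) /=.
  rewrite (pair_bigA _ (fun x x' => \sum_p G ((x, x'), (p.1, p.2)))) /=.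
  rewrite (pair_bigA _ (fun p q => G ((p.1, p.2), (q.1, q.2)))) /=.
  by apply: eq_bigr => -[[? ?] [? ?]].
rewrite (S4 (fun p => F ((p.1.1.1, p.1.2.1), (p.2.1.1, p.2.2.1))
                       ((p.1.1.2, p.1.2.2), (p.2.1.2, p.2.2.2)))).
rewrite pair_bigA /=.
pose f (p : quad * quad) : (Q * Q) * (Q * Q) * ((Q * Q) * (Q * Q)) :=
  (((p.1.1.1, p.2.1.1), (p.1.1.2, p.2.1.2)), ((p.1.2.1, p.2.2.1), (p.1.2.2, p.2.2.2))).
rewrite [RHS](reindex f) /=; first by apply: eq_bigr => -[[[? ?] [? ?]] [[? ?] [? ?]]].
exists (fun p => (((p.1.1.1, p.1.2.1), (p.2.1.1, p.2.2.1)),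
                  ((p.1.1.2, p.1.2.2), (p.2.1.2, p.2.2.2)))).
  by move=> [[[? ?] [? ?]] [[? ?] [? ?]]].
by move=> [[[? ?] [? ?]] [[? ?] [? ?]]].
Qed.

Lemma mean_gate (mu : probability (borel_mx R N) R) (h h' : quad -> C) a b :
  second_moment mu ->
  \sum_a' \sum_b' cmean mu (ugate_mono a b a' b') * (h a' * h' b') =
  \sum_t gate_coef h h' t * (string_op t a * string_op t b).
Proof.
move=> mu2.
pose A : 'M[C]_(N * N) := \matrix_(i, j)
  let x := enum_val (mxtens_unindex i).1 in
  let x' := enum_val (mxtens_unindex i).2 in
  let y := enum_val (mxtens_unindex j).1 in
  let y' := enum_val (mxtens_unindex j).2 in
  h ((x.1, x'.1), (y.1, y'.1)) * h' ((x.2, x'.2), (y.2, y'.2)).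
pose E x : 'I_N := enum_rank x.
have AE x x' y y' : tens_entry A (E x) (E x') (E y) (E y') =
    h ((x.1, x'.1), (y.1, y'.1)) * h' ((x.2, x'.2), (y.2, y'.2)).
  by rewrite /tens_entry mxE !mxtens_indexK /= !enum_rankK.
have sumE (F : 'I_N -> C) : \sum_i F i = \sum_x F (E x) by exact: sum_enum_rank.
have := mu2 A (E (a.1.1, b.1.1)) (E (a.1.2, b.1.2)) (E (a.2.1, b.2.1))
  (E (a.2.2, b.2.2)).
have -> : (fun U : 'M[C]_N => uind U * tens_entry (twirl2 A U)
    (E (a.1.1, b.1.1)) (E (a.1.2, b.1.2)) (E (a.2.1, b.2.1)) (E (a.2.2, b.2.2))) =
  (fun U => \sum_a' \sum_b' (h a' * h' b') * ugate_mono a b a' b' U).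
  apply/funext => U; rewrite twirl2E.
  rewrite (sum_pair_quad (fun a' b' => h a' * h' b' * ugate_mono a b a' b' U)).
  rewrite sumE mulr_sumr; apply: eq_bigr => x _.
  rewrite sumE mulr_sumr; apply: eq_bigr => x' _.
  rewrite sumE mulr_sumr; apply: eq_bigr => y _.
  rewrite sumE mulr_sumr; apply: eq_bigr => y' _.
  rewrite AE mulrCA; congr (_ * _).
  by case: x; case: x'; case: y; case: y' => *.
rewrite cmean_sum; last first.
  by move=> a'; apply: bmeas_sum => b'; apply: bmeasZ; apply: bmeas_ugate_mono.
move=> e; transitivity (\sum_a' cmean mu (fun U => \sum_b' h a' * h' b' *
    ugate_mono a b a' b' U)).
  apply: eq_bigr => a' _; rewrite cmean_sum; last first.
    by move=> b'; apply: bmeasZ; apply: bmeas_ugate_mono.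
  apply: eq_bigr => b' _; rewrite cmeanZ; last exact: bmeas_ugate_mono.
  by rewrite mulrC.
rewrite e /haar_twirl.
have tr1 : tens_tr A = quad_tr h * quad_tr h'.
  rewrite /tens_tr sumE; under eq_bigr do rewrite sumE.
  under eq_bigr do under eq_bigr do rewrite AE.
  rewrite /quad_tr mulr_suml -(pair_bigA _ (fun p q => \sum_(x' : Q * Q)
    h ((p, x'.1), (p, x'.1)) * h' ((q, x'.2), (q, x'.2)))) /=.
  apply: eq_bigr => z _; under eq_bigr do
    rewrite -(pair_bigA _ (fun p q => h ((z, p), (z, p)) * h' ((_, q), (_, q)))) /=.
  rewrite exchange_big mulr_suml /=; apply: eq_bigr => z' _.
  by rewrite mulr_sumr; apply: eq_bigr => w _; rewrite mulr_sumr.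
have tr2 : tens_trF A = quad_trF h * quad_trF h'.
  rewrite /tens_trF sumE; under eq_bigr do rewrite sumE.
  under eq_bigr do under eq_bigr do rewrite AE.
  rewrite /quad_trF mulr_suml -(pair_bigA _ (fun p q => \sum_(x' : Q * Q)
    h ((p, x'.1), (x'.1, p)) * h' ((q, x'.2), (x'.2, q)))) /=.
  apply: eq_bigr => z _; under eq_bigr do
    rewrite -(pair_bigA _ (fun p q => h ((z, p), (p, z)) * h' ((_, q), (q, _)))) /=.
  rewrite exchange_big mulr_suml /=; apply: eq_bigr => z' _.
  by rewrite mulr_sumr; apply: eq_bigr => w _; rewrite mulr_sumr.
rewrite big_bool /= tr1 tr2 /gate_coef /=.
rewrite !(inj_eq enum_rank_inj) !xpair_eqE -!natrM !mulnb.
congr (_ * _%:R + _ * _%:R); congr nat_of_bool.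
  by rewrite andbACA.
by rewrite andbACA.
Qed.

End GateMoments.

Section Network.
Context (R : realType) (Q : finType) (k : nat).
Local Notation C := R[i].
Local Notation N := (#|{: Q * Q}|).
Local Notation config := {ffun 'I_k -> quad Q}.
Hypothesis k_even : ~~ odd k.

Definition layer_mono (l : nat) (e e' : config) (i : 'I_(k./2)) : 'M[C]_N -> C :=
  ugate_mono (e (gate_fst l i)) (e (gate_snd l i))
             (e' (gate_fst l i)) (e' (gate_snd l i)).

Lemma bmeas_layer_mono l e e' i : bmeas (layer_mono l e e' i : borel_mx R N -> C).
Proof. exact: bmeas_ugate_mono. Qed.

(** The doubled operator P (x) P after [j] layers, as a function of four basis labels per qudit (see
    [network_circuit]). Each layer is linear in the previous value, which allows the gates to be
    averaged layer by layer. *)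
Fixpoint network (G : nat -> 'I_(k./2) -> 'M[C]_N) (v0 : config -> C) (j : nat)
    (e : config) : C :=
  if j is l.+1 then
    \sum_e' (\prod_i layer_mono l e e' i (G l i)) * network G v0 l e'
  else v0 e.

Fixpoint mean_network (mu : probability (borel_mx R N) R) (v0 : config -> C)
    (j : nat) (e : config) : C :=
  if j is l.+1 then
    \sum_e' (\prod_i cmean mu (layer_mono l e e' i)) * mean_network mu v0 l e'
  else v0 e.

Lemma mean_networkS mu v0 l e : mean_network mu v0 l.+1 e =
  \sum_e' (\prod_i cmean mu (layer_mono l e e' i)) * mean_network mu v0 l e'.
Proof. by []. Qed.

Section Random.
Context (d : nat) (disp : measure_display) (Omega : measurableType disp).
Context (P : probability Omega R).
Context (g : 'I_d -> 'I_(k./2) -> {RV P >-> borel_mx R N}).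
Context (mu : probability (borel_mx R N) R).
Hypothesis indep : mutually_independent (fun li : 'I_d * 'I_(k./2) => g li.1 li.2).
Hypothesis law : forall l i (B : set (borel_mx R N)), measurable B ->
  distribution P (g l i) B = mu B.

(** Layers are indexed by all naturals to fit the recursion of [network]; those beyond the depth are
    padded with the identity. *)
Definition gates_at (w : Omega) (l : nat) (i : 'I_(k./2)) : 'M[C]_N :=
  if insub l is Some l' then g l' i w else 1%:M.

Lemma gates_atE w (l : 'I_d) i : gates_at w l i = g l i w.
Proof. by rewrite /gates_at (valK l). Qed.

Lemma bmeas_network v0 j e : (j <= d)%N ->
  bmeas (fun w => network (gates_at w) v0 j e).
Proof.
elim: j e => [|j IH] e jd /=; first exact: bmeas_cst.
apply: bmeas_sum => e'; apply: bmeasM; last by apply: IH; exact: ltnW.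
apply: bmeas_prod => i.
under eq_fun do rewrite (gates_atE _ (Ordinal jd)).
have mg : measurable_fun setT (g (Ordinal jd) i) by [].
exact: (bmeas_comp (bmeas_layer_mono j e e' i) mg).
Qed.

(** The statement is strengthened by an arbitrary function of every gate from layer [j] on. At j = 0
    only a product over all gates is left, to which independence applies. *)
Lemma mean_network_rest v0 j e (F : 'I_d * 'I_(k./2) -> 'M[C]_N -> C) :
  (j <= d)%N -> (forall li, bmeas (F li : borel_mx R N -> C)) ->
  cmean P (fun w => network (gates_at w) v0 j e *
    \prod_(li : 'I_d * 'I_(k./2) | (j <= li.1)%N) F li (g li.1 li.2 w)) =
  mean_network mu v0 j e * \prod_(li : 'I_d * 'I_(k./2) | (j <= li.1)%N) cmean mu (F li).
Proof.
have bg (li : 'I_d * 'I_(k./2)) (f : 'M[C]_N -> C) : bmeas (f : borel_mx R N -> C) ->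
    bmeas (fun w => f (g li.1 li.2 w)) by move=> bf; apply: bmeas_comp.
elim: j e F => [|j IH] e F jd bF /=.
  rewrite cmeanZ; last by apply: bmeas_prod => li; apply: bg.
  congr (_ * _); rewrite (independent_cmean_prod indep) //.
  by apply: eq_bigr => li _; apply: cmean_distribution => //; apply: law.
pose l := Ordinal jd.
(* Layer [j] leaves the network and joins the product, with its monomials as test functions. *)
pose F' e' (li : 'I_d * 'I_(k./2)) :=
  if li.1 == l then layer_mono j e e' li.2 else F li.
have bF' e' li : bmeas (F' e' li : borel_mx R N -> C).
  by rewrite /F'; case: eqP => _; [exact: bmeas_layer_mono|exact: bF].
have split_prod (H : 'I_d * 'I_(k./2) -> C) :
    \prod_(li : 'I_d * 'I_(k./2) | (j <= li.1)%N) H li =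
    (\prod_i H (l, i)) * \prod_(li : 'I_d * 'I_(k./2) | (j < li.1)%N) H li.
  rewrite (bigID (fun li => li.1 == l)) /=; congr (_ * _).
    rewrite (reindex_onto (fun i => (l, i)) snd) /=; last first.
      by move=> [a i] /= /andP[_ /eqP->].
    by apply: eq_bigl => i; rewrite leqnn !eqxx.
  by apply: eq_bigl => -[a i] /=; rewrite -val_eqE /= ltn_neqAle andbC eq_sym.
have -> : (fun w => (\sum_e' (\prod_i layer_mono j e e' i (gates_at w j i)) *
     network (gates_at w) v0 j e') * \prod_(li : 'I_d * 'I_(k./2) | (j < li.1)%N) F li (g li.1 li.2 w)) =
  (fun w => \sum_e' network (gates_at w) v0 j e' *
     \prod_(li : 'I_d * 'I_(k./2) | (j <= li.1)%N) F' e' li (g li.1 li.2 w)).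
  apply/funext => w; rewrite mulr_suml; apply: eq_bigr => e' _.
  rewrite split_prod mulrA [_ * network _ _ _ _]mulrC; congr (_ * _ * _).
    by apply: eq_bigr => i _; rewrite /F' /= eqxx -(gates_atE w l).
  by apply: eq_bigr => li; rewrite /F'; case: eqP => // ->; rewrite ltnn.
rewrite cmean_sum; last first.
  move=> e'; apply: bmeasM; first by apply: bmeas_network; exact: ltnW.
  by apply: bmeas_prod => li; apply: bg.
rewrite mulr_suml; apply: eq_bigr => e' _.
rewrite IH; [|exact: ltnW|exact: bF'].
rewrite split_prod mulrA [_ * mean_network _ _ _ _]mulrC; congr (_ * _ * _).
  by apply: eq_bigr => i _; rewrite /F' /= eqxx.
by apply: eq_bigr => li; rewrite /F'; case: eqP => // ->; rewrite ltnn.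
Qed.

Lemma cmean_network v0 e :
  cmean P (fun w => network (gates_at w) v0 d e) = mean_network mu v0 d e.
Proof.
have := @mean_network_rest v0 d e (fun _ _ => 1) (leqnn d) (fun _ => bmeas_cst 1).
rewrite !big_pred0 ?mulr1; try by move=> li; rewrite leqNgt ltn_ord.
move=> <-; congr cmean; apply/funext => w.
by rewrite mulr1.
Qed.

End Random.
End Network.

Section StringExpansion.
Context (R : realType) (Q : finType) (k : nat).
Local Notation C := R[i].
Local Notation N := (#|{: Q * Q}|).
Local Notation config := {ffun 'I_k -> quad Q}.
Local Notation q := (#|Q|%:R : R).
Hypothesis k_even : ~~ odd k.
Hypothesis Q_gt1 : (1 < #|Q|)%N.
Context (mu : probability (borel_mx R N) R).
Hypothesis mu2 : second_moment mu.

Definition swap_eta : R := q / (q ^+ 2 + 1).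

Let q1 : 1 < q. Proof. by rewrite ltr1n. Qed.
Let q0 : q != 0. Proof. by rewrite lt0r_neq0 // (lt_trans _ q1). Qed.
Let qp : q + 1 != 0.
Proof. by rewrite lt0r_neq0 // ltr_wpDl // ltW // (lt_trans _ q1). Qed.
Let qm : q - 1 != 0. Proof. by rewrite subr_eq0 gt_eqF. Qed.
Let q2p : q ^+ 2 + 1 != 0.
Proof. by rewrite lt0r_neq0 // ltr_wpDl // exprn_ge0 // ltW // (lt_trans _ q1). Qed.

Lemma card_pairE : (N%:R : C) = (q ^+ 2)%:C.
Proof. by rewrite card_prod rmorphXn /= rmorph_nat expr2 natrM. Qed.

Lemma sum_card2 (x : C) : \sum_(z : Q) \sum_(z' : Q) x = (q ^+ 2)%:C * x.
Proof.
rewrite !sumr_const -mulrnA -[x *+ _]mulr_natl natrM rmorphXn /= rmorph_nat.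
by rewrite expr2.
Qed.

Lemma sum_card_diag (f : Q -> Q -> bool) : (forall z z', f z z' = (z == z')) ->
  \sum_(z : Q) \sum_(z' : Q) (f z z')%:R = q%:C :> C.
Proof.
move=> fE; rewrite rmorph_nat -sumr_const; apply: eq_bigr => z _.
rewrite (bigD1 z) //= big1 ?addr0 ?fE ?eqxx // => z'.
by rewrite fE eq_sym => /negbTE ->.
Qed.

Lemma quad_tr_string t :
  quad_tr (@string_op R Q t) = (if t then q ^+ 2 else q)%:C :> C.
Proof.
case: t; rewrite /quad_tr /string_op /=.
  under eq_bigr do under eq_bigr do rewrite !eqxx /=.
  by rewrite sum_card2 mulr1.
by apply: sum_card_diag => z z'; rewrite [z' == z]eq_sym andbb.
Qed.

Lemma quad_trF_string t :
  quad_trF (@string_op R Q t) = (if t then q else q ^+ 2)%:C :> C.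
Proof.
case: t; rewrite /quad_trF /string_op /=.
  by apply: sum_card_diag => z z'; rewrite [z' == z]eq_sym andbb.
under eq_bigr do under eq_bigr do rewrite !eqxx /=.
by rewrite sum_card2 mulr1.
Qed.

Lemma gate_coef_string x y t :
  gate_coef (@string_op R Q x) (@string_op R Q y) t = (gate_wt swap_eta x y t)%:C.
Proof.
rewrite /gate_coef !quad_tr_string !quad_trF_string card_pairE /gate_wt.
rewrite -!rmorphM -!rmorphXn -(rmorph1 (real_complex R)) /=.
rewrite -!rmorphB -!rmorphM /= -fmorphV /=.
have q4 : q ^+ 4 - 1 != 0.
  have -> : q ^+ 4 - 1 = (q - 1) * (q + 1) * (q ^+ 2 + 1) by ring.
  by rewrite !mulf_neq0.
rewrite /swap_eta; case: x; case: y; case: t => /=;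
 rewrite -?rmorphB -?rmorphM /=; congr (_%:C); field;
 by rewrite ?q2p ?q0 ?q4.
Qed.

Definition string_prod (l : nat) (b : {ffun 'I_(k./2) -> bool}) (e : config) : C :=
  \prod_i (@string_op R Q (b i) (e (gate_fst l i)) *
           @string_op R Q (b i) (e (gate_snd l i))).

Lemma mean_layer l (h : 'I_k -> quad Q -> C) (e : config) :
  \sum_e' (\prod_i cmean mu (layer_mono l e e' i)) * \prod_j h j (e' j) =
  \sum_(b : {ffun 'I_(k./2) -> bool})
    (\prod_i gate_coef (h (gate_fst l i)) (h (gate_snd l i)) (b i)) *
    string_prod l b e.
Proof.
transitivity (\sum_(e' : config) \prod_i
  (cmean mu (layer_mono l e e' i) *
   (h (gate_fst l i) (e' (gate_fst l i)) * h (gate_snd l i) (e' (gate_snd l i))))).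
  by apply: eq_bigr => e' _; rewrite big_split /= (prod_gates k_even l).
rewrite (sum_gates k_even l (fun i a b =>
  cmean mu (ugate_mono (e (gate_fst l i)) (e (gate_snd l i)) a b) *
   (h (gate_fst l i) a * h (gate_snd l i) b))).
under eq_bigr do rewrite (mean_gate _ _ _ _ mu2).
by rewrite bigA_distr_bigA /=; apply: eq_bigr => b _; rewrite big_split.
Qed.

Fixpoint string_coef (c0 : {ffun 'I_(k./2) -> bool} -> R) (l : nat) :
    {ffun 'I_(k./2) -> bool} -> R :=
  if l is l'.+1 then
    wall_step (@ordS _) (gate_left l') swap_eta (string_coef c0 l')
  else c0.

(** [gate_coef] of the input, whose traces 4 and 2 per qudit give 16 and 4 per gate, divided by the
    factor 16 / q^4 that [mean_network_strings] takes out. *)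
Definition init_coef (t : bool) : R :=
  if t then (16 * q ^+ 2 - 4) * q ^+ 2 / (16 * (q ^+ 4 - 1))
  else (4 * q ^+ 2 - 16) * q ^+ 2 / (16 * (q ^+ 4 - 1)).

Definition init_string (b : {ffun 'I_(k./2) -> bool}) : R :=
  \prod_i init_coef (b i).

(** The first layer only turns the product input into strings; each later layer is one [wall_step].
    Hence [d.+1] layers give [d] contractions. *)
Lemma mean_network_strings (h : 'I_k -> quad Q -> C) (d : nat) (e : config) :
  (forall j, quad_tr (h j) = (4 : R)%:C) ->
  (forall j, quad_trF (h j) = (2 : R)%:C) ->
  mean_network mu (fun e => \prod_j h j (e j)) d.+1 e =
  ((16 / q ^+ 4) ^+ k./2)%:C *
  \sum_b (string_coef init_string d b)%:C * string_prod d b e.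
Proof.
move=> h4 h2; elim: d e => [|d IH] e.
  rewrite mean_networkS /= mean_layer mulr_sumr; apply: eq_bigr => b _.
  rewrite mulrA; congr (_ * _); rewrite /init_string -rmorphM /=.
  have -> : (16 / q ^+ 4) ^+ k./2 = \prod_(i < k./2) (16 / q ^+ 4).
    by rewrite prodr_const card_ord.
  rewrite -big_split rmorph_prod.
  apply: eq_bigr => i _; rewrite /gate_coef !h4 !h2 card_pairE /init_coef.
  have q4 : q ^+ 4 - 1 != 0.
    have -> : q ^+ 4 - 1 = (q - 1) * (q + 1) * (q ^+ 2 + 1) by ring.
    by rewrite !mulf_neq0.
  move: q0 q4; move: (#|Q|%:R : R) => x x0 x4.
  rewrite -!rmorphM -!rmorphXn -(rmorph1 (real_complex R)) /=.
  rewrite -!rmorphB -!rmorphM /= -fmorphV /=.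
  by case: (b i); rewrite -rmorphM /=; congr (_%:C); field; rewrite ?x0 ?x4.
rewrite mean_networkS; under eq_bigr do rewrite IH.
transitivity (((16 / q ^+ 4) ^+ k./2)%:C * \sum_a (string_coef init_string d a)%:C *
  \sum_e' (\prod_i cmean mu (layer_mono d.+1 e e' i)) * string_prod d a e').
  under eq_bigr do rewrite mulrCA.
  rewrite -mulr_sumr; congr (_ * _).
  under [RHS]eq_bigr do rewrite mulr_sumr.
  rewrite [RHS]exchange_big /=; apply: eq_bigr => e' _.
  by rewrite mulr_sumr; apply: eq_bigr => a _; rewrite mulrCA.
congr (_ * _).
transitivity (\sum_(a : {ffun 'I_(k./2) -> bool}) (string_coef init_string d a)%:C *
  \sum_(b : {ffun 'I_(k./2) -> bool}) (\prod_i gate_wt swap_eta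
     (a (gate_left d i)) (a (ordS (gate_left d i))) (b i))%:C *
     string_prod d.+1 b e).
  apply: eq_bigr => a _; congr (_ * _).
  have [hh hK Kh] := gate_site_bij k_even d.+1.
  (* A string of layer [d] is again a product over qudits, written here through the gates of layer
     [d.+1] so that [mean_layer] applies. *)
  pose h' (j : 'I_k) : quad Q -> C := let p := hh j in
    @string_op R Q (if p.2 then a (ordS (gate_left d p.1)) else a (gate_left d p.1)).
  have hf i : h' (gate_fst d.+1 i) = @string_op R Q (a (gate_left d i)).
    by rewrite /h' -[gate_fst _ _]/(gate_site d.+1 (i, false)) hK.
  have hs i : h' (gate_snd d.+1 i) = @string_op R Q (a (ordS (gate_left d i))).
    by rewrite /h' -[gate_snd _ _]/(gate_site d.+1 (i, true)) hK.
  have hE (e' : config) : string_prod d a e' = \prod_j h' j (e' j).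
    rewrite (prod_gates k_even d.+1) /string_prod.
    rewrite (gate_string_next k_even (@string_op R Q) d a e').
    by apply: eq_bigr => i _; rewrite hf hs.
  under eq_bigr do rewrite hE.
  rewrite mean_layer; apply: eq_bigr => b _; congr (_ * _).
  rewrite rmorph_prod; apply: eq_bigr => i _.
  by rewrite hf hs gate_coef_string.
under eq_bigr do rewrite mulr_sumr.
rewrite exchange_big /=; apply: eq_bigr => b _.
rewrite /= /wall_step rmorph_sum mulr_suml; apply: eq_bigr => a _.
by rewrite mulrA -rmorphM.
Qed.

Let q00 : 0 < q. Proof. exact: lt_trans q1. Qed.

Lemma init_coef_ge0 t : (4 <= #|Q|)%N -> 0 <= init_coef t.
Proof.
move=> Q4; have q4 : 4 <= q by rewrite ler_nat.
have q16 : 16 <= q ^+ 2 by rewrite expr2; have := ler_pM _ _ q4 q4; lra.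
have qq : 0 <= q ^+ 4 - 1.
  by rewrite (exprM q 2 2); have := ler_pM _ _ q16 q16; rewrite -expr2; lra.
have qs : 0 <= q ^+ 2 by rewrite exprn_ge0 // ltW.
rewrite /init_coef; case: t; apply: divr_ge0; apply: mulr_ge0 => //; lra.
Qed.

(* [wall_pair] at [b] dominates the coefficient of [b]; unlike the coefficient it
   contracts under a layer. *)
Lemma string_coef_bound d : (4 <= #|Q|)%N ->
  (forall b, 0 <= string_coef init_string d b) /\
  (forall b, wall_pair (@ordS _) q (string_coef init_string d) b <=
    string_wt R b * ((5 / 2 * swap_eta) ^+ d) ^+ nwalls (@ordS _) b).
Proof.
move=> Q4.
have q4 : q ^+ 4 - 1 != 0.
  have -> : q ^+ 4 - 1 = (q - 1) * (q + 1) * (q ^+ 2 + 1) by ring.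
  by rewrite !mulf_neq0.
have qi : 0 <= q ^- 2 by rewrite invr_ge0 exprn_ge0 // ltW.
elim: d => [|d [IH0 IH]].
  have c0 b : 0 <= init_string b.
    by apply: prodr_ge0 => i _; apply: init_coef_ge0.
  split=> // b; rewrite expr0 expr1n mulr1 /wall_pair /wall_fun /init_string /=.
  under eq_bigr do rewrite -big_split.
  rewrite /= -(bigA_distr_bigA (fun i z => init_coef z * site_wt (@ordS _) q b i z)).
  apply: ler_prod => i _; apply/andP; split.
    apply: sumr_ge0 => z _; apply: mulr_ge0; first exact: init_coef_ge0.
    by rewrite /site_wt; case: (z == b i) => //; case: (near _ _ _).
  apply: (@le_trans _ _ (\sum_z init_coef z * (if z == b i then 1 else q ^- 2))).
    apply: ler_sum => z _; apply: ler_wpM2l; first exact: init_coef_ge0.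
    by rewrite /site_wt; case: (z == b i) => //; case: (near _ _ _).
  (* Without the wall constraint the sum is exactly 1 for an identity and 1/4 for a swap. *)
  rewrite big_bool /init_coef le_eqVlt; apply/orP; left; apply/eqP.
  by case: (b i) => /=; field; rewrite ?q0 ?q4.
split=> [b|b] /=; first exact: (wall_step_ge0 _ _ q00 erefl).
rewrite exprS; apply: (wall_step_bound (q := q) (@ordSK _) (@ord_predK _)
  (gate_leftK d) (gate_left_invK d) (gate_leftS d) q00 erefl IH0 _ IH).
by rewrite exprn_ge0 // mulr_ge0 // (eta_ge0 q00).
Qed.

End StringExpansion.

Section Circuit.
Context (R : realType) (Q : finType) (k : nat).
Local Notation C := R[i].
Local Notation N := (#|{: Q * Q}|).
Local Notation config := {ffun 'I_k -> quad Q}.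
Local Notation space := {ffun 'I_k -> Q}.
Hypothesis k_even : ~~ odd k.

Fixpoint circuit (G : nat -> 'I_(k./2) -> 'M[C]_N) (d : nat) : qop R space :=
  if d is l.+1 then layer_op l (G l) *m circuit G l else 1%:M.

Lemma brickwork_circuit (G : nat -> 'I_(k./2) -> 'M[C]_N) d :
  brickwork_op (fun (l : 'I_d) => G l) = circuit G d.
Proof.
rewrite /brickwork_op.
suff : \big[mulmx/1%:M]_(l < d) layer_op (d - l.+1) (G (d - l.+1)%N) = circuit G d.
  by move<-.
elim: d => [|d IH]; first by rewrite big_ord0.
by rewrite big_ord_recl /= subn1 /= -IH.
Qed.

Lemma layer_opE l (g : 'I_(k./2) -> 'M[C]_N) (x y : space) :
  rentry (layer_op l g : qop R space) x y = \prod_i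
    rentry (g i) (x (gate_fst l i), x (gate_snd l i))
                 (y (gate_fst l i), y (gate_snd l i)).
Proof. exact: rentryE. Qed.

Lemma rentry1 (T : finType) (x y : T) : rentry (1%:M : 'M[C]_#|T|) x y = (x == y)%:R.
Proof. by rewrite /rentry mxE (inj_eq enum_rank_inj). Qed.

Lemma layer_op_unitary l (g : 'I_(k./2) -> 'M[C]_N) :
  (forall i, g i \is unitarymx) ->
  (layer_op l g : qop R space) ^t* *m layer_op l g = 1%:M.
Proof.
move=> ug; apply: mulmx1C; apply: rentryP => x y; rewrite rentryM rentry1.
under eq_bigr do rewrite rentry_adj !layer_opE rmorph_prod -big_split /=.
rewrite (sum_gates k_even l (fun i a b =>
  rentry (g i) (x (gate_fst l i), x (gate_snd l i)) (a, b) *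
  (rentry (g i) (y (gate_fst l i), y (gate_snd l i)) (a, b))^*)).
have E i : \sum_a \sum_b rentry (g i) (x (gate_fst l i), x (gate_snd l i)) (a, b) *
    (rentry (g i) (y (gate_fst l i), y (gate_snd l i)) (a, b))^* =
    (x (gate_fst l i) == y (gate_fst l i))%:R * (x (gate_snd l i) == y (gate_snd l i))%:R.
  rewrite (pair_bigA _ (fun a b => rentry (g i) _ (a, b) * (rentry (g i) _ (a, b))^*)) /=.
  have /unitarymxP e := ug i.
  have := congr1 (fun A : 'M[C]_N => rentry A (x (gate_fst l i), x (gate_snd l i))
    (y (gate_fst l i), y (gate_snd l i))) e.
  rewrite rentry1 rentryM xpair_eqE -mulnb natrM => <-.
  by apply: eq_bigr => -[a b] _; rewrite rentry_adj.
under eq_bigr do rewrite E.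
rewrite -(prod_gates k_even l (fun j => (x j == y j)%:R)).
case: eqP => [->|ne]; first by rewrite big1 // => j _; rewrite eqxx.
have [j xy] : exists j, x j != y j.
  apply/existsP; rewrite -negb_forall; apply/forallP => h.
  by apply: ne; apply/ffunP => j; apply/eqP.
by rewrite (bigD1 j) //= (negPf xy) mul0r.
Qed.

Lemma circuit_unitary (G : nat -> 'I_(k./2) -> 'M[C]_N) d :
  (forall l i, (l < d)%N -> G l i \is unitarymx) ->
  (circuit G d) ^t* *m circuit G d = 1%:M.
Proof.
elim: d => [|d IH] uG /=.
  by rewrite mulmx1 trmx1 map_mx1.
have uL := layer_op_unitary d (fun i => uG d i (ltnSn d)).
rewrite adjmxM; move: uL; move: (layer_op d (G d)) => A uA.
rewrite -mulmxA [A ^t* *m (A *m _)]mulmxA uA mul1mx; apply: IH => l i ld.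
by apply: uG; apply: ltnW.
Qed.

Definition cfg (x x' y y' : space) : config :=
  [ffun j => ((x j, x' j), (y j, y' j))].

Lemma sum_cfg (F : config -> C) :
  \sum_e F e = \sum_x \sum_x' \sum_y \sum_y' F (cfg x x' y y').
Proof.
under [RHS]eq_bigr => x _ do under eq_bigr => x' _ do
  rewrite (pair_bigA _ (fun y y' => F (cfg x x' y y'))) /=.
rewrite (pair_bigA _ (fun x x' => \sum_p F (cfg x x' p.1 p.2))) /=.
rewrite (pair_bigA _ (fun p q => F (cfg p.1 p.2 q.1 q.2))) /=.
pose f (p : (space * space) * (space * space)) := cfg p.1.1 p.1.2 p.2.1 p.2.2.
rewrite (reindex f) //.
exists (fun e : config => (([ffun j => (e j).1.1], [ffun j => (e j).1.2]),
                ([ffun j => (e j).2.1], [ffun j => (e j).2.2]))).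
  move=> [[x x'] [y y']] _; rewrite /f /=.
  by do 3?congr pair; apply/ffunP => j; rewrite !ffunE.
move=> e _; apply/ffunP => j; rewrite !ffunE /=.
by case: (e j) => [[? ?] [? ?]].
Qed.

Lemma network_circuit (G : nat -> 'I_(k./2) -> 'M[C]_N) (P0 : qop R space) d x x' y y' :
  (forall l i, (l < d)%N -> G l i \is unitarymx) ->
  let Pd := circuit G d *m P0 *m (circuit G d) ^t* in
  network G (fun e => rentry P0 [ffun j => (e j).1.1] [ffun j => (e j).2.1] *
                      rentry P0 [ffun j => (e j).1.2] [ffun j => (e j).2.2]) d
    (cfg x x' y y') = rentry Pd x y * rentry Pd x' y'.
Proof.
elim: d x x' y y' => [|d IH] x x' y y' uG /=.
  have c1 : [ffun j => (cfg x x' y y' j).1.1] = x by apply/ffunP => j; rewrite !ffunE.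
  have c2 : [ffun j => (cfg x x' y y' j).1.2] = x' by apply/ffunP => j; rewrite !ffunE.
  have c3 : [ffun j => (cfg x x' y y' j).2.1] = y by apply/ffunP => j; rewrite !ffunE.
  have c4 : [ffun j => (cfg x x' y y' j).2.2] = y' by apply/ffunP => j; rewrite !ffunE.
  by rewrite trmx1 map_mx1 mul1mx mulmx1 c1 c2 c3 c4.
pose A : qop R space := layer_op d (G d).
pose Pd := circuit G d *m P0 *m (circuit G d) ^t*.
have -> : layer_op d (G d) *m circuit G d *m P0 *m
    (layer_op d (G d) *m circuit G d) ^t* = A *m Pd *m A ^t*.
  by rewrite adjmxM /A /Pd !mulmxA.
have AE u v : rentry (A *m Pd *m A ^t*) u v =
    \sum_z \sum_t rentry A u z * rentry Pd z t * (rentry A v t)^*.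
  rewrite rentryM exchange_big /=; apply: eq_bigr => t _.
  by rewrite rentryM mulr_suml rentry_adj.
rewrite sum_cfg !AE mulr_suml; apply: eq_bigr => z _.
rewrite exchange_big mulr_suml /=; apply: eq_bigr => t _.
rewrite mulr_sumr; apply: eq_bigr => z' _; rewrite mulr_sumr.
apply: eq_bigr => t' _; rewrite IH; last first.
  by move=> l i ld; apply: uG; apply: ltnW.
have -> : \prod_i layer_mono d (cfg x x' y y') (cfg z z' t t') i (G d i) =
    rentry A x z * rentry A x' z' * ((rentry A y t)^* * (rentry A y' t')^*).
  rewrite /A !layer_opE !rmorph_prod -!big_split; apply: eq_bigr => i _ /=.
  by rewrite /layer_mono /ugate_mono /gate_mono /uind uG // mul1r !ffunE.
by rewrite -/Pd; ring.
Qed.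

End Circuit.

(** * Encoding *)

Section Encoding.
Context (R : realType) (k m : nat).
Local Notation C := R[i].
Local Notation S := (qubits (k * m)).
Local Notation L := (qubits k).
Local Notation H := {ffun 'I_k -> qubits m}.
Context (pos : 'I_k -> 'I_m).

Definition ungroup (f : H) : S :=
  [ffun i => f (mxtens_unindex i).1 (mxtens_unindex i).2].

Lemma group_qubitsK : cancel (@group_qubits k m) ungroup.
Proof.
move=> x; apply/ffunP => i; rewrite !ffunE /=.
by rewrite -[in RHS](mxtens_unindexK i).
Qed.

Lemma ungroupK : cancel ungroup (@group_qubits k m).
Proof.
by move=> f; apply/ffunP => a; apply/ffunP => b; rewrite !ffunE mxtens_indexK.
Qed.

Lemma sum_group (F : H -> C) : \sum_(x : S) F (group_qubits x) = \sum_f F f.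
Proof.
rewrite [RHS](reindex (@group_qubits k m)) //.
by exists ungroup => x _; rewrite ?group_qubitsK ?ungroupK.
Qed.

Lemma prod_tens (A : comPzSemiRingType) (F : 'I_(k * m) -> A) :
  \prod_i F i = \prod_a \prod_b F (mxtens_index (a, b)).
Proof.
rewrite pair_bigA /= (reindex (@mxtens_index k m)) /=; last first.
  by exists (@mxtens_unindex k m) => i _; rewrite (mxtens_indexK, mxtens_unindexK).
by apply: eq_bigr => -[].
Qed.

Lemma on_qubitsE (U : qop R H) (x y : S) :
  rentry (on_qubits U : qop R S) x y = rentry U (group_qubits x) (group_qubits y).
Proof. exact: rentryE. Qed.

Lemma on_qubitsM (A B : qop R H) : on_qubits (A *m B) = on_qubits A *m on_qubits B.
Proof.
apply: rentryP => x y; rewrite on_qubitsE !rentryM -sum_group.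
by apply: eq_bigr => z _; rewrite !on_qubitsE.
Qed.

Lemma on_qubits_adj (A : qop R H) : on_qubits (A ^t*) = (on_qubits A) ^t*.
Proof. by apply: rentryP => x y; rewrite on_qubitsE !rentry_adj on_qubitsE. Qed.

Definition embed : 'M[C]_(#|{: S}|, #|{: L}|) :=
  mkrop (fun x l => (ancillas_zero pos x && (logical_part pos x == l))%:R).

(** An entry of the projector of qudit [j] onto ancillas in state 0. Its rank is 2, since the
    logical qubit is free. *)
Definition ancilla_site (j : 'I_k) (u v : qubits m) : C :=
  ([forall b, (b != pos j) ==> (u b == 0)] && (u == v))%:R.

Definition init_proj : qop R H := mkop (fun x y : H => \prod_j ancilla_site j (x j) (y j)).

Lemma natr_forall (I : finType) (p : pred I) :
  ([forall i, p i])%:R = \prod_i (p i)%:R :> C.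
Proof.
case: (boolP [forall i, p i]) => [/forallP h|/forallPn[i hi]].
  by rewrite big1 // => i _; rewrite h.
by rewrite (bigD1 i) //= (negPf hi) mul0r.
Qed.

Lemma natr_ffun_eq (I T : finType) (f g : {ffun I -> T}) :
  (f == g)%:R = \prod_i (f i == g i)%:R :> C.
Proof.
rewrite -natr_forall; congr (nat_of_bool _)%:R.
by apply/eqP/forallP => [->|h] //; apply/ffunP => i; apply/eqP.
Qed.

Lemma embed_proj : embed *m embed ^t* = on_qubits init_proj.
Proof.
apply: rentryP => x y; rewrite on_qubitsE rentryM rentryE.
have -> : \sum_z rentry embed x z * rentry (embed ^t*) z y =
    \sum_z ((ancillas_zero pos x && (logical_part pos x == z)) &&
       (ancillas_zero pos y && (logical_part pos y == z)))%:R.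
  apply: eq_bigr => l _; rewrite rentry_adj !rentryE.
  by rewrite rmorph_nat -natrM mulnb.
have -> : \prod_j ancilla_site j (group_qubits x j) (group_qubits y j) =
    (ancillas_zero pos x && (x == y))%:R.
  rewrite -mulnb natrM -(can_eq group_qubitsK) natr_ffun_eq.
  rewrite /ancillas_zero natr_forall -big_split; apply: eq_bigr => j _ /=.
  rewrite -natrM mulnb; congr (_ && _)%:R.
  by apply: eq_forallb => b; rewrite !ffunE.
case: (boolP (ancillas_zero pos x)) => ax /=; last by rewrite big1.
rewrite (bigD1 (logical_part pos x)) //= eqxx big1 ?addr0 /= => [|l /negbTE h].
  congr (nat_of_bool _)%:R; apply/andP/eqP => [[ay /eqP e]|<-]; last by rewrite ax eqxx.
  apply/ffunP => i; rewrite -(mxtens_unindexK i).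
  case: (mxtens_unindex i) => a b.
  have [->|ne] := eqVneq b (pos a).
    by have := congr1 (fun f : L => f a) e; rewrite !ffunE.
  have /forallP/(_ a)/forallP/(_ b) := ax; have /forallP/(_ a)/forallP/(_ b) := ay.
  by rewrite ne /= => /eqP -> /eqP ->.
by rewrite [logical_part pos x == l]eq_sym h.
Qed.

Lemma with_ancillasE (rho : qop R L) : with_ancillas pos rho = embed *m rho *m embed ^t*.
Proof.
apply: rentryP => x y; rewrite rentryE rentryM.
rewrite (bigD1 (logical_part pos y)) //= big1 ?addr0 => [|l /negbTE h]; last first.
  by rewrite rentry_adj rentryE [_ == l]eq_sym h andbF rmorph0 mulr0.
rewrite rentryM (bigD1 (logical_part pos x)) //= big1 ?addr0 => [|l /negbTE h]; last first.
  by rewrite rentryE [_ == l]eq_sym h andbF mul0r.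
rewrite rentry_adj !rentryE !eqxx !andbT rmorph_nat -mulnb natrM.
by rewrite -[entry _ _ _]/(rentry _ _ _); ring.
Qed.

Lemma encoderE (U : qop R H) (rho : qop R L) :
  encoder pos U rho = (on_qubits U *m embed) *m rho *m (on_qubits U *m embed) ^t*.
Proof. by rewrite /encoder with_ancillasE adjmxM !mulmxA. Qed.

Lemma sum_ancilla_site j : \sum_u ancilla_site j u u = 2.
Proof.
transitivity (\sum_(u : qubits m) \prod_b ((b == pos j) || (u b == 0))%:R : C).
  apply: eq_bigr => u _; rewrite -natr_forall /ancilla_site eqxx andbT.
  by congr (nat_of_bool _)%:R; apply: eq_forallb => b; rewrite implyNb.
rewrite -(bigA_distr_bigA (fun b v => ((b == pos j) || (v == 0))%:R : C)) /=.
rewrite (bigD1 (pos j)) //= eqxx /= [X in _ * X]big1 ?mulr1 => [|b /negbTE h].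
  by rewrite sumr_const card_ord.
by rewrite h !big_ord_recl big_ord0 !addr0.
Qed.

Definition ancilla_quad (j : 'I_k) (a : quad (qubits m)) : C :=
  ancilla_site j a.1.1 a.2.1 * ancilla_site j a.1.2 a.2.2.

Lemma quad_tr_ancilla j : quad_tr (ancilla_quad j) = (4 : R)%:C.
Proof.
rewrite /quad_tr /ancilla_quad /=; under eq_bigr do rewrite -mulr_sumr.
rewrite -mulr_suml sum_ancilla_site -natrM; by rewrite rmorph_nat.
Qed.

(** For a projector p the swap trace of p (x) p is tr p^2 = tr p. *)
Lemma quad_trF_ancilla j : quad_trF (ancilla_quad j) = (2 : R)%:C.
Proof.
rewrite rmorph_nat -(sum_ancilla_site j) /quad_trF; apply: eq_bigr => z _.
rewrite (bigD1 z) //= big1 ?addr0 /ancilla_quad /ancilla_site /=.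
  by rewrite eqxx andbT -natrM mulnb andbb.
by move=> z'; rewrite eq_sym => /negbTE ->; rewrite andbF mul0r.
Qed.

Lemma init_proj_quad (e : {ffun 'I_k -> quad (qubits m)}) :
  rentry init_proj [ffun j => (e j).1.1] [ffun j => (e j).2.1] *
  rentry init_proj [ffun j => (e j).1.2] [ffun j => (e j).2.2] =
  \prod_j ancilla_quad j (e j).
Proof.
rewrite !rentryE -big_split; apply: eq_bigr => j _ /=.
by rewrite !ffunE.
Qed.

Lemma tr_init_proj : \tr init_proj = 2 ^+ k.
Proof.
rewrite tr_rentry; under eq_bigr do rewrite entryE.
rewrite -(bigA_distr_bigA (fun j u => ancilla_site j u u)) /=.
under eq_bigr do rewrite sum_ancilla_site.
by rewrite prodr_const card_ord.
Qed.

End Encoding.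

Section NoiseWeight.
Context (R : realType) (n : nat) (S' J : finType).
Local Notation C := R[i].
Context (K : J -> 'M[C]_(#|S'|, #|{: qubits n}|)) (lam : J -> R).

(* Value of the functional J on the string [t]: [true] marks the qubits carrying
   an identity, [false] those carrying a swap. *)
Definition noise_weight (t : 'I_n -> bool) : C :=
  \sum_a \sum_b ((Num.sqrt (lam a) * Num.sqrt (lam b))^-1)%:C *
  \sum_(x : qubits n) \sum_(x' : qubits n) \sum_(y : qubits n) \sum_(y' : qubits n)
    (\prod_i @string_op R 'I_2 (t i) ((x i, x' i), (y i, y' i))) *
    (rentry ((K b) ^t* *m K a) y' x * (rentry ((K b) ^t* *m K a) x' y)^*).

End NoiseWeight.

Section RandomCode.
Context (R : realType) (k m : nat) (S' J : finType).
Local Notation C := R[i].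
Local Notation S := (qubits (k * m)).
Local Notation Q := (qubits m).
Local Notation H := {ffun 'I_k -> Q}.
Local Notation N := (#|{: Q * Q}|).
Local Notation config := {ffun 'I_k -> quad Q}.
Context (pos : 'I_k -> 'I_m).
Context (K : J -> 'M[C]_(#|S'|, #|S|)) (lam : J -> R).

(** The trace is quadratic in [Y]; the index order makes its two entries those of the doubled
    operator in [network]. *)
Lemma tr_conj2 (T : finType) (X Y : qop R T) :
  \tr (X *m Y *m X ^t* *m Y) =
  \sum_x \sum_x' \sum_y \sum_y' (rentry Y x y * rentry Y x' y') *
    (rentry X y' x * (rentry X x' y)^*).
Proof.
rewrite tr_rentry; under eq_bigr do rewrite -[entry _ _ _]/(rentry _ _ _) rentryM.
under eq_bigr => y' _ do under eq_bigr => x' _ do rewrite rentryM mulr_suml.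
under eq_bigr => y' _ do under eq_bigr => x' _ do under eq_bigr => y _ do
  rewrite rentryM mulr_suml mulr_suml.
rewrite exchange_big /=.
under eq_bigr => x' _ do (rewrite exchange_big /=; under eq_bigr => y _ do rewrite exchange_big /=).
under eq_bigr => x' _ do rewrite exchange_big /=.
rewrite exchange_big /=; apply: eq_bigr => x _; apply: eq_bigr => x' _.
apply: eq_bigr => y _; apply: eq_bigr => y' _.
by rewrite rentry_adj; ring.
Qed.

Definition pair_wt (a b : J) (x x' y y' : S) : C :=
  rentry ((K b) ^t* *m K a) y' x * (rentry ((K b) ^t* *m K a) x' y)^*.

Definition config_wt (e : config) : C :=
  \sum_a \sum_b ((Num.sqrt (lam a) * Num.sqrt (lam b))^-1)%:C *
    pair_wt a b (ungroup [ffun j => (e j).1.1]) (ungroup [ffun j => (e j).1.2])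
                (ungroup [ffun j => (e j).2.1]) (ungroup [ffun j => (e j).2.2]).

Lemma sum_config_wt (F : config -> C) :
  \sum_e F e * config_wt e =
  \sum_a \sum_b ((Num.sqrt (lam a) * Num.sqrt (lam b))^-1)%:C *
    \sum_x \sum_x' \sum_y \sum_y'
    F (cfg (group_qubits x) (group_qubits x') (group_qubits y) (group_qubits y')) *
    pair_wt a b x x' y y'.
Proof.
under eq_bigr do rewrite mulr_sumr; rewrite exchange_big /=.
apply: eq_bigr => a _; under eq_bigr do rewrite mulr_sumr; rewrite exchange_big /=.
apply: eq_bigr => b _; under eq_bigr do rewrite mulrCA; rewrite -mulr_sumr.
congr (_ * _); rewrite sum_cfg -sum_group; apply: eq_bigr => x _.
rewrite -sum_group; apply: eq_bigr => x' _.
rewrite -sum_group; apply: eq_bigr => y _.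
rewrite -sum_group; apply: eq_bigr => y' _.
congr (_ * _).
have e1 (f g h l : S) : ungroup [ffun j => (cfg (group_qubits f) (group_qubits g)
    (group_qubits h) (group_qubits l) j).1.1] = f.
  by rewrite -[RHS]group_qubitsK; congr ungroup; apply/ffunP => j; rewrite !ffunE.
have e2 (f g h l : S) : ungroup [ffun j => (cfg (group_qubits f) (group_qubits g)
    (group_qubits h) (group_qubits l) j).1.2] = g.
  by rewrite -[RHS]group_qubitsK; congr ungroup; apply/ffunP => j; rewrite !ffunE.
have e3 (f g h l : S) : ungroup [ffun j => (cfg (group_qubits f) (group_qubits g)
    (group_qubits h) (group_qubits l) j).2.1] = h.
  by rewrite -[RHS]group_qubitsK; congr ungroup; apply/ffunP => j; rewrite !ffunE.
have e4 (f g h l : S) : ungroup [ffun j => (cfg (group_qubits f) (group_qubits g)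
    (group_qubits h) (group_qubits l) j).2.2] = l.
  by rewrite -[RHS]group_qubitsK; congr ungroup; apply/ffunP => j; rewrite !ffunE.
by rewrite e1 e2 e3 e4.
Qed.

Definition code_kraus (U : qop R H) (a : J) : 'M[C]_(#|S'|, #|{: qubits k}|) :=
  K a *m (on_qubits U *m embed R pos).

Hypothesis k_even : ~~ odd k.

(** By cyclicity the overlap depends on the encoder only through the projector onto the code space,
    in which it is quadratic. *)
Lemma overlap_code (G : nat -> 'I_(k./2) -> 'M[C]_N) d a b :
  (forall l i, (l < d)%N -> G l i \is unitarymx) ->
  (overlap (code_kraus (circuit G d)) a b)%:C =
  \sum_x \sum_x' \sum_y \sum_y'
    network G (fun e => \prod_j ancilla_quad R pos j (e j)) d
      (cfg (group_qubits x) (group_qubits x') (group_qubits y) (group_qubits y')) *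
    pair_wt a b x x' y y'.
Proof.
move=> uG; rewrite overlapE /code_kraus.
pose V := on_qubits (circuit G d) *m embed R pos.
pose Pi := on_qubits (circuit G d *m init_proj R pos *m (circuit G d) ^t*).
have PiE : V *m V ^t* = Pi.
  by rewrite /V /Pi adjmxM !on_qubitsM on_qubits_adj -embed_proj !mulmxA.
pose X := (K b) ^t* *m K a.
have -> : \tr ((K b *m V) ^t* *m (K a *m V) *m (K a *m V) ^t* *m (K b *m V)) =
    \tr (X *m Pi *m X ^t* *m Pi).
  rewrite -PiE /X; clearbody V.
  transitivity (\tr (V ^t* *m ((K b) ^t* *m (K a *m V) *m (K a *m V) ^t* *m (K b *m V)))).
    by rewrite adjmxM !mulmxA.
  by rewrite mxtrace_mulC !adjmxM trmxCK !mulmxA.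
rewrite tr_conj2; apply: eq_bigr => x _; apply: eq_bigr => x' _.
apply: eq_bigr => y _; apply: eq_bigr => y' _; congr (_ * _).
rewrite /Pi !on_qubitsE -(network_circuit _ _ _ _ _ uG).
congr (network _ _ _ _); apply/funext => e; exact: init_proj_quad.
Qed.

Lemma overlap_sum_network (G : nat -> 'I_(k./2) -> 'M[C]_N) d :
  (forall l i, (l < d)%N -> G l i \is unitarymx) ->
  (overlap_sum (code_kraus (circuit G d)) lam)%:C =
  (2 ^+ k)^-1 * \sum_e
    network G (fun e => \prod_j ancilla_quad R pos j (e j)) d e * config_wt e.
Proof.
move=> uG; rewrite sum_config_wt /overlap_sum rmorphM fmorphV rmorph_nat.
rewrite card_ffun !card_ord natrX; congr (_ * _).
rewrite rmorph_sum; apply: eq_bigr => a _; rewrite rmorph_sum; apply: eq_bigr => b _.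
by rewrite rmorphM /= overlap_code.
Qed.

Lemma code_kraus_tr (G : nat -> 'I_(k./2) -> 'M[C]_N) d :
  (forall l i, (l < d)%N -> G l i \is unitarymx) ->
  \sum_a (K a) ^t* *m K a = 1%:M ->
  \sum_a \tr ((code_kraus (circuit G d) a) ^t* *m code_kraus (circuit G d) a) =
  #|{: qubits k}|%:R.
Proof.
move=> uG K1; pose V := on_qubits (circuit G d) *m embed R pos.
have -> : \sum_a \tr ((code_kraus (circuit G d) a) ^t* *m code_kraus (circuit G d) a) =
    \tr (V ^t* *m (\sum_a (K a) ^t* *m K a) *m V).
  rewrite mulmx_sumr mulmx_suml raddf_sum; apply: eq_bigr => a _.
  by rewrite /code_kraus -/V adjmxM !mulmxA.
rewrite K1 mulmx1 mxtrace_mulC.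
have -> : V *m V ^t* = on_qubits (circuit G d *m init_proj R pos *m (circuit G d) ^t*).
  by rewrite /V adjmxM !on_qubitsM on_qubits_adj -embed_proj !mulmxA.
have -> (A : qop R H) : \tr (on_qubits A) = \tr A.
  rewrite !tr_rentry -sum_group; apply: eq_bigr => x _; exact: on_qubitsE.
rewrite mxtrace_mulC mulmxA circuit_unitary // mul1mx tr_init_proj.
by rewrite card_ffun !card_ord natrX.
Qed.

Lemma string_op_qubits (t : bool) (u u' v v' : Q) :
  @string_op R Q t ((u, u'), (v, v')) =
  \prod_i @string_op R 'I_2 t ((u i, u' i), (v i, v' i)).
Proof.
case: t; rewrite /string_op /= -mulnb natrM !natr_ffun_eq -big_split;
  by apply: eq_bigr => i _; rewrite /= -natrM mulnb.
Qed.

(** Every qubit inherits the symbol of the gate of layer [l] covering it. A gate covers 2 m qubits,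
    whence the square of w^m. *)
Lemma string_weight (w : R) (l : nat) (b : {ffun 'I_(k./2) -> bool}) :
  exists2 t : 'I_(k * m) -> bool,
    \sum_e string_prod R l b e * config_wt e = noise_weight K lam t &
    \prod_i (if t i then w else 1) = \prod_i (if b i then (w ^+ m) ^+ 2 else 1).
Proof.
have [h hK Kh] := gate_site_bij k_even l.
pose t (i : 'I_(k * m)) := b (h (mxtens_unindex i).1).1.
have hf i : h (gate_fst l i) = (i, false) by apply: (canLR hK).
have hs i : h (gate_snd l i) = (i, true) by apply: (canLR hK).
exists t; last first.
  rewrite prod_tens (prod_gates k_even l); apply: eq_bigr => i _.
  under eq_bigr do rewrite /t mxtens_indexK /= hf.
  under [X in _ * X]eq_bigr do rewrite /t mxtens_indexK /= hs.
  by rewrite !prodr_const card_ord; case: (b i); rewrite ?expr2 // !expr1n mul1r.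
rewrite sum_config_wt /noise_weight; apply: eq_bigr => a _; apply: eq_bigr => c _.
congr (_ * _); apply: eq_bigr => x _; apply: eq_bigr => x' _.
apply: eq_bigr => y _; apply: eq_bigr => y' _; congr (_ * _).
rewrite /string_prod prod_tens (prod_gates k_even l); apply: eq_bigr => i _.
rewrite !ffunE; congr (_ * _); rewrite string_op_qubits; apply: eq_bigr => j _.
  by rewrite !ffunE /t mxtens_indexK /= hf.
by rewrite !ffunE /t mxtens_indexK /= hs.
Qed.

End RandomCode.

Section MeanOverlap.
Context (R : realType) (k m : nat) (S' J : finType).
Local Notation C := R[i].
Local Notation S := (qubits (k * m)).
Local Notation Q := (qubits m).
Local Notation N := (#|{: Q * Q}|).
Local Notation config := {ffun 'I_k -> quad Q}.
Context (pos : 'I_k -> 'I_m).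
Context (K : J -> 'M[C]_(#|S'|, #|S|)) (lam : J -> R).
Context (d : nat) (disp : measure_display) (Omega : measurableType disp).
Context (P : probability Omega R).
Context (g : 'I_d.+1 -> 'I_(k./2) -> {RV P >-> borel_mx R N}).
Context (mu : probability (borel_mx R N) R).
Hypothesis k_even : ~~ odd k.
Hypothesis k_gt0 : (0 < k)%N.
Hypothesis Q4 : (4 <= #|Q|)%N.
Hypothesis indep : mutually_independent (fun li : 'I_d.+1 * 'I_(k./2) => g li.1 li.2).
Hypothesis law : forall l i (B : set (borel_mx R N)), measurable B ->
  distribution P (g l i) B = mu B.
Hypothesis mu2 : second_moment mu.
Hypothesis g_unitary : forall l i w, (g l i w : 'M[C]_N) \is unitarymx.
Context (w : R).
Hypothesis w_ge0 : 0 <= w.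
Hypothesis K_wt : forall t : 'I_(k * m) -> bool,
  noise_weight K lam t <= (4 ^+ (k * m) * \prod_i (if t i then w else 1))%:C.

Definition random_overlap (o : Omega) : R :=
  overlap_sum (code_kraus pos K (circuit (gates_at g o) d.+1)) lam.

Let gates_unitary o l i : (l < d.+1)%N -> gates_at g o l i \is unitarymx.
Proof. by move=> ld; have := gates_atE g o (Ordinal ld) i => /= ->; exact: g_unitary. Qed.

Let v0 (e : config) : C := \prod_j ancilla_quad R pos j (e j).

Let random_overlapE : (fun o => (random_overlap o)%:C) =
  (fun o => (2 ^+ k)^-1 * \sum_e config_wt K lam e * network (gates_at g o) v0 d.+1 e).
Proof.
apply/funext => o; rewrite /random_overlap overlap_sum_network //; last first.
  by move=> l i; exact: gates_unitary.
by congr (_ * _); apply: eq_bigr => e _; rewrite mulrC.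
Qed.

Lemma bmeas_random_overlap : bmeas (fun o => (random_overlap o)%:C).
Proof.
rewrite random_overlapE; apply: bmeasZ; apply: bmeas_sum => e; apply: bmeasZ.
exact: bmeas_network.
Qed.

Let Y : R := 4 * (w ^+ m) ^+ 2.
Let be : R := (5 / 2 * swap_eta R Q) ^+ d.

Let be_ge0 : 0 <= be.
Proof.
rewrite exprn_ge0 // mulr_ge0 //; apply: divr_ge0 => //.
Qed.

(** After normalisation a swap weighs 4 and an identity [Y] per gate. The 1/4 in [string_wt] cancels
    the 4, which leaves the ring sum with weights 1 and [Y] and with [be] per wall. *)
Lemma mean_random_overlap : Y < 1 ->
  \int[P]_o random_overlap o <=
  Y ^+ k./2 + (1 + be ^+ 2 * ((1 - Y)^-1 * (Y / (1 - Y)))) *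
    (1 + be ^+ 2 * (Y / (1 - Y))) ^+ k./2.
Proof.
move=> Y1; have Q1 : (1 < #|Q|)%N by apply: leq_trans Q4.
have Y0 : 0 <= Y by rewrite mulr_ge0 // exprn_ge0 // exprn_ge0.
have [c0 cb] := string_coef_bound R k Q1 d Q4.
set c := string_coef _ _ _ in c0 cb.
pose W2 : R := (w ^+ m) ^+ 2.
have -> : \int[P]_o random_overlap o =
    complex.Re (cmean P (fun o => (random_overlap o)%:C)) by [].
have kE : k = (k./2 + k./2)%N.
  by rewrite addnn -[LHS]odd_double_half (negPf k_even).
have M : cmean P (fun o => (random_overlap o)%:C) <=
    (\sum_b c b * \prod_i (if b i then Y else 4))%:C.
  have -> : cmean P (fun o => (random_overlap o)%:C) =
      ((2 ^+ k)^-1 * (16 / (#|Q|%:R : R) ^+ 4) ^+ k./2)%:C *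
      \sum_b (c b)%:C * \sum_e string_prod R d b e * config_wt K lam e.
    rewrite random_overlapE cmeanZ; last first.
      apply: bmeas_sum => e; apply: bmeasZ; exact: bmeas_network.
    rewrite rmorphM -mulrA; congr (_ * _).
      by rewrite fmorphV rmorphXn /= rmorph_nat.
    rewrite cmean_sum; last by move=> e; apply: bmeasZ; exact: bmeas_network.
    transitivity (\sum_e ((16 / (#|Q|%:R : R) ^+ 4) ^+ k./2)%:C *
       (\sum_b (c b)%:C * string_prod R d b e) * config_wt K lam e).
      apply: eq_bigr => e _; rewrite cmeanZ; last exact: bmeas_network.
      rewrite (cmean_network indep law) mulrC; congr (_ * _).
      rewrite mean_network_strings // => j; first exact: quad_tr_ancilla.
      exact: quad_trF_ancilla.
    under eq_bigr do rewrite -mulrA; rewrite -mulr_sumr; congr (_ * _).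
    under [RHS]eq_bigr do rewrite mulr_sumr; rewrite [RHS]exchange_big /=.
    by apply: eq_bigr => e _; rewrite mulr_suml; apply: eq_bigr => b _; rewrite mulrA.
  apply: (@le_trans _ _ (((2 ^+ k)^-1 * (16 / (#|Q|%:R : R) ^+ 4) ^+ k./2) *
      \sum_b c b * (4 ^+ (k * m) * \prod_i (if b i then W2 else 1)))%:C).
    rewrite [leRHS]rmorphM; apply: ler_wpM2l.
      rewrite lecR mulr_ge0 ?invr_ge0 ?exprn_ge0 ?divr_ge0 //.
    rewrite [leRHS]rmorph_sum; apply: ler_sum => b _; rewrite [leRHS]rmorphM.
    apply: ler_wpM2l; first by rewrite lecR.
    have [t -> <-] := string_weight K lam k_even w d b; exact: K_wt.
  rewrite lecR mulr_sumr; apply: ler_sum => b _.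
  rewrite mulrCA; apply: ler_wpM2l => //; rewrite mulrA.
  (* As #|Q| = 2^m, the power 4^(k m) cancels q^(4 k/2), and 2^-k 16^(k/2) = 4^(k/2) remains. *)
  have -> : (2 ^+ k)^-1 * (16 / (#|Q|%:R : R) ^+ 4) ^+ k./2 * 4 ^+ (k * m) = 4 ^+ k./2.
    have q0 : (#|Q|%:R : R) != 0 by rewrite pnatr_eq0 -lt0n (leq_trans _ Q4).
    have -> : (4 : R) ^+ (k * m) = (#|Q|%:R ^+ 4) ^+ k./2.
      rewrite card_ffun !card_ord natrX (_ : 4 = 2 ^+ 2); last by rewrite -natrX.
      by rewrite -!exprM {1}kE; congr (_ ^+ _); lia.
    rewrite -mulrA -exprMn divfK ?expf_neq0 //.
    have x0 : (2 : R) ^+ k./2 != 0 by rewrite expf_neq0 // pnatr_eq0.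
    rewrite [X in 2 ^- X]kE exprD (_ : 16 = 2 * 2 * (2 * 2)); last by rewrite -!natrM.
    rewrite (_ : (4 : R) = 2 * 2); last by rewrite -natrM.
    by rewrite !exprMn; field; rewrite x0.
  rewrite -[X in 4 ^+ X]card_ord -prodr_const -big_split.
  rewrite le_eqVlt; apply/orP; left; apply/eqP; apply: eq_bigr => i _ /=.
  by case: (b i); rewrite ?mulr1.
have /= : complex.Re (cmean P (fun o => (random_overlap o)%:C)) <=
    complex.Re (\sum_b c b * \prod_i (if b i then Y else 4))%:C.
  by case/andP: M.
move/le_trans; apply.
have RW n : (0 < n)%N -> \sum_(b : {ffun 'I_n -> bool})
    (\prod_i (if b i then Y else 1)) * be ^+ nwalls (@ordS n) b <=
    Y ^+ n + (1 + be ^+ 2 * ((1 - Y)^-1 * (Y / (1 - Y)))) *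
      (1 + be ^+ 2 * (Y / (1 - Y))) ^+ n.
  by case: n => // n _; exact: ring_wall_sum.
apply: le_trans (RW _ _); last by rewrite half_gt0; case: (k) k_gt0 k_even => [|[]].
apply: ler_sum => b _.
have -> : \prod_i (if b i then Y else 1) =
    string_wt R b * \prod_i (if b i then Y else 4).
  rewrite /string_wt -big_split; apply: eq_bigr => i _.
  by case: (b i); rewrite /= ?mul1r // mulVf // pnatr_eq0.
rewrite mulrAC; apply: ler_wpM2r.
  by apply: prodr_ge0 => i _; case: (b i).
(* [wall_fun b b] is 1 and all other terms of the pairing are nonnegative, so the pairing dominates
   the coefficient. *)
apply: le_trans (cb b); rewrite /wall_pair (bigD1 b) //= -[leLHS]addr0.
apply: lerD; last first.
  apply: sumr_ge0 => a _; apply: mulr_ge0 => //; apply: prodr_ge0 => i _.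
  by rewrite /site_wt; case: (_ == _) => //; case: (near _ _ _).
by rewrite /wall_fun big1 ?mulr1 // => i _; rewrite /site_wt eqxx.
Qed.

End MeanOverlap.

(** * Noise models *)

Lemma conjCR (R : realType) (x : R) : (x%:C : R[i])^* = x%:C.
Proof. exact: conjc_real. Qed.

(** [w] bounds the weight of an identity on one qubit relative to that of a swap, normalised to
    4. *)
Definition noise_model (R : realType) (n : nat) (S' : finType)
    (noise : qop R (qubits n) -> qop R S') (w : R) : Prop :=
  exists (J : finType) (K : J -> 'M[R[i]]_(#|S'|, #|{: qubits n}|)) (lam : J -> R),
    [/\ forall X, noise X = kraus_map K X,
        [/\ forall j, 0 <= lam j, \sum_j lam j = 1 & forall j, lam j = 0 -> K j = 0],
        \sum_j (K j) ^t* *m K j = 1%:M &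
        forall t : 'I_n -> bool,
          noise_weight K lam t <= (4 ^+ n * \prod_i (if t i then w else 1))%:C].

Section LocalNoise.
Context (R : realType) (b : nat) (I : finType).
Local Notation C := R[i].
Context (Phi : 'M[C]_2 -> 'M[C]_b) (ker : I -> 'I_b -> 'I_2 -> R) (l : I -> R).
Context (n : nat).
Local Notation S := (qubits n).
Local Notation S' := {ffun 'I_n -> 'I_b}.

Definition site_overlap (a c : I) (x y : 'I_2) : R := \sum_z ker c z x * ker a z y.

(** The one-qubit factor of [noise_weight]. For K the transpose of the c-th kernel times the a-th,
    an identity gives the squared Hilbert-Schmidt norm of K, a swap its squared trace. *)
Definition site_weight (t : bool) : R :=
  \sum_a \sum_c (Num.sqrt (l a) * Num.sqrt (l c))^-1 *
    (if t then \sum_x \sum_y site_overlap a c x y ^+ 2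
     else (\sum_x site_overlap a c x x) ^+ 2).

Definition tensor_kraus (A : {ffun 'I_n -> I}) : 'M[C]_(#|{: S'}|, #|{: S}|) :=
  mkrop (fun (y : S') (x : S) => (\prod_i ker (A i) (y i) (x i))%:C).

Definition tensor_wt (A : {ffun 'I_n -> I}) : R := \prod_i l (A i).

Hypothesis PhiE : forall x x' y y',
  Phi (delta_mx x x') y y' = (\sum_j ker j y x * ker j y' x')%:C.
Hypothesis ker_id : forall x y, \sum_j \sum_z ker j z x * ker j z y = (x == y)%:R.
Hypothesis l_ge0 : forall j, 0 <= l j.
Hypothesis l_sum : \sum_j l j = 1.
Hypothesis l_eq0 : forall j, l j = 0 -> forall y x, ker j y x = 0.
Context (w : R).
Hypothesis weightI : site_weight true <= 4 * w.
Hypothesis weightF : site_weight false <= 4.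

Let sum_prod (T : finType) (F : 'I_n -> T -> R) :
  \prod_i \sum_a F i a = \sum_(f : {ffun 'I_n -> T}) \prod_i F i (f i).
Proof. exact: bigA_distr_bigA. Qed.

Lemma local_noise_kraus (X : qop R S) : local_noise Phi X = kraus_map tensor_kraus X.
Proof.
apply: rentryP => y y'; rewrite rentryE rentry_sum.
under [RHS]eq_bigr => A _.
  rewrite rentryM; under eq_bigr => x' _ do rewrite rentryM mulr_suml; over.
rewrite [RHS]exchange_big /= exchange_big /=.
apply: eq_bigr => x' _; rewrite [RHS]exchange_big /=; apply: eq_bigr => x _.
transitivity (\sum_(A : {ffun 'I_n -> I}) entry X x x' * (\prod_i (ker (A i) (y i) (x i) * ker (A i) (y' i) (x' i)))%:C).
  rewrite -mulr_sumr -rmorph_sum -(sum_prod (fun i j => ker j (y i) (x i) * ker j (y' i) (x' i))).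
  by rewrite rmorph_prod; congr (_ * _); apply: eq_bigr => i _; rewrite PhiE.
apply: eq_bigr => A _; rewrite rentry_adj !rentryE big_split rmorphM /=.
by rewrite conjCR -[rentry X _ _]/(entry X x x'); ring.
Qed.

Lemma tensor_overlap A B x y :
  rentry ((tensor_kraus B) ^t* *m tensor_kraus A) x y =
  (\prod_i site_overlap (A i) (B i) (x i) (y i))%:C.
Proof.
rewrite rentryM /site_overlap sum_prod rmorph_sum; apply: eq_bigr => z _.
by rewrite rentry_adj !rentryE conjCR -rmorphM -big_split.
Qed.

Lemma sqrt_prod (F : 'I_n -> R) : (forall i, 0 <= F i) ->
  Num.sqrt (\prod_i F i) = \prod_i Num.sqrt (F i).
Proof.
move=> F0; elim: (index_enum _) => [|i s IH]; first by rewrite !big_nil sqrtr1.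
by rewrite !big_cons sqrtrM // IH.
Qed.

Lemma site_weight_ge0 t : 0 <= site_weight t.
Proof.
apply: sumr_ge0 => a _; apply: sumr_ge0 => c _; apply: mulr_ge0.
  by rewrite invr_ge0 mulr_ge0 // sqrtr_ge0.
case: t; last exact: sqr_ge0.
by apply: sumr_ge0 => x _; apply: sumr_ge0 => y _; exact: sqr_ge0.
Qed.

Lemma tensor_noise_weight (t : 'I_n -> bool) :
  noise_weight tensor_kraus tensor_wt t = (\prod_i site_weight (t i))%:C.
Proof.
pose f (s : bool) (a c : I) : R := \sum_x \sum_x' \sum_y \sum_y'
  (if s then ((x == y) && (x' == y'))%:R else ((x == y') && (x' == y))%:R) *
  (site_overlap a c y' x * site_overlap a c x' y).
have fE s a c : f s a c = if s then \sum_x \sum_y site_overlap a c x y ^+ 2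
     else (\sum_x site_overlap a c x x) ^+ 2.
  rewrite /f; case: s.
    rewrite [RHS]exchange_big; apply: eq_bigr => x _; apply: eq_bigr => x' _.
    rewrite (bigD1 x) //= [X in _ + X]big1 ?addr0; last first.
      by move=> y /negbTE h; apply: big1 => y' _; rewrite eq_sym h mul0r.
    rewrite (bigD1 x') //= big1 ?addr0 ?eqxx ?mul1r ?expr2 //.
    by move=> y' /negbTE h; rewrite [x' == _]eq_sym h andbF mul0r.
  rewrite expr2 mulr_suml; apply: eq_bigr => x _; rewrite mulr_sumr.
  apply: eq_bigr => x' _.
  rewrite (bigD1 x') //= [X in _ + X]big1 ?addr0; last first.
    by move=> y /negbTE h; apply: big1 => y' _; rewrite [x' == y]eq_sym h andbF mul0r.
  rewrite (bigD1 x) //= big1 ?addr0 ?eqxx ?mul1r //.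
  by move=> y' /negbTE h; rewrite [x == _]eq_sym h mul0r.
rewrite /noise_weight /site_weight sum_prod rmorph_sum; apply: eq_bigr => A _.
rewrite sum_prod rmorph_sum; apply: eq_bigr => B _.
rewrite big_split rmorphM /tensor_wt !sqrt_prod // -big_split prodfV /=; congr (_ * _).
under [in RHS]eq_bigr do rewrite -fE.
rewrite /f sum_prod rmorph_sum; apply: eq_bigr => x _.
rewrite sum_prod rmorph_sum; apply: eq_bigr => x' _.
rewrite sum_prod rmorph_sum; apply: eq_bigr => y _.
rewrite sum_prod rmorph_sum; apply: eq_bigr => y' _.
rewrite !tensor_overlap conjCR -rmorphM -big_split.
rewrite [in RHS]big_split [RHS]rmorphM /=.
congr (_ * _); rewrite rmorph_prod; apply: eq_bigr => i _.
by rewrite /string_op; case: (t i); rewrite rmorph_nat.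
Qed.

Lemma local_noise_model : noise_model (@local_noise R 2 b Phi n) w.
Proof.
exists {ffun 'I_n -> I}, tensor_kraus, tensor_wt; split.
- exact: local_noise_kraus.
- split.
  + by move=> A; apply: prodr_ge0.
  + rewrite /tensor_wt -(sum_prod (fun _ => l)) l_sum.
    by rewrite big1.
  move=> A /eqP/prodf_eq0[i _ /eqP/l_eq0 h].
  apply: rentryP => y x; rewrite rentryE (bigD1 i) //= h mul0r.
  by rewrite /rentry mxE.
- apply: rentryP => x y; rewrite rentry_sum rentry1 natr_ffun_eq.
  rewrite (eq_bigr _ (fun A _ => tensor_overlap A A x y)) -rmorph_sum /=.
  rewrite -(sum_prod (fun i a => site_overlap a a (x i) (y i))) rmorph_prod.
  by apply: eq_bigr => i _; rewrite ker_id rmorph_nat.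
move=> t; rewrite tensor_noise_weight lecR.
have -> : 4 ^+ n = \prod_(i < n) (4 : R) by rewrite prodr_const card_ord.
rewrite -big_split; apply: ler_prod => i _; rewrite site_weight_ge0 /=.
by case: (t i); rewrite ?mulr1.
Qed.

End LocalNoise.

Section Channels.
Context (R : realType).
Local Notation C := R[i].

Lemma sum_ord2 (V : nmodType) (F : nat -> V) : \sum_(i < 2) F i = F 0%N + F 1%N.
Proof. by rewrite !big_ord_recl big_ord0 addr0. Qed.
Lemma sum_ord3 (V : nmodType) (F : nat -> V) : \sum_(i < 3) F i = F 0%N + (F 1%N + F 2%N).
Proof. by rewrite !big_ord_recl big_ord0 addr0. Qed.
Lemma sum_ord4 (V : nmodType) (F : nat -> V) :
  \sum_(i < 4) F i = F 0%N + (F 1%N + (F 2%N + F 3%N)).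
Proof. by rewrite !big_ord_recl big_ord0 addr0. Qed.

Lemma mulV_sqr (x : R) : x^-1 * x ^+ 2 = x.
Proof.
have [->|x0] := eqVneq x 0; first by rewrite expr0n mulr0.
by rewrite expr2 mulKf.
Qed.

Lemma ord2P (P : 'I_2 -> Prop) : P 0 -> P 1 -> forall x, P x.
Proof.
move=> p0 p1 [[|[|x]] h] //.
  by have -> : Ordinal h = 0 by apply: val_inj.
by have -> : Ordinal h = 1 by apply: val_inj.
Qed.

Section Pauli.
Context (p : nat -> R).
Hypothesis p_ge0 : forall j, 0 <= p j.
Hypothesis p_sum : p 0%N + (p 1%N + (p 2%N + p 3%N)) = 1.

(** Real forms of I, X, Y, Z: the phase i of Y is dropped, as it does not affect the channel.
    Natural indices let the entries compute. *)
Definition pauli_entry (j y x : nat) : R :=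
  match j with
  | 0 => (y == x)%:R
  | 1 => (y != x)%:R
  | 2 => if y == x then 0 else (-1) ^+ (y == 0)
  | _ => if y == x then (-1) ^+ (y != 0) else 0
  end.

Let s j : R := Num.sqrt (p j).
Let ss j : s j * s j = p j. Proof. by rewrite -expr2 sqr_sqrtr. Qed.

Definition pauli_ker (j : 'I_4) (y x : 'I_2) : R := s j * pauli_entry j y x.

Lemma pauli_overlap (a c : 'I_4) (x y : 'I_2) : site_overlap pauli_ker a c x y =
  s a * s c * (pauli_entry c 0%N x * pauli_entry a 0%N y + pauli_entry c 1%N x * pauli_entry a 1%N y).
Proof.
rewrite /site_overlap (sum_ord2 (fun z => s c * pauli_entry c z x * (s a * pauli_entry a z y))).
ring.
Qed.

Lemma pauli_overlap_sqr (a c : 'I_4) :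
  \sum_x \sum_y site_overlap pauli_ker a c x y ^+ 2 = 2 * (s a * s c) ^+ 2.
Proof.
under eq_bigr do under eq_bigr do rewrite pauli_overlap.
rewrite (sum_ord2 (fun x => \sum_(y < 2) (s a * s c * (pauli_entry c 0%N x * pauli_entry a 0%N y +
  pauli_entry c 1%N x * pauli_entry a 1%N y)) ^+ 2)).
rewrite !(sum_ord2 (fun y => (s a * s c * (pauli_entry c 0%N _ * pauli_entry a 0%N y +
  pauli_entry c 1%N _ * pauli_entry a 1%N y)) ^+ 2)).
by move: a c => [[|[|[|[|a]]]] //= _] [[|[|[|[|c]]]] //= _]; ring.
Qed.

Lemma pauli_overlap_tr (a c : 'I_4) :
  \sum_x site_overlap pauli_ker a c x x = (a == c)%:R * (2 * (s a * s c)).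
Proof.
under eq_bigr do rewrite pauli_overlap.
rewrite (sum_ord2 (fun x => (s a * s c * (pauli_entry c 0%N x * pauli_entry a 0%N x +
  pauli_entry c 1%N x * pauli_entry a 1%N x)))).
by rewrite -val_eqE; move: a c => [[|[|[|[|a]]]] //= _] [[|[|[|[|c]]]] //= _]; ring.
Qed.

Lemma mul_delta a b (A : 'M[C]_(b, a)) (B : 'M[C]_(a, b)) x x' y y' :
  (A *m delta_mx x x' *m B) y y' = A y x * B x' y'.
Proof.
rewrite -(mul_delta_mx (0 : 'I_1)) mulmxA -mulmxA -colE -rowE mxE big_ord1.
by rewrite !mxE.
Qed.

Lemma pauli_entryX y x : pauliX R y x = (pauli_entry 1%N y x)%:C.
Proof.
by elim/ord2P: y; elim/ord2P: x; rewrite !mxE /= ?addr0 ?add0r.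
Qed.

Lemma pauli_entryZ y x : pauliZ R y x = (pauli_entry 3%N y x)%:C.
Proof.
elim/ord2P: y; elim/ord2P: x; rewrite !mxE /= ?subr0 ?add0r ?expr1 ?rmorphN ?rmorph1 //.
Qed.

Lemma pauli_entryY y x : pauliY R y x = 'i * (pauli_entry 2%N y x)%:C.
Proof.
elim/ord2P: y; elim/ord2P: x; rewrite !mxE /= ?subrr ?subr0 ?sub0r ?expr1 ?rmorphN ?rmorph1 //.
Qed.

(** Products of Paulis have squared norm 2, so an identity weighs 2 times the squared sum of the
    roots, that is 4 w. By orthogonality only equal indices contribute to a swap, each 4 p_a. *)
Lemma pauli_model n :
  noise_model (@local_noise R 2 2 (pauli_channel (p 0%N) (p 1%N) (p 2%N) (p 3%N)) n)
    ((s 0%N + (s 1%N + (s 2%N + s 3%N))) ^+ 2 / 2).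
Proof.
apply: (@local_noise_model R 2 'I_4 _ pauli_ker (fun j => p j)).
- move=> x x' y y'.
  rewrite (sum_ord4 (fun j => s j * pauli_entry j y x * (s j * pauli_entry j y' x'))).
  have e i j : s i * j * (s i * j) = p i * (j * j) by rewrite mulrACA ss.
  have e' i j k : s i * j * (s i * k) = p i * (j * k) by rewrite mulrACA ss.
  have addE (A B : 'M[C]_2) : (A + B) y y' = A y y' + B y y' by rewrite mxE.
  have scaleE c (A : 'M[C]_2) : (c *: A) y y' = c * A y y' by rewrite mxE.
  rewrite !e' /pauli_channel !addE !scaleE -!addrA [delta_mx _ _ _ _]mxE {addE scaleE}.
  rewrite ![(_ *m delta_mx _ _ *m _) y y']mul_delta !pauli_entryX !pauli_entryY !pauli_entryZ.
  rewrite !rmorphD !rmorphM; congr (_ + (_ + (_ + _))); congr (_ * _).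
  - by rewrite -mulnb natrM /= !rmorph_nat.
  - by rewrite /= [(x' : nat) == y']eq_sym.
  (* The real form of Y is antisymmetric, and this sign compensates the square of the dropped
     phase. *)
  - have -> : pauli_entry 2 x' y' = - pauli_entry 2 y' x'.
      by elim/ord2P: x'; elim/ord2P: y'; rewrite /= ?oppr0 ?expr1 ?expr0 ?opprK.
    by rewrite /= rmorphN mulrACA -expr2 sqrCi mulN1r mulrN opprK.
  - by rewrite /= [(x' : nat) == y']eq_sym; case: ((y' : nat) =P x') => // ->.
- move=> x y.
  rewrite (eq_bigr (fun j => site_overlap pauli_ker j j x y)) //.
  under eq_bigr do rewrite pauli_overlap ss.
  rewrite (sum_ord4 (fun j => p j * (pauli_entry j 0%N x * pauli_entry j 0%N y + pauli_entry j 1%N x * pauli_entry j 1%N y))).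
  by elim/ord2P: x; elim/ord2P: y; rewrite /= ?mulr0n -?[RHS]p_sum; ring.
- by [].
- by rewrite (sum_ord4 p).
- by move=> j p0 y x; rewrite /pauli_ker /s p0 sqrtr0 mul0r.
- rewrite /site_weight; under eq_bigr do under eq_bigr do
    rewrite pauli_overlap_sqr mulrCA mulV_sqr.
  rewrite le_eqVlt; apply/orP; left; apply/eqP.
  under eq_bigr do rewrite -mulr_sumr -mulr_sumr.
  rewrite -mulr_sumr -mulr_suml (sum_ord4 s); by field.
rewrite /site_weight; apply: (@le_trans _ _ (\sum_(a < 4) 4 * p a : R)).
  apply: ler_sum => a _; under eq_bigr do rewrite pauli_overlap_tr.
  rewrite (bigD1 a) //= big1 ?addr0 => [|c /negbTE h]; last first.
    by rewrite eq_sym h mul0r expr0n mulr0.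
  by rewrite eqxx mul1r exprMn mulrCA mulV_sqr ss -natrX.
by rewrite -mulr_sumr (sum_ord4 p) p_sum mulr1.
Qed.
End Pauli.

Lemma half_sqr (x : R) : (x / 2)^-1 * x ^+ 2 = 2 * x.
Proof.
have [->|x0] := eqVneq x 0; first by rewrite expr0n !mulr0.
by field; rewrite x0.
Qed.

Section Erasure.
Context (p : R).
Hypothesis p01 : 0 <= p <= 1.

Let p0 : 0 <= p. Proof. by case/andP: p01. Qed.
Let p1 : 0 <= 1 - p. Proof. by rewrite subr_ge0; case/andP: p01. Qed.
Let s := Num.sqrt (1 - p).
Let r := Num.sqrt p.
Let ss : s * s = 1 - p. Proof. by rewrite -expr2 sqr_sqrtr. Qed.
Let rr : r * r = p. Proof. by rewrite -expr2 sqr_sqrtr. Qed.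

Definition erasure_entry (j y x : nat) : R :=
  if j == 0%N then s * (y == x)%:R else r * ((y == 2%N) && (x == j.-1))%:R.
Definition erasure_prob (j : nat) : R := if j == 0%N then 1 - p else p / 2.

Definition erasure_ker (j : 'I_3) (y : 'I_3) (x : 'I_2) : R := erasure_entry j y x.

Lemma erasure_overlap (a c : 'I_3) (x y : 'I_2) : site_overlap erasure_ker a c x y =
  erasure_entry c 0 x * erasure_entry a 0 y + (erasure_entry c 1 x * erasure_entry a 1 y
  + erasure_entry c 2 x * erasure_entry a 2 y).
Proof. exact: (sum_ord3 (fun z => erasure_entry c z x * erasure_entry a z y)). Qed.

Lemma erasure_overlap_sqr (a c : 'I_3) :
  \sum_x \sum_y site_overlap erasure_ker a c x y ^+ 2 =
  if (a == 0%N :> nat) && (c == 0%N :> nat) then 2 * (s * s) ^+ 2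
  else if (a == 0%N :> nat) || (c == 0%N :> nat) then 0 else (r * r) ^+ 2.
Proof.
under eq_bigr do under eq_bigr do rewrite erasure_overlap.
pose f x y := (erasure_entry c 0 x * erasure_entry a 0 y + (erasure_entry c 1 x *
  erasure_entry a 1 y + erasure_entry c 2 x * erasure_entry a 2 y)) ^+ 2.
rewrite (sum_ord2 (fun x => \sum_(y < 2) f x y)) !(sum_ord2 (f _)) /f /erasure_entry.
by move: a c {f} => [[|[|[|a]]] //= _] [[|[|[|c]]] //= _]; ring.
Qed.

Lemma erasure_overlap_tr (a c : 'I_3) :
  \sum_x site_overlap erasure_ker a c x x =
  if a == c then (if a == 0%N :> nat then 2 * (s * s) else r * r) else 0.
Proof.
under eq_bigr do rewrite erasure_overlap.
rewrite (sum_ord2 (fun x => erasure_entry c 0 x * erasure_entry a 0 x + (erasure_entry c 1 x *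
  erasure_entry a 1 x + erasure_entry c 2 x * erasure_entry a 2 x))) /erasure_entry.
by rewrite -val_eqE; move: a c => [[|[|[|a]]] //= _] [[|[|[|c]]] //= _]; ring.
Qed.

(** An identity weighs 2 (1 - p) from the unerased term and 2 p from each of the four pairs of
    erasure operators, 2 + 6 p in all; mixed terms vanish because the ranges are orthogonal. A swap
    weighs 4 (1 - p) + 4 p. *)
Lemma erasure_model n :
  noise_model (@local_noise R 2 3 (erasure_channel p) n) ((1 + 3 * p) / 2).
Proof.
have sq : Num.sqrt (p / 2) * Num.sqrt (p / 2) = p / 2.
  by rewrite -expr2 sqr_sqrtr // divr_ge0.
have pp := half_sqr p.
apply: (@local_noise_model R 3 'I_3 _ erasure_ker (fun j => erasure_prob j)).
- move=> x x' y y'.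
  rewrite (sum_ord3 (fun j => erasure_entry j y x * erasure_entry j y' x')) /erasure_entry /=.
  have trE : \tr (delta_mx x x' : 'M[C]_2) = (x == x')%:R.
    rewrite /mxtrace (bigD1 x) //= big1 ?addr0 ?mxE ?eqxx // => i /negbTE h.
    by rewrite mxE h.
  rewrite /erasure_channel trE.
  have [u yu|u yu] := split_ordP (y : 'I_(2 + 1)); have [v yv|v yv] := split_ordP (y' : 'I_(2 + 1)).
  + have -> : block_mx ((1 - p)%:C *: delta_mx x x') 0 0 (p%:C * (x == x')%:R)%:M y y' =
        ((1 - p)%:C *: delta_mx x x') u v :> C by rewrite yu yv; exact: block_mxEul.
    have yu2 : (y == 2 :> nat) = false by rewrite yu /= ltn_eqF.
    rewrite yu2 /= !mulr0n !mulr0 !mul0r !addr0 mulrACA ss yu yv /= !mxE.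
    by rewrite rmorphM -natrM mulnb /= rmorph_nat.
  + have -> : block_mx ((1 - p)%:C *: delta_mx x x') 0 0 (p%:C * (x == x')%:R)%:M y y' =
        (0 : 'M[C]_(2, 1)) u v by rewrite yu yv; exact: block_mxEur.
    have yu2 : (y == 2 :> nat) = false by rewrite yu /= ltn_eqF.
    have yx : (y' == x' :> nat) = false by rewrite yv (ord1 v) /= gtn_eqF.
    by rewrite yu2 yx /= !mxE !mulr0n !(mulr0, mul0r) !addr0.
  + have -> : block_mx ((1 - p)%:C *: delta_mx x x') 0 0 (p%:C * (x == x')%:R)%:M y y' =
        (0 : 'M[C]_(1, 2)) u v by rewrite yu yv; exact: block_mxEdl.
    have yv2 : (y' == 2 :> nat) = false by rewrite yv /= ltn_eqF.
    have yx : (y == x :> nat) = false by rewrite yu (ord1 u) /= gtn_eqF.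
    by rewrite yv2 yx /= !mxE !mulr0n !(mulr0, mul0r) !addr0.
  + have -> : block_mx ((1 - p)%:C *: delta_mx x x') 0 0 (p%:C * (x == x')%:R)%:M y y' =
        ((p%:C * (x == x')%:R)%:M : 'M[C]_1) u v by rewrite yu yv; exact: block_mxEdr.
    have y2 : (y == 2 :> nat) by rewrite yu (ord1 u).
    have yv2 : (y' == 2 :> nat) by rewrite yv (ord1 v).
    have yx : (y == x :> nat) = false by rewrite yu (ord1 u) /= gtn_eqF.
    rewrite y2 yv2 yx (ord1 u) (ord1 v) !mxE /= !mulr0n !(mulr0, mul0r) add0r.
    have e i j : r * i * (r * j) = p * (i * j) by rewrite mulrACA rr.
    rewrite !e -mulrDr mulr1n [RHS]rmorphM; congr (_ * _).
    rewrite -!natrM -natrD [RHS]rmorph_nat; clear trE yx.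
    by elim/ord2P: x; elim/ord2P: x'.
- move=> x y.
  rewrite (eq_bigr (fun j => site_overlap erasure_ker j j x y)) //.
  under eq_bigr do rewrite erasure_overlap.
  rewrite (sum_ord3 (fun j => erasure_entry j 0 x * erasure_entry j 0 y + (erasure_entry j 1 x *
  erasure_entry j 1 y + erasure_entry j 2 x * erasure_entry j 2 y))) /erasure_entry.
  elim/ord2P: x; elim/ord2P: y; rewrite /= ?mulr0n ?mulr1n; ring: ss rr.
- by move=> j; rewrite /erasure_prob; case: ifP => _ //; rewrite divr_ge0.
- by rewrite (sum_ord3 erasure_prob) /erasure_prob /=; field.
- move=> j; rewrite /erasure_prob /erasure_ker /erasure_entry; case: ifP => _ h y x.
    by rewrite /s h sqrtr0 mul0r.
  by move/eqP: h; rewrite mulf_eq0 invr_eq0 pnatr_eq0 orbF /r => /eqP ->; rewrite sqrtr0 mul0r.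
- rewrite /site_weight; under eq_bigr do under eq_bigr do rewrite erasure_overlap_sqr.
  pose f (a c : nat) := (Num.sqrt (erasure_prob a) * Num.sqrt (erasure_prob c))^-1 *
    (if (a == 0%N) && (c == 0%N) then 2 * (s * s) ^+ 2
  else if (a == 0%N) || (c == 0%N) then 0 else (r * r) ^+ 2).
  rewrite (sum_ord3 (fun a => \sum_(c < 3) f a c)) !(sum_ord3 (f _)) /f /erasure_prob /=.
  rewrite -/s sq ss rr !mulr0 !addr0 mulrCA mulV_sqr pp; lra.
rewrite /site_weight; under eq_bigr do under eq_bigr do rewrite erasure_overlap_tr.
under eq_bigr => a _.
  rewrite (bigD1 a) //= big1 ?addr0 ?eqxx => [|c /negbTE h]; last first.
    by rewrite eq_sym h expr0n mulr0.
  over.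
pose f (a : nat) := (Num.sqrt (erasure_prob a) * Num.sqrt (erasure_prob a))^-1 *
   (if (a == 0%N) then 2 * (s * s) else r * r) ^+ 2.
rewrite (sum_ord3 f) /f /erasure_prob /= sq -/s ss rr exprMn mulrCA mulV_sqr pp; lra.
Qed.
End Erasure.

Section Damping.
Context (p : R).
Hypothesis p01 : 0 <= p <= 1.

Let p0 : 0 <= p. Proof. by case/andP: p01. Qed.
Let p1 : 0 <= 1 - p. Proof. by rewrite subr_ge0; case/andP: p01. Qed.
Let s := Num.sqrt (1 - p).
Let r := Num.sqrt p.
Let ss : s * s = 1 - p. Proof. by rewrite -expr2 sqr_sqrtr. Qed.
Let rr : r * r = p. Proof. by rewrite -expr2 sqr_sqrtr. Qed.

Definition damping_entry (j y x : nat) : R :=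
  if j == 0%N then (if x == 0%N then 1 else s) * (y == x)%:R
  else r * ((y == 0%N) && (x == 1%N))%:R.
Definition damping_prob (j : nat) : R := if j == 0%N then (2 - p) / 2 else p / 2.

Definition damping_ker (j : 'I_2) (y x : 'I_2) : R := damping_entry j y x.

Lemma damping_overlap (a c x y : 'I_2) : site_overlap damping_ker a c x y =
  damping_entry c 0 x * damping_entry a 0 y + damping_entry c 1 x * damping_entry a 1 y.
Proof. exact: (sum_ord2 (fun z => damping_entry c z x * damping_entry a z y)). Qed.

Lemma damping_overlap_sqr (a c : 'I_2) :
  \sum_x \sum_y site_overlap damping_ker a c x y ^+ 2 =
  if (a == 0%N :> nat) && (c == 0%N :> nat) then 1 + (s * s) ^+ 2
  else if (a == 0%N :> nat) || (c == 0%N :> nat) then r * r else (r * r) ^+ 2.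
Proof.
under eq_bigr do under eq_bigr do rewrite damping_overlap.
pose f x y := (damping_entry c 0 x * damping_entry a 0 y + damping_entry c 1 x *
  damping_entry a 1 y) ^+ 2.
rewrite (sum_ord2 (fun x => \sum_(y < 2) f x y)) !(sum_ord2 (f _)) /f /damping_entry.
by move: a c {f} => [[|[|a]] //= _] [[|[|c]] //= _]; ring.
Qed.

Lemma damping_overlap_tr (a c : 'I_2) :
  \sum_x site_overlap damping_ker a c x x =
  if a == c then (if a == 0%N :> nat then 1 + s * s else r * r) else 0.
Proof.
under eq_bigr do rewrite damping_overlap.
rewrite (sum_ord2 (fun x => damping_entry c 0 x * damping_entry a 0 x + damping_entry c 1 x *
  damping_entry a 1 x)) /damping_entry.
by rewrite -val_eqE; move: a c => [[|[|a]] //= _] [[|[|c]] //= _]; ring.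
Qed.

Lemma damping_K0_entry y x : damping_K0 p y x = (damping_entry 0 y x)%:C.
Proof.
by elim/ord2P: y; elim/ord2P: x;
  rewrite !mxE /damping_entry /= ?mulr1 ?mulr0 ?addr0 ?add0r.
Qed.

Lemma damping_K1_entry y x : damping_K1 p y x = (damping_entry 1 y x)%:C.
Proof.
by elim/ord2P: y; elim/ord2P: x; rewrite !mxE /damping_entry /= ?mulr1 ?mulr0.
Qed.

(** The diagonal terms of an identity are 4 / (2 - p) - 2 p and 2 p; the two mixed ones give 4 times
    the root of p / (2 - p). A swap weighs 2 (2 - p) + 2 p = 4. *)
Lemma damping_model n :
  noise_model (@local_noise R 2 2 (damping_channel p) n)
    (1 / (2 - p) + Num.sqrt (p / (2 - p))).
Proof.
have u0 : 0 < 2 - p by case/andP: p01; lra.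
have sq0 : Num.sqrt ((2 - p) / 2) * Num.sqrt ((2 - p) / 2) = (2 - p) / 2.
  by rewrite -expr2 sqr_sqrtr // divr_ge0 // ltW.
have sq1 : Num.sqrt (p / 2) * Num.sqrt (p / 2) = p / 2.
  by rewrite -expr2 sqr_sqrtr // divr_ge0.
have pp := half_sqr p.
apply: (@local_noise_model R 2 'I_2 _ damping_ker (fun j => damping_prob j)).
- move=> x x' y y'.
  rewrite (sum_ord2 (fun j => damping_entry j y x * damping_entry j y' x')).
  have addE (A B : 'M[C]_2) : (A + B) y y' = A y y' + B y y' by rewrite mxE.
  have adjE (A : 'M[C]_2) : (A ^t*) x' y' = (A y' x')^* by rewrite !mxE.
  rewrite /damping_channel addE !mul_delta !adjE !damping_K0_entry !damping_K1_entry.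
  by rewrite !conjCR rmorphD !rmorphM.
- move=> x y.
  rewrite (eq_bigr (fun j => site_overlap damping_ker j j x y)) //.
  under eq_bigr do rewrite damping_overlap.
  rewrite (sum_ord2 (fun j => damping_entry j 0 x * damping_entry j 0 y +
    damping_entry j 1 x * damping_entry j 1 y)) /damping_entry.
  elim/ord2P: x; elim/ord2P: y; rewrite /= ?mulr0n ?mulr1n; ring: ss rr.
- by move=> j; rewrite /damping_prob; case: ifP => _; rewrite divr_ge0 // ltW.
- by rewrite (sum_ord2 damping_prob) /damping_prob /=; field.
- move=> j; rewrite /damping_prob /damping_ker /damping_entry; case: ifP => _ h y x.
    by move: h; lra.
  by move/eqP: h; rewrite mulf_eq0 invr_eq0 pnatr_eq0 orbF /r => /eqP ->; rewrite sqrtr0 mul0r.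
- rewrite /site_weight; under eq_bigr do under eq_bigr do rewrite damping_overlap_sqr.
  pose f (a c : nat) := (Num.sqrt (damping_prob a) * Num.sqrt (damping_prob c))^-1 *
    (if (a == 0%N) && (c == 0%N) then 1 + (s * s) ^+ 2
  else if (a == 0%N) || (c == 0%N) then r * r else (r * r) ^+ 2).
  rewrite (sum_ord2 (fun a => \sum_(c < 2) f a c)) !(sum_ord2 (f _)) /f /damping_prob /=.
  rewrite sq0 sq1 ss rr pp.
  have -> : Num.sqrt (p / (2 - p)) = (Num.sqrt ((2 - p) / 2) * Num.sqrt (p / 2))^-1 * p / 2.
    have [z|z] := eqVneq p 0; first by rewrite z !mul0r sqrtr0 !mulr0 mul0r.
    have pz : 0 < p by rewrite lt_def z.
    have -> : p / (2 - p) = (p / 2) / ((2 - p) / 2).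
      by field; rewrite gt_eqF.
    rewrite sqrtrM ?divr_ge0 // sqrtrV ?divr_ge0 ?ltW //.
    have a0 : Num.sqrt ((2 - p) / 2) != 0 by rewrite gt_eqF // sqrtr_gt0 divr_gt0.
    have b0 : Num.sqrt (p / 2) != 0 by rewrite gt_eqF // sqrtr_gt0 divr_gt0.
    rewrite -mulrA; move: a0 b0 sq1.
    move: (Num.sqrt (p / 2)) (Num.sqrt ((2 - p) / 2)) => b a a0 b0 <-.
    by field; rewrite a0 b0.
  rewrite [Num.sqrt (p / 2) * _]mulrC.
  have -> : ((2 - p) / 2)^-1 * (1 + (1 - p) ^+ 2) = 4 * (1 / (2 - p)) - 2 * p.
    by field; rewrite gt_eqF.
  move: (_^-1 * p) (1 / (2 - p)) => x y; lra.
rewrite /site_weight; under eq_bigr do under eq_bigr do rewrite damping_overlap_tr.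
under eq_bigr => a _.
  rewrite (bigD1 a) //= big1 ?addr0 ?eqxx => [|c /negbTE h]; last first.
    by rewrite eq_sym h expr0n mulr0.
  over.
pose f (a : nat) := (Num.sqrt (damping_prob a) * Num.sqrt (damping_prob a))^-1 *
   (if (a == 0%N) then 1 + s * s else r * r) ^+ 2.
rewrite (sum_ord2 f) /f /damping_prob /= sq0 sq1 ss rr pp.
have -> : ((2 - p) / 2)^-1 * (1 + (1 - p)) ^+ 2 = 2 * (2 - p).
  by field; rewrite gt_eqF.
lra.
Qed.
End Damping.
End Channels.

(** * Correlated noise on an open chain *)

Section ChainBound.
Context (R : realFieldType) (T : finType).

Lemma ffun_cons0 n (x : T) (f : {ffun 'I_n -> T}) : ffun_cons x f ord0 = x.
Proof. by rewrite ffunE unlift_none. Qed.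

Lemma ffun_consS n (x : T) (f : {ffun 'I_n -> T}) i :
  ffun_cons x f (lift ord0 i) = f i.
Proof. by rewrite ffunE liftK. Qed.

Lemma chain_bound N (f : 'I_N -> T -> T -> R) (B : 'I_N -> R) u :
  (forall l x y, 0 <= f l x y) -> (forall l x, \sum_y f l x y <= B l) ->
  \sum_(y : {ffun 'I_N -> T}) \prod_l f l (ffun_cons u y (widen_ord (leqnSn N) l))
    (ffun_cons u y (lift ord0 l)) <= \prod_l B l.
Proof.
elim: N f B u => [|N IH] f B u f0 fB.
  rewrite big_ord0 (eq_bigr (fun=> 1)) => [|y _]; last by rewrite big_ord0.
  by rewrite sumr_const card_ffun card_ord expn0.
have B0 l : 0 <= B l by apply: le_trans (fB l u); apply: sumr_ge0.
rewrite sum_ffun_cons big_ord_recl.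
apply: (@le_trans _ _ (\sum_x f ord0 u x * \prod_l B (lift ord0 l))).
  apply: ler_sum => x _.
  apply: le_trans (ler_wpM2l (f0 ord0 u x)
    (IH (fun l => f (lift ord0 l)) (fun l => B (lift ord0 l)) x _ _)) => //.
  rewrite mulr_sumr; apply: ler_sum => y _; rewrite le_eqVlt; apply/orP; left; apply/eqP.
  rewrite big_ord_recl ffun_consS ffun_cons0.
  have -> : widen_ord (leqnSn N.+1) ord0 = ord0 by apply: val_inj.
  rewrite ffun_cons0; congr (_ * _); apply: eq_bigr => l _; rewrite ffun_consS.
  have -> : widen_ord (leqnSn N.+1) (lift ord0 l) = lift ord0 (widen_ord (leqnSn N) l).
    exact: val_inj.
  by rewrite ffun_consS.
rewrite -mulr_suml; apply: ler_wpM2r => //; exact: prodr_ge0.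
Qed.

End ChainBound.

Section SpinChain.
Context (R : realType).

Definition spin n (x : qubits n) (i : 'I_n) : R := (-1) ^+ (x i).

Definition link_sign n (l : 'I_n.-1) (x : qubits n) : R :=
  spin x (this_site l) * spin x (next_site l).

Lemma spin_sqr n (x : qubits n) i : spin x i * spin x i = 1.
Proof. by rewrite -expr2 sqrr_sign. Qed.

Lemma link_sign_sqr n (l : 'I_n.-1) x : link_sign l x * link_sign l x = 1.
Proof. by rewrite mulrACA !spin_sqr mulr1. Qed.

Definition same_spin n (t : 'I_n -> bool) (x y : qubits n) : R :=
  \prod_i (if t i then (x i == y i)%:R else 1).

(** The sites of [y] are summed from left to right. Under an identity the value is forced and the
    incoming link contributes at most 1 + r; under a swap the two values contribute 1 + r and 1 - r
    in some order. The first site has no incoming link and gives 1 or 2. *)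
Lemma same_spin_bound n (t : 'I_n -> bool) (x : qubits n) (r : R) : 0 <= r -> r <= 1 ->
  \sum_y same_spin t x y * \prod_l (1 + r * (link_sign l x * link_sign l y)) <=
  \prod_i (if t i then 1 + r else 2).
Proof.
move=> r_ge0 r_le1; case: n t x => [|n] t x.
  rewrite [leRHS]big_ord0 (eq_bigr (fun=> 1)) => [|y _].
    by rewrite sumr_const card_ffun !card_ord expn0.
  by rewrite /same_spin !big_ord0 mulr1.
pose sg (v : 'I_2) : R := (-1) ^+ v.
pose B i : R := if t i then 1 + r else 2.
pose h (i : 'I_n.+1) (v : 'I_2) : R := if t i then (x i == v)%:R else 1.
pose f (l : 'I_n) (u v : 'I_2) : R :=
  (1 + r * (link_sign (l : 'I_n.+1.-1) x * (sg u * sg v))) * h (lift ord0 l) v.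
have ls1 l : link_sign (l : 'I_n.+1.-1) x = 1 \/ link_sign (l : 'I_n.+1.-1) x = -1.
  have := link_sign_sqr (l : 'I_n.+1.-1) x; rewrite -expr2 => /eqP.
  by rewrite sqrf_eq1 => /orP[]/eqP ->; [left|right].
have sg1 v : sg v = 1 \/ sg v = -1.
  by rewrite /sg -signr_odd; case: odd; [right|left].
have f_ge0 l u v : 0 <= f l u v.
  apply: mulr_ge0; last by rewrite /h; case: (t _).
  case: (ls1 l) => ->; case: (sg1 u) => ->; case: (sg1 v) => ->; lra.
have f_sum l u : \sum_v f l u v <= B (lift ord0 l).
  rewrite /f /h /B; case: (t _).
    rewrite (bigD1 (x (lift ord0 l))) //= big1 ?addr0 => [|v /negbTE e].
      rewrite eqxx mulr1; case: (ls1 l) => ->; case: (sg1 u) => ->.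
        by case: (sg1 (x (lift ord0 l))) => ->; lra.
        by case: (sg1 (x (lift ord0 l))) => ->; lra.
        by case: (sg1 (x (lift ord0 l))) => ->; lra.
        by case: (sg1 (x (lift ord0 l))) => ->; lra.
    by rewrite eq_sym e mulr0.
  rewrite (sum_ord2 (fun v : nat => (1 + r * (link_sign (l : 'I_n.+1.-1) x *
    (sg u * (-1) ^+ v))) * 1)).
  by rewrite expr0 expr1 le_eqVlt; apply/orP; left; apply/eqP; ring.
have step u (y : {ffun 'I_n -> 'I_2}) :
    same_spin t x (ffun_cons u y) * \prod_l (1 + r * (link_sign l x *
      link_sign l (ffun_cons u y))) =
    h ord0 u * \prod_l f l (ffun_cons u y (widen_ord (leqnSn n) l))
      (ffun_cons u y (lift ord0 l)).
  rewrite /same_spin big_ord_recl ffun_cons0 -mulrA; congr (_ * _).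
  rewrite [RHS]big_split [RHS]mulrC; congr (_ * _).
  apply: eq_bigr => l _; congr (1 + r * (_ * _)).
  by rewrite /link_sign /spin; congr (_ * _); congr (_ ^+ _);
    congr (nat_of_ord (ffun_cons u y _)); apply: val_inj.
rewrite sum_ffun_cons (eq_bigr _ (fun u _ => eq_bigr _ (fun y _ => step u y))).
apply: (@le_trans _ _ (\sum_u h ord0 u * \prod_l B (lift ord0 l))).
  apply: ler_sum => u _; rewrite -mulr_sumr; apply: ler_wpM2l.
    by rewrite /h; case: (t _).
  exact: chain_bound.
rewrite -mulr_suml [leRHS]big_ord_recl; apply: ler_wpM2r.
  by apply: prodr_ge0 => l _; rewrite /B; case: (t _); lra.
rewrite /h; case: (t _); last by rewrite sumr_const card_ord.
rewrite (bigD1 (x ord0)) //= big1 ?addr0 ?eqxx => [|v /negbTE e].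
  by rewrite mulr1n lerDl.
by rewrite eq_sym e.
Qed.

End SpinChain.

Section ZZCoupling.
Context (R : realType) (p : R) (n : nat).
Local Notation C := R[i].
Local Notation S := (qubits n).
Hypothesis p01 : 0 <= p <= 1.

Let p0 : 0 <= p. Proof. by case/andP: p01. Qed.
Let p1 : 0 <= 1 - p. Proof. by rewrite subr_ge0; case/andP: p01. Qed.

Definition diag_op (f : S -> R) : qop R S := mkop (fun x y => ((x == y)%:R * f x)%:C).

Lemma diag_opE f x y : rentry (diag_op f) x y = ((x == y)%:R * f x)%:C.
Proof. exact: rentryE. Qed.

Lemma diag_op_mul f (X : qop R S) x y :
  rentry (diag_op f *m X) x y = (f x)%:C * rentry X x y.
Proof.
rewrite rentryM (bigD1 x) //= big1 ?addr0 => [|z /negbTE h].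
  by rewrite diag_opE eqxx mul1r.
by rewrite diag_opE eq_sym h mul0r rmorph0 mul0r.
Qed.

Lemma mul_diag_op f (X : qop R S) x y :
  rentry (X *m diag_op f) x y = rentry X x y * (f y)%:C.
Proof.
rewrite rentryM (bigD1 y) //= big1 ?addr0 => [|z /negbTE h].
  by rewrite diag_opE eqxx mul1r.
by rewrite diag_opE h mul0r rmorph0 mulr0.
Qed.

Lemma diag_op_adj f : (diag_op f) ^t* = diag_op f.
Proof.
apply: rentryP => x y; rewrite rentry_adj !diag_opE conjCR eq_sym.
by case: eqP => [->|] //; rewrite !mul0r.
Qed.

Lemma site_opZ i : site_op i (pauliZ R) = diag_op (fun x => spin R x i).
Proof.
apply: rentryP => x y; rewrite diag_opE rentryE pauli_entryZ /=.
case: (x =P y) => [->|ne].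
  rewrite eqxx mul1r /spin.
  have -> : [forall j, (j != i) ==> (y j == y j)] by apply/forallP => j; rewrite eqxx implybT.
  by rewrite mul1r; congr (_%:C); elim/ord2P: (y i).
rewrite mul0r; case: forallP => [h|]; last by rewrite mul0r.
case: eqP => [e|]; last by rewrite mul1r.
case: ne; apply/ffunP => j; have := h j; case: eqP => [->|_ /eqP //] _.
exact: val_inj.
Qed.

Lemma zz_step_entry l (X : qop R S) x y :
  rentry (zz_step p l X) x y =
  (1 - p + p * (link_sign R l x * link_sign R l y))%:C * rentry X x y.
Proof.
have addE (A B : qop R S) : rentry (A + B) x y = rentry A x y + rentry B x y.
  by rewrite /rentry mxE.
have scaleE c (A : qop R S) : rentry (c *: A) x y = c * rentry A x y.
  by rewrite /rentry mxE.
rewrite /zz_step /= !site_opZ addE !scaleE mulmxA !mul_diag_op -!mulmxA !diag_op_mul.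
rewrite !(rmorphD, rmorphM) /=; ring.
Qed.

Definition bit_prob (u : bool) : R := if u then p else 1 - p.
Definition bit_sign (u : bool) (s : R) : R := if u then s else 1.

(** The diagonal of the Kraus operator in which Z Z has acted on the set [e] of links. *)
Definition zz_ker (e : {ffun 'I_n.-1 -> bool}) (x : S) : R :=
  \prod_l (Num.sqrt (bit_prob (e l)) * bit_sign (e l) (link_sign R l x)).
Definition zz_prob (e : {ffun 'I_n.-1 -> bool}) : R := \prod_l bit_prob (e l).

Let bit_prob_ge0 u : 0 <= bit_prob u. Proof. by case: u. Qed.
Let zz_prob_ge0 e : 0 <= zz_prob e. Proof. exact: prodr_ge0. Qed.

Let sum_prod (F : 'I_n.-1 -> bool -> R) :
  \prod_l \sum_u F l u = \sum_(e : {ffun 'I_n.-1 -> bool}) \prod_l F l (e l).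
Proof. exact: bigA_distr_bigA. Qed.

Lemma sum_zz_ker x y : \sum_e zz_ker e x * zz_ker e y =
  \prod_l (1 - p + p * (link_sign R l x * link_sign R l y)).
Proof.
transitivity (\prod_l \sum_u Num.sqrt (bit_prob u) * bit_sign u (link_sign R l x) *
    (Num.sqrt (bit_prob u) * bit_sign u (link_sign R l y))).
  by rewrite sum_prod; apply: eq_bigr => e _; rewrite -big_split.
apply: eq_bigr => l _; rewrite big_bool /bit_sign /=.
have sp : Num.sqrt p * Num.sqrt p = p by rewrite -expr2 sqr_sqrtr.
have sq : Num.sqrt (1 - p) * Num.sqrt (1 - p) = 1 - p by rewrite -expr2 sqr_sqrtr.
by rewrite !mulr1 mulrACA sp sq addrC.
Qed.

Lemma zz_noise_kraus (X : qop R S) :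
  zz_noise p X = kraus_map (fun e => diag_op (zz_ker e)) X.
Proof.
apply: rentryP => x y; rewrite rentry_sum.
under eq_bigr do rewrite diag_op_adj mul_diag_op diag_op_mul mulrAC -rmorphM.
rewrite -mulr_suml -rmorph_sum sum_zz_ker /zz_noise -big_enum /=.
elim: (enum _) => [|l s IH] /=; first by rewrite big_nil mul1r.
by rewrite zz_step_entry IH big_cons rmorphM mulrA.
Qed.

Let r : R := 2 * (Num.sqrt p * Num.sqrt (1 - p)).

Let r_ge0 : 0 <= r. Proof. by rewrite mulr_ge0 ?mulr_ge0 ?sqrtr_ge0. Qed.

Let sqr_sum : (Num.sqrt (1 - p) + Num.sqrt p) ^+ 2 = 1 + r.
Proof. by rewrite sqrrD !sqr_sqrtr // /r -mulr_natl; ring. Qed.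

Let r_le1 : r <= 1.
Proof.
have := sqr_ge0 (Num.sqrt (1 - p) - Num.sqrt p).
by rewrite sqrrB !sqr_sqrtr // /r -mulr_natl; lra.
Qed.

(** As the Kraus operators are diagonal, a swap imposes nothing and an identity forces x and y to
    agree at its site. The sum over both Kraus labels factors over links into (1 - p) + p + r s,
    with s the product of the two link signs. *)
Lemma zz_noise_weight (t : 'I_n -> bool) :
  noise_weight (fun e => diag_op (zz_ker e)) zz_prob t =
  (\sum_x \sum_y same_spin R t x y *
    \prod_l (1 + r * (link_sign R l x * link_sign R l y)))%:C.
Proof.
have E a b : \sum_(x : S) \sum_(x' : S) \sum_(y : S) \sum_(y' : S)
    (\prod_i @string_op R 'I_2 (t i) ((x i, x' i), (y i, y' i))) *
    (rentry ((diag_op (zz_ker b)) ^t* *m diag_op (zz_ker a)) y' x *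
     (rentry ((diag_op (zz_ker b)) ^t* *m diag_op (zz_ker a)) x' y)^*) =
    (\sum_x \sum_y same_spin R t x y *
      (zz_ker a x * zz_ker b x * (zz_ker a y * zz_ker b y)))%:C.
  rewrite rmorph_sum; apply: eq_bigr => x _; rewrite exchange_big /= rmorph_sum.
  apply: eq_bigr => y _; rewrite diag_op_adj.
  under eq_bigr do under eq_bigr do rewrite !mul_diag_op !diag_opE.
  rewrite (bigD1 y) //= [X in _ + X]big1 ?addr0 => [|x' /negbTE h]; last first.
    by apply: big1 => y' _; rewrite h mulr0n !(mul0r, rmorph0, conjC0, mulr0).
  rewrite (bigD1 x) //= [X in _ + X]big1 ?addr0 => [|y' /negbTE h]; last first.
    by rewrite h mulr0n !(mul0r, rmorph0, mulr0).
  rewrite !eqxx !mul1r -!rmorphM conjCR [RHS]rmorphM /=.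
  congr (_ * _); last by rewrite -rmorphM; congr (_%:C); ring.
  rewrite rmorph_prod; apply: eq_bigr => i _; rewrite /string_op.
  case: (t i) => /=; last by rewrite !eqxx.
  by rewrite [y i == _]eq_sym andbb rmorph_nat.
rewrite /noise_weight; under eq_bigr do under eq_bigr do rewrite E -rmorphM.
under eq_bigr do rewrite -rmorph_sum; rewrite -rmorph_sum /=; congr (_%:C).
under eq_bigr do under eq_bigr do rewrite mulr_sumr.
under eq_bigr do rewrite exchange_big /=; rewrite exchange_big /=.
apply: eq_bigr => x _.
under eq_bigr do under eq_bigr do rewrite mulr_sumr.
under eq_bigr do rewrite exchange_big /=; rewrite exchange_big /=.
apply: eq_bigr => y _.
under eq_bigr do under eq_bigr do rewrite mulrCA.
under eq_bigr do rewrite -mulr_sumr; rewrite -mulr_sumr; congr (_ * _).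
pose g l u v : R := Num.sqrt (bit_prob u) * Num.sqrt (bit_prob v) *
  (bit_sign u (link_sign R l x * link_sign R l y) * bit_sign v (link_sign R l x * link_sign R l y)).
transitivity (\prod_l \sum_u \sum_v g l u v).
  rewrite sum_prod; apply: eq_bigr => a _; rewrite sum_prod; apply: eq_bigr => b _.
  rewrite /zz_prob !sqrt_prod // /zz_ker -!big_split -prodfV -big_split.
  apply: eq_bigr => l _; rewrite /g.
  have bs u s s' : bit_sign u s * bit_sign u s' = bit_sign u (s * s').
    by case: u; rewrite /= ?mulr1.
  move: (link_sign R l x) (link_sign R l y) => X Y; rewrite -!bs /=.
  move: (Num.sqrt (bit_prob (a l))) (Num.sqrt (bit_prob (b l))) => A B.
  rewrite -[in RHS](mulV_sqr (A * B)) -[RHS]mulrA; congr (_ * _); ring.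
apply: eq_bigr => l _; rewrite !big_bool /g /bit_sign /bit_prob /=.
have s2 : link_sign R l x * link_sign R l y * (link_sign R l x * link_sign R l y) = 1.
  by rewrite mulrACA !link_sign_sqr mulr1.
by rewrite s2 !mulr1 -!expr2 !sqr_sqrtr // /r; ring.
Qed.

Lemma zz_model :
  noise_model (@zz_noise R p n) ((Num.sqrt (1 - p) + Num.sqrt p) ^+ 2 / 2).
Proof.
exists {ffun 'I_n.-1 -> bool}, (fun e => diag_op (zz_ker e)), zz_prob; split.
- exact: zz_noise_kraus.
- split=> //.
    rewrite /zz_prob -(sum_prod (fun _ => bit_prob)) big1 // => l _.
    by rewrite big_bool /= addrC subrK.
  move=> e /eqP/prodf_eq0[l _ /eqP h]; apply: rentryP => x y.
  rewrite diag_opE /zz_ker (bigD1 l) //= h sqrtr0 !mul0r mulr0.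
  by rewrite /rentry mxE.
- apply: rentryP => x y; rewrite rentry_sum rentry1.
  under eq_bigr do rewrite diag_op_adj mul_diag_op diag_opE -rmorphM -mulrA.
  rewrite -rmorph_sum -mulr_sumr sum_zz_ker; case: eqP => [->|_] /=; last by rewrite mul0r.
  rewrite mul1r big1 // => l _.
  by rewrite link_sign_sqr mulr1 subrK.
move=> t; rewrite zz_noise_weight lecR.
apply: le_trans (ler_sum _ (fun x _ => same_spin_bound t x r_ge0 r_le1)) _.
have -> (c : R) : \sum_(x : S) c = 2 ^+ n * c.
  by rewrite sumr_const card_ffun !card_ord -[LHS]mulr_natl natrX.
have -> : (2 : R) ^+ n = \prod_(i < n) 2 by rewrite prodr_const card_ord.
have -> : (4 : R) ^+ n = \prod_(i < n) 4 by rewrite prodr_const card_ord.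
rewrite -!big_split sqr_sum le_eqVlt; apply/orP; left; apply/eqP.
by apply: eq_bigr => i _ /=; case: (t i); field.
Qed.

End ZZCoupling.

(** * The expected Choi error *)

Section Expectation.
Context (R : realType) (d : measure_display) (T : measurableType d).
Context (P : probability T R).

(* The integral of a nonnegative function is a supremum over the simple
   functions below it, so no measurability of [X] is needed. *)
Lemma expectation_le_affine (X Q : T -> R) (a b : R) :
  bmeas (fun w => (Q w)%:C) -> (forall w, 0 <= X w) ->
  (forall w, X w <= a + b * Q w) ->
  ('E_P[X] <= (a + b * \int[P]_w Q w)%:E)%E.
Proof.
move=> bQ X0 XQ.
pose G w := a + b * Q w.
have bG : bmeas (fun w => (G w)%:C).
  under eq_fun do rewrite /G rmorphD rmorphM.
  by apply: bmeasD; [exact: bmeas_cst|apply: bmeasZ].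
have iG := bmeas_integrableRe P bG.
have -> : a + b * \int[P]_w Q w = \int[P]_w G w.
  transitivity (complex.Re (cmean P (fun w => a%:C + b%:C * (Q w)%:C))).
    by rewrite cmeanD ?cmeanZ ?cmean_cst //=; [rewrite mul0r subr0|exact: bmeas_cst|exact: bmeasZ].
  by rewrite /cmean /=; apply: eq_Rintegral => w _; rewrite /G mul0r subr0.
rewrite /Rintegral fineK; last first.
  by have := integrable_fin_num (@measurableT _ T) iG.
have G0 w : (0 <= (G w)%:E)%E by rewrite lee_fin (le_trans (X0 w)).
rewrite unlock !ge0_integralTE //.
apply: ereal_sup_le => _ [h hX <-].
by exists h => // w; apply: le_trans (hX w) _; rewrite lee_fin.
Qed.

End Expectation.

(* AM-GM for x^4, y^4, y^4, y^4. *)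
Lemma fourth_root_tangent (R : realFieldType) (x y : R) : 0 <= x -> 0 < y ->
  x <= y * (3 / 4) + (4 * y ^+ 3)^-1 * x ^+ 4.
Proof.
move=> x0 y0; have y3 : 0 < 4 * y ^+ 3 by rewrite mulr_gt0 // exprn_gt0.
rewrite -(ler_pM2l y3) mulrDr mulVKf ?gt_eqF // -subr_ge0.
have -> : 4 * y ^+ 3 * (y * (3 / 4)) + x ^+ 4 - 4 * y ^+ 3 * x =
   (x - y) ^+ 2 * ((x + y) ^+ 2 + 2 * y ^+ 2) by field.
by rewrite mulr_ge0 ?sqr_ge0 // addr_ge0 ?sqr_ge0 // mulr_ge0 ?sqr_ge0.
Qed.

Section ChoiExpectation.
Context (R : realType) (k m b : nat).
Local Notation C := R[i].
Local Notation Q := (qubits m).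
Local Notation N := (#|{: Q * Q}|).
Context (noise : qop R (qubits (k * m)) -> qop R {ffun 'I_(k * m) -> 'I_b}).
Context (w : R) (pos : 'I_k -> 'I_m).
Context (d : nat) (disp : measure_display) (Omega : measurableType disp).
Context (P : probability Omega R).
Context (g : 'I_d -> 'I_(k./2) -> {RV P >-> borel_mx R N}).
Hypothesis noise_w : noise_model noise w.
Hypothesis k_even : ~~ odd k.

Definition random_choi (o : Omega) : R :=
  choi_error noise (encoder pos (brickwork_op (fun l i => g l i o))).

Let gates_unitary o l i :
  (forall l i w, (g l i w : 'M[C]_N) \is unitarymx) ->
  (l < d)%N -> gates_at g o l i \is unitarymx.
Proof. by move=> g_unitary ld; have := gates_atE g o (Ordinal ld) i => /= ->. Qed.

Lemma random_choi_bounds :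
  (forall l i w, (g l i w : 'M[C]_N) \is unitarymx) ->
  exists (J : finType) (K : J -> 'M[C]_(#|{: {ffun 'I_(k * m) -> 'I_b}}|, _)) (lam : J -> R),
    (forall t : 'I_(k * m) -> bool,
      noise_weight K lam t <= (4 ^+ (k * m) * \prod_i (if t i then w else 1))%:C) /\
    forall o, [/\ 0 <= random_choi o, random_choi o <= 1 &
      random_choi o ^+ 4 <=
        overlap_sum (code_kraus pos K (circuit (gates_at g o) d)) lam - 1].
Proof.
move=> g_unitary.
have [J [K [lam [noiseE [lam0 lam1 lamK] K1 Kt]]]] := noise_w.
exists J, K, lam; split=> // o.
have uG l i : (l < d)%N -> gates_at g o l i \is unitarymx by exact: gates_unitary.
have cE : brickwork_op (fun l i => g l i o) = circuit (gates_at g o) d.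
  rewrite -brickwork_circuit; congr brickwork_op; apply/funext => l.
  by apply/funext => i; rewrite gates_atE.
apply: (choi_error_le_overlap (S := qubits (k * m)) [ffun=> 0]) => //.
- by move=> j /lamK h; rewrite /code_kraus h mul0mx.
- exact: code_kraus_tr.
move=> X; rewrite cE encoderE noiseE /kraus_map; apply: eq_bigr => j _.
by rewrite /code_kraus [(K j *m _) ^t*]adjmxM !mulmxA.
Qed.

End ChoiExpectation.

(** The tangent of the fourth root replaces Jensen's inequality, as no measurability of the Choi
    error is established. It is taken at [B] itself, so that a mean of J - 1 below [B] gives
    precisely B^(1/4). *)
Lemma expectation_choi_le (R : realType) (k m b d : nat)
    (noise : qop R (qubits (k * m)) -> qop R {ffun 'I_(k * m) -> 'I_b})
    (w B : R) (pos : 'I_k -> 'I_m) (disp : measure_display)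
    (Omega : measurableType disp) (P : probability Omega R)
    (g : 'I_d.+1 -> 'I_(k./2) ->
         {RV P >-> borel_mx R #|{: qubits m * qubits m}|}) :
  noise_model noise w -> 0 <= w -> (0 < k)%N -> ~~ odd k -> (1 < m)%N ->
  brickwork_ensemble g -> 0 < B ->
  let Y := 4 * (w ^+ m) ^+ 2 in
  let be := (5 / 2 * swap_eta R (qubits m)) ^+ d in
  Y < 1 ->
  Y ^+ k./2 + (1 + be ^+ 2 * ((1 - Y)^-1 * (Y / (1 - Y)))) *
    (1 + be ^+ 2 * (Y / (1 - Y))) ^+ k./2 - 1 <= B ->
  ('E_P[random_choi noise pos g] <= (B `^ (1 / 4))%:E)%E.
Proof.
move=> noise_w w0 k0 k_even m1 [gu indep [mu law gmu]] B0 Y be Y1 YB.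
have cardQ : #|qubits m| = (2 ^ m)%N by rewrite card_ffun !card_ord.
have Q4 : (4 <= #|qubits m|)%N by rewrite cardQ (@leq_exp2l 2 2).
have mu2 : second_moment mu.
  apply: gate_second_moment law; rewrite card_prod.
  by apply: (@leq_trans (4 * 4)); rewrite // leq_mul.
have [J [K [lam [Kt choiP]]]] := random_choi_bounds pos noise_w k_even gu.
have := mean_random_overlap pos k_even k0 Q4 indep gmu mu2 gu w0 Kt Y1.
have := bmeas_random_overlap pos K lam gu.
set Ov := random_overlap _ _ _ _ => bO EO; rewrite -/Y -/be in EO.
pose y := B `^ (1 / 4).
have y0 : 0 < y by rewrite powR_gt0.
have y4 : y ^+ 4 = B.
  by rewrite -powR_mulrn ?ltW // -powRrM divfK ?pnatr_eq0 // powRr1 // ltW.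

have b4 : 0 <= (4 * y ^+ 3)^-1 by rewrite invr_ge0 mulr_ge0 // exprn_ge0 // ltW.
have bQ : bmeas (fun o => (Ov o - 1)%:C).
  under eq_fun do rewrite rmorphB /= -mulN1r.
  apply: bmeasD => //; apply: bmeas_cst.
have E1 : ('E_P[random_choi noise pos g] <=
    (y * (3 / 4) + (4 * y ^+ 3)^-1 * \int[P]_o (Ov o - 1))%:E)%E.
  apply: expectation_le_affine bQ _ _ => o; have [c0 _ c4] := choiP o => //.
  apply: le_trans (fourth_root_tangent c0 y0) _; rewrite lerD2l; exact: ler_wpM2l.
apply: (le_trans E1).
rewrite lee_fin.
have -> : \int[P]_o (Ov o - 1) = \int[P]_o Ov o - 1.
  have -> : \int[P]_o (Ov o - 1) = complex.Re (cmean P (fun o => (Ov o)%:C + (-1)%:C)).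
    by rewrite /cmean /=.
  rewrite cmeanD //; last exact: bmeas_cst.
  by rewrite cmean_cst.
apply: (@le_trans _ _ (y * (3 / 4) + (4 * y ^+ 3)^-1 * B)).
  rewrite lerD2l; apply: ler_wpM2l => //; apply: le_trans YB; by rewrite lerD2r.
rewrite -/y -y4 le_eqVlt; apply/orP; left; apply/eqP.
by field; rewrite gt_eqF.
Qed.

Lemma expectation_choi_le1 (R : realType) (k m b d : nat)
    (noise : qop R (qubits (k * m)) -> qop R {ffun 'I_(k * m) -> 'I_b})
    (w : R) (pos : 'I_k -> 'I_m) (disp : measure_display)
    (Omega : measurableType disp) (P : probability Omega R)
    (g : 'I_d -> 'I_(k./2) ->
         {RV P >-> borel_mx R #|{: qubits m * qubits m}|}) :
  noise_model noise w -> ~~ odd k -> brickwork_ensemble g ->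
  ('E_P[random_choi noise pos g] <= 1)%E.
Proof.
move=> noise_w k_even [gu _ _].
have [J [K [lam [_ choiP]]]] := random_choi_bounds pos noise_w k_even gu.
have := @expectation_le_affine R _ _ P (random_choi noise pos g) (fun=> 0) 1 0.
rewrite mul0r mul0r !addr0; apply; first exact: bmeas_cst.
  by move=> o; have [] := choiP o.
by move=> o; have [] := choiP o.
Qed.

(** * Consequences of the depth formula *)

Section Depth.
Context (R : realType).

Lemma expR_le_linear (z : R) : 0 <= z -> z <= 1 / 2 -> expR z <= 1 + 2 * z.
Proof.
move=> z0 z1; have d0 : 0 < 1 - z by lra.
have h : 1 - z <= expR (- z) by exact: expR_ge1Dx.
have {}h : expR z <= (1 - z)^-1.
  by rewrite -[expR z]opprK -[expR z]invrK -expRN opprK lef_pV2 // posrE ?expR_gt0.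
apply: le_trans h _; rewrite -div1r ler_pdivrMr //.
have : 0 <= z * (1 - 2 * z) by rewrite mulr_ge0 //; lra.
lra.
Qed.

Lemma prod_le_expR (a c z : R) (n : nat) : 0 <= a -> 0 <= c -> 0 <= z ->
  (1 + z * a) * (1 + z * c) ^+ n <= expR (z * (a + n%:R * c)).
Proof.
move=> a0 c0 z0; rewrite mulrDr expRD; apply: ler_pM.
- by rewrite addr_ge0 // mulr_ge0.
- by rewrite exprn_ge0 // addr_ge0 // mulr_ge0.
- exact: expR_ge1Dx.
rewrite mulrCA expRM_natl lerXn2r ?nnegrE ?expR_ge0 ?expR_ge1Dx //.
by rewrite addr_ge0 // mulr_ge0.
Qed.

Lemma brickwork_eta_gt0 m : 0 < brickwork_eta R m.
Proof.
have q0 : 0 < (2 ^ m)%:R :> R by rewrite ltr0n expn_gt0.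
by rewrite divr_gt0 // addr_gt0 // exprn_gt0.
Qed.

Lemma brickwork_eta_le m : brickwork_eta R m <= (2 ^+ m)^-1.
Proof.
have q0 : 0 < (2 : R) ^+ m by rewrite exprn_gt0.
rewrite /brickwork_eta natrX ler_pdivrMr ?addr_gt0 ?exprn_gt0 //.
by rewrite mulrDr expr2 mulKf ?gt_eqF // mulr1 lerDl invr_ge0 ltW.
Qed.

(** With u = 2 eta the formula for D makes k u^D equal to (k / eps)^(log2 u) / (e - 1). Since u <=
    2^(1 - m) and e - 1 >= 1, this is at most (eps / k)^(m - 1), one factor eps / k better than
    stated. *)
Lemma depth_decay (m k D : nat) (eps : R) : (1 < m)%N -> (0 < k)%N ->
  0 < eps < k%:R -> D.+1%:R = brickwork_depth m k eps ->
  k%:R * (2 * brickwork_eta R m) ^+ D <= (eps / k%:R) `^ (m%:R - 2).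
Proof.
move=> m1 k0 /andP[e0 ek]; rewrite /brickwork_depth /log2 -natr1 => /addIr.
set u := 2 * brickwork_eta R m.
have kp : 0 < k%:R :> R by rewrite ltr0n.
have u0 : 0 < u by rewrite mulr_gt0 // brickwork_eta_gt0.
have l2 : 0 < ln (2 : R) by rewrite ln_gt0 // ltr1n.
have lnu : ln u <= (1 - m%:R) * ln 2.
  have -> : (1 - m%:R) * ln 2 = ln (2 * (2 ^+ m)^-1 : R).
    rewrite lnM ?posrE ?invr_gt0 ?exprn_gt0 // lnV ?posrE ?exprn_gt0 //.
    by rewrite lnXn // -[ln 2 *+ m]mulr_natl; ring.
  rewrite ler_ln ?posrE // ?mulr_gt0 ?invr_gt0 ?exprn_gt0 //.
  by rewrite ler_pM2l // brickwork_eta_le.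
have lu : ln u < 0.
  apply: le_lt_trans lnu _; rewrite nmulr_rlt0 // subr_lt0 ltr1n //.
have lV : ln (1 / u) = - ln u by rewrite div1r lnV.
rewrite lV -/u => DE.
have e1 : 1 <= expR 1 - 1 :> R by have := expR_ge1Dx (1 : R); lra.
pose L : R := ln (k%:R / eps).
have L0 : 0 <= L.
  by rewrite ln_ge0 // ler_pdivlMr // mul1r ltW.
have DL : D%:R * ln u = L * (ln u / ln 2) - ln k%:R - ln (expR 1 - 1).
  have l20 : ln 2 != 0 :> R by rewrite gt_eqF.
  have lu0 : ln u != 0 by rewrite lt_eqF.
  rewrite DE -/L; move: l20 lu0; move: (ln 2) (ln u) => y z y0 z0.
  by field; rewrite y0 z0.
have -> : k%:R * u ^+ D = expR (L * (ln u / ln 2) - ln (expR 1 - 1)).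
  rewrite -{1}[k%:R](@lnK R) // -{1}[u](@lnK R) // -expRM_natl DL -expRD.
  by congr expR; ring.
have -> : (eps / k%:R) `^ (m%:R - 2) = expR (- (m%:R - 2) * L).
  rewrite /powR gt_eqF ?divr_gt0 //; congr expR.
  have -> : eps / k%:R = (k%:R / eps)^-1 by rewrite invf_div.
  by rewrite lnV ?posrE ?divr_gt0 // -/L mulrN mulNr.
rewrite ler_expR.
have le1 : 0 <= ln (expR 1 - 1 : R) by exact: ln_ge0.
have : L * (ln u / ln 2) <= L * (1 - m%:R).
  by apply: ler_wpM2l => //; rewrite ler_pdivrMr.
set X := L * (ln u / ln 2) => h.
have -> : - (m%:R - 2) * L = L * (1 - m%:R) + L by ring.
lra.
Qed.

(** Split (5/2 eta)^2 = (2 eta) (25/8 eta). [depth_decay] uses up the first factor. For m >= 3 one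
    has eta <= 1/8, so the second is at most 1/2 and its D-th power beats the constant 2 A once D >=
    N0. That holds uniformly in eps: k (2 eta)^D <= 1 forces D to be large when [k] is. *)
Lemma depth_uniform (m : nat) (A : R) : (2 < m)%N -> 0 <= A ->
  exists k0 : nat, forall (k D : nat) (eps : R), (k0 <= k)%N -> (0 < k)%N ->
    0 < eps < k%:R -> D.+1%:R = brickwork_depth m k eps ->
    2 * (((5 / 2 * brickwork_eta R m) ^+ D) ^+ 2 * (k%:R * A)) <=
      (eps / k%:R) `^ (m%:R - 2).
Proof.
move=> m2 A0; pose u := 2 * brickwork_eta R m.
have eta0 := brickwork_eta_gt0 m.
have eta8 : brickwork_eta R m <= 8^-1.
  apply: le_trans (brickwork_eta_le m) _; rewrite lef_pV2 ?posrE ?exprn_gt0 //.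
  rewrite (_ : 8 = 2 ^+ 3); last by rewrite -natrX.
  by rewrite ler_weXn2l // ler1n.
have u0 : 0 < u by rewrite mulr_gt0.
have u1 : u <= 1 by rewrite /u; lra.
pose N0 := (Num.truncn (2 * A)).+1.
have AN : 2 * A <= 2 ^+ N0.
  apply: (@le_trans _ _ N0%:R); first by rewrite ltW // truncnS_gt.
  by rewrite -natrX ler_nat ltnW // ltn_expl.
pose k0 := (Num.truncn (u ^- N0)).+1.
have kN : u ^- N0 < k0%:R by exact: truncnS_gt.
exists k0 => k D eps kk k_gt0 ek dE.
have kp : 0 < k%:R :> R by rewrite ltr0n.
have dec := depth_decay (ltnW m2) k_gt0 ek dE; rewrite -/u in dec.
set t := (eps / k%:R) `^ _ in dec *.
have t1 : t <= 1.
  case/andP: ek => e0 ek; rewrite -[leRHS](powRr0 (eps / k%:R)) /t.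
  rewrite ger_powR // ?subr_ge0 ?ler_nat ?(ltnW m2) //.
  by rewrite divr_gt0 //= ler_pdivrMr // mul1r ltW.
have DN : (N0 <= D)%N.
  rewrite leqNgt; apply/negP => DN.
  have : k%:R * u ^+ N0 <= 1.
    apply: le_trans (le_trans dec t1); apply: ler_wpM2l; first exact: ltW.
    by apply: ler_wiXn2l; rewrite ?(ltW u0) // ltnW.
  rewrite leNgt => /negP; apply; rewrite -ltr_pdivrMr ?exprn_gt0 // div1r.
  by apply: lt_le_trans kN _; rewrite ler_nat.
have -> : ((5 / 2 * brickwork_eta R m) ^+ D) ^+ 2 =
    u ^+ D * (25 / 8 * brickwork_eta R m) ^+ D.
  rewrite -exprM mulnC exprM -exprMn; congr (_ ^+ _); rewrite /u; by field.
apply: le_trans dec.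
have -> (x y : R) : 2 * (x * y * (k%:R * A)) = k%:R * x * (2 * A * y) by ring.
apply: ler_piMr; first by rewrite mulr_ge0 ?exprn_ge0 // ltW.
apply: (@le_trans _ _ (2 ^+ D * (2^-1) ^+ D)); last first.
  by rewrite -exprMn mulfV ?expr1n // pnatr_eq0.
apply: ler_pM.
- by rewrite mulr_ge0.
- by rewrite exprn_ge0 // mulr_ge0 // ltW.
- by apply: le_trans AN _; rewrite ler_weXn2l // ler1n.
rewrite lerXn2r ?nnegrE ?mulr_ge0 ?(ltW eta0) //; lra.
Qed.

End Depth.

Section ChoiBound.
Context (R : realType) (m b : nat).
Context (noise : forall n : nat, qop R (qubits n) -> qop R {ffun 'I_n -> 'I_b}).
Context (w c : R).
Hypothesis noise_w : forall n, noise_model (@noise n) w.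

Let exponentE (k : nat) : (0 < k)%N -> (k * m)%N%:R / k%:R = m%:R :> R.
Proof. by move=> k0; rewrite natrM mulrC mulKf // pnatr_eq0 -lt0n. Qed.

Lemma choi_bound_small : (m <= 2)%N -> brickwork_choi_bound m noise c.
Proof.
move=> m2; exists 0%N => k eps d n k0 k_even _ /andP[e0 ek] _ _ pos disp Omega P g ens.
apply: le_trans (expectation_choi_le1 pos (noise_w _) k_even ens) _.
rewrite lee_fin; apply: (@le_trans _ _ (1 `^ (1 / 4))); first by rewrite powR1.
apply: ge0_ler_powR.
- by rewrite divr_ge0.
- by rewrite nnegrE.
- by rewrite nnegrE addr_ge0 // powR_ge0.
apply: (@le_trans _ _ ((eps / k%:R) `^ (n%:R / k%:R - 2))); last by rewrite lerDr powR_ge0.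
rewrite exponentE // -[leLHS](powRr0 (eps / k%:R)); apply: ger_powR.
  by rewrite divr_gt0 ?ltr0n //= ler_pdivrMr ?ltr0n // mul1r ltW.
by rewrite subr_le0 ler_nat.
Qed.

(** The all-identity string gives (2 w^m)^k. The rest has the form (1 + s mu) (1 + s kap)^(k/2) - 1
    <= expR z - 1 with [z] of order k s, where [s] is the square of the total contraction, so that
    [depth_uniform] applies. *)
Lemma choi_bound_large : (2 < m)%N -> 0 <= w -> 2 * w ^+ m < 1 ->
  2 * w ^+ m <= 2 `^ (- (m%:R * c)) -> brickwork_choi_bound m noise c.
Proof.
move=> m2 w0 w1 wc; pose y := 2 * w ^+ m; pose Y := 4 * (w ^+ m) ^+ 2.
have y0 : 0 <= y by rewrite mulr_ge0 // exprn_ge0.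
have YE : Y = y ^+ 2 by rewrite /Y /y; ring.
have Y0 : 0 <= Y by rewrite YE exprn_ge0.
have Y1 : Y < 1 by rewrite YE exprn_ilt1.
have d0 : 0 <= (1 - Y)^-1 by rewrite invr_ge0 subr_ge0 ltW.
pose kap := Y / (1 - Y); pose mu := (1 - Y)^-1 * kap.
have kap0 : 0 <= kap by rewrite mulr_ge0.
have mu0 : 0 <= mu by rewrite mulr_ge0.
have [k0 k0P] := depth_uniform m2 (addr_ge0 mu0 kap0).
exists (k0 * m)%N => k eps d n k_gt0 k_even nk ek d_gt0 dE pos disp Omega P g ens.
have kk : (k0 <= k)%N by move: nk; rewrite leq_pmul2r // (leq_trans _ m2).
case: d d_gt0 dE g ens => // D _ dE g ens.
have := k0P k D eps kk k_gt0 ek dE.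
set t := (eps / k%:R) `^ _ => dec.
have kp : 0 < k%:R :> R by rewrite ltr0n.
have ep : 0 < eps / k%:R by case/andP: ek => e0 _; rewrite divr_gt0.
have t1 : t <= 1.
  case/andP: ek => e0 ek; rewrite -[leRHS](powRr0 (eps / k%:R)) /t.
  rewrite ger_powR // ?subr_ge0 ?ler_nat ?(ltnW m2) //.
  by rewrite ep /= ler_pdivrMr // mul1r ltW.
have -> : (eps / k%:R) `^ (n%:R / k%:R - 2) = t by rewrite exponentE.
have t0 : 0 < t by rewrite powR_gt0.
apply: (expectation_choi_le pos (noise_w _) w0 k_gt0 k_even _ ens).
- exact: ltnW.
- by rewrite addr_gt0 // powR_gt0.
- exact: Y1.
have -> : swap_eta R (qubits m) = brickwork_eta R m.
  by rewrite /swap_eta /brickwork_eta card_ffun !card_ord.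
rewrite -/Y -addrA; apply: lerD.
  have -> : Y ^+ k./2 = y ^+ k.
    rewrite YE -exprM mul2n; congr (_ ^+ _).
    by rewrite -[RHS]odd_double_half (negPf k_even).
  have -> : 2 `^ (- (n%:R * c)) = (2 `^ (- (m%:R * c))) ^+ k.
    by rewrite -powR_mulrn ?powR_ge0 // -powRrM /n natrM; congr (_ `^ _); ring.
  by rewrite lerXn2r ?nnegrE ?powR_ge0.
set s := (_ ^+ D) ^+ 2 in dec *.
have s0 : 0 <= s by rewrite sqr_ge0.
rewrite -/kap -/mu lerBlDl.
pose z := s * (mu + k./2%:R * kap).
have z0 : 0 <= z by rewrite mulr_ge0 // addr_ge0 // mulr_ge0.
(* Used twice: together with t <= 1 it brings [z] into the range of [expR_le_linear], and it bounds
   the resulting 2 z by [t]. *)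
have zk : 2 * z <= t.
  apply: le_trans dec; rewrite ler_pM2l //; apply: ler_wpM2l => //.
  rewrite mulrDr; apply: lerD; first by rewrite ler_peMl // ler1n.
  apply: ler_wpM2r => //; rewrite ler_nat.
  by rewrite -[leqRHS]odd_double_half (negPf k_even) -addnn leq_addr.
apply: le_trans (prod_le_expR k./2 mu0 kap0 s0) _; rewrite -/z.
apply: le_trans (expR_le_linear z0 _) _; lra.
Qed.

Lemma choi_bound : 0 <= w ->
  ((2 < m)%N -> 2 * w ^+ m < 1 /\ 2 * w ^+ m <= 2 `^ (- (m%:R * c))) ->
  brickwork_choi_bound m noise c.
Proof.
move=> w0 h; have [/choi_bound_small//|m2] := leqP m 2.
by have [w1 wc] := h m2; exact: choi_bound_large.
Qed.

End ChoiBound.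

Lemma powR_log2 (R : realType) (m : nat) (w : R) : (0 < m)%N -> 0 < w ->
  2 * w ^+ m = 2 `^ (- (m%:R * (- log2 w - m%:R^-1))).
Proof.
move=> m0 w0; have l2 : ln 2 != 0 :> R by rewrite gt_eqF // ln_gt0 // ltr1n.
have mR : m%:R != 0 :> R by rewrite pnatr_eq0 -lt0n.
rewrite /powR pnatr_eq0 /= /log2.
have -> : - (m%:R * (- (ln w / ln 2) - m%:R^-1)) * ln 2 = ln 2 + m%:R * ln w :> R.
  by field; rewrite l2 mR.
by rewrite expRD expRM_natl !lnK ?posrE.
Qed.

Lemma powR2_lt1 (R : realType) (x : R) : x < 0 -> 2 `^ x < 1.
Proof.
by move=> x0; rewrite /powR pnatr_eq0 /= expR_lt1 pmulr_llt0 // ln_gt0 // ltr1n.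
Qed.

Lemma choi_bound_log2 (R : realType) (m b : nat)
    (noise : forall n : nat, qop R (qubits n) -> qop R {ffun 'I_n -> 'I_b}) (w : R) :
  (forall n, noise_model (@noise n) w) -> (0 < m)%N -> 0 < w ->
  0 < - log2 w - m%:R^-1 -> brickwork_choi_bound m noise (- log2 w - m%:R^-1).
Proof.
move=> nw m0 w0 c0; apply: (choi_bound nw); first exact: ltW.
move=> m2; rewrite (powR_log2 m0 w0); split=> //.
by apply: powR2_lt1; rewrite oppr_lt0 mulr_gt0 // ltr0n.
Qed.

Lemma sum_sqrt4_gt0 (R : realType) (p : nat -> R) : (forall j, 0 <= p j) ->
  p 0%N + (p 1%N + (p 2%N + p 3%N)) = 1 ->
  0 < Num.sqrt (p 0%N) + (Num.sqrt (p 1%N) + (Num.sqrt (p 2%N) + Num.sqrt (p 3%N))).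
Proof.
move=> p0 p1; pose r j := Num.sqrt (p j).
have : r 0%N ^+ 2 + (r 1%N ^+ 2 + (r 2%N ^+ 2 + r 3%N ^+ 2)) = 1.
  by rewrite /r !sqr_sqrtr.
rewrite /r !expr2; clear r.
have r0 j : 0 <= Num.sqrt (p j) by exact: sqrtr_ge0.
move: (r0 0%N) (r0 1%N) (r0 2%N) (r0 3%N).
move: (Num.sqrt (p 0%N)) (Num.sqrt (p 1%N)) (Num.sqrt (p 2%N)) (Num.sqrt (p 3%N)).
move=> a b c d a0 b0 c0 d0 e; rewrite lt_def !addr_ge0 // andbT; apply/eqP => s0.
have [ea eb ec ed] : [/\ a = 0, b = 0, c = 0 & d = 0] by split; lra.
by move/eqP: e; rewrite ea eb ec ed mulr0 !addr0 eq_sym oner_eq0.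
Qed.

Theorem mainTheorem5 (R : realType) (rate : R) (m : nat)
    (hm : (0 < m)%N) (hrate : rate^-1 = m%:R) :
  [/\ (forall pI pX pY pZ : R,
         0 <= pI -> 0 <= pX -> 0 <= pY -> 0 <= pZ ->
         pI + pX + pY + pZ = 1 ->
         0 < 1 - pauli_f pI pX pY pZ - rate ->
         brickwork_choi_bound m (local_noise (pauli_channel pI pX pY pZ))
           (1 - pauli_f pI pX pY pZ - rate)),
      (forall p : R, 0 <= p <= 1 ->
         0 < 1 - log2 (1 + 3 * p) - rate ->
         brickwork_choi_bound m (local_noise (erasure_channel p))
           (1 - log2 (1 + 3 * p) - rate)),
      (forall p : R, 0 <= p <= 1 ->
         0 < - log2 (1 / (2 - p) + Num.sqrt (p / (2 - p))) - rate ->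
         brickwork_choi_bound m (local_noise (damping_channel p))
           (- log2 (1 / (2 - p) + Num.sqrt (p / (2 - p))) - rate)) &
      (forall p : R, 0 <= p <= 1 ->
         0 <= 1 - rate - 2 * (1 + rate) * log2 (Num.sqrt (1 - p) + Num.sqrt p) ->
         brickwork_choi_bound m (zz_noise p)
           (1 - rate - 2 * (1 + rate) * log2 (Num.sqrt (1 - p) + Num.sqrt p)))].
Proof.
have {hrate} -> : rate = m%:R^-1 by rewrite -hrate invrK.
have l2 : 0 < ln 2 :> R by rewrite ln_gt0 // ltr1n.
have half w : 0 < w -> - log2 (w / 2) = 1 - log2 w :> R.
  move=> w0; rewrite /log2 lnM ?posrE // lnV ?posrE // mulrDl mulNr divff ?gt_eqF //.
  by rewrite opprD opprK addrC.
have sq w : 0 < w -> log2 (w ^+ 2) = 2 * log2 w :> R.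
  by move=> w0; rewrite /log2 lnXn // mulr2n; ring.
split.
- move=> pI pX pY pZ hI hX hY hZ h1.
  (* Extended by 0 beyond index 3, since the Pauli model takes a sequence indexed by naturals. *)
  pose p j := nth 0 [:: pI; pX; pY; pZ] j.
  have p0 j : 0 <= p j.
    by move: j => [|[|[|[|j]]]] //=; rewrite /p nth_default.
  have p1 : p 0%N + (p 1%N + (p 2%N + p 3%N)) = 1 by rewrite -h1 /p /=; ring.
  have s0 : 0 < Num.sqrt (p 0%N) + (Num.sqrt (p 1%N) + (Num.sqrt (p 2%N) + Num.sqrt (p 3%N))).
    exact: sum_sqrt4_gt0.
  have -> : 1 - pauli_f pI pX pY pZ = - log2 ((Num.sqrt (p 0%N) + (Num.sqrt (p 1%N)
      + (Num.sqrt (p 2%N) + Num.sqrt (p 3%N)))) ^+ 2 / 2).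
    by rewrite half ?exprn_gt0 // sq // /pauli_f !addrA.
  apply: choi_bound_log2 => // [n|]; first exact: (pauli_model p0 p1).
  by rewrite divr_gt0 // exprn_gt0.
- move=> p p01; have w0 : 0 < 1 + 3 * p by case/andP: p01; lra.
  rewrite -half //; apply: choi_bound_log2 => // [n|]; first exact: erasure_model.
  by rewrite divr_gt0.
- move=> p p01; apply: choi_bound_log2 => // [n|]; first exact: damping_model.
  have u0 : 0 < 2 - p by case/andP: p01; lra.
  by rewrite ltr_pwDl ?sqrtr_ge0 // divr_gt0.
move=> p p01; set s := Num.sqrt (1 - p) + Num.sqrt p => c0.
have /andP[p0 p1] := p01.
have s2 : s ^+ 2 = 1 + 2 * (Num.sqrt (1 - p) * Num.sqrt p).
  by rewrite /s sqrrD !sqr_sqrtr ?subr_ge0 // -mulr_natl; ring.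
have s0 : 0 <= s by rewrite addr_ge0 // sqrtr_ge0.
have s1 : 1 <= s.
  rewrite -(expr_ge1 (n := 2)) // s2 lerDl mulr_ge0 // mulr_ge0 ?sqrtr_ge0 //.
have sp : 0 < s by apply: lt_le_trans s1.
have w0 : 0 < s ^+ 2 / 2 by rewrite divr_gt0 // exprn_gt0.
apply: (@choi_bound R m 2 (@zz_noise R p) (s ^+ 2 / 2)) => [n||m2]; first exact: zz_model.
  exact: ltW.
have ls : 0 <= log2 s by apply: divr_ge0; [exact: ln_ge0|exact: ltW].
set c := (X in 2 `^ (- (m%:R * X))).
have mR : m%:R != 0 :> R by rewrite pnatr_eq0 -lt0n.
rewrite powR_log2 // half ?exprn_gt0 // sq //.
(* The weight yields the coefficient 2 of log2 s, while the claimed exponent has 2 (1 + 1/m); the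
   slack 2 log2 s is what makes the non-strict hypothesis sufficient. *)
have -> : - (m%:R * (1 - 2 * log2 s - m%:R^-1)) = - (m%:R * c) - 2 * log2 s.
  by rewrite /c; field.
have mc : 0 <= m%:R * c by rewrite mulr_ge0.
split; last by rewrite ler_powR ?ler1n // gerBl mulr_ge0.
apply: powR2_lt1.
(* Strictness comes from the slack if s > 1; if s = 1 the exponent is 1 - 1/m, which is positive. *)
move: s1; rewrite le_eqVlt => /orP[/eqP s1|s1].
  have : 0 < m%:R * c.
    rewrite /c -s1 /log2 ln1 mul0r mulr0 subr0 mulr_gt0 ?ltr0n //.
    by rewrite subr_gt0 invf_lt1 ?ltr0n // ltr1n (ltn_trans _ m2).
  lra.
have : 0 < log2 s by rewrite divr_gt0 // ln_gt0.
lra.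
Qed.
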